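(* Let $n$ and $k$ be positive integers and let $\widetilde{T}_n\in\mathcal{R}_n$ act like the $n$-th Hecke operator on periods, i.e. there is $Y\in\mathcal{R}_n$ with $(1-S)\widetilde{T}_n=T_n^\infty(1-S)+(1-T)Y$. Suppose that $\widetilde{T}_n=\sum_{\gamma}v_\gamma\gamma$ (a finite sum with $v_\gamma\in\mathbb{Q}$), where the $\gamma=\begin{bmatrix}a&b\\c&d\end{bmatrix}$ are matrices with non-negative entries. Then for all $x>0$ the derivatives of the higher order Herglotz-Zagier functions $\Phi_r$ satisfy $$\sum_{r=1}^{k}\binom{k}{r}\frac1n\left[\Big(\Phi'_r|_2^{(k-r)}\widetilde{T}_n\Big)(x)-n\sum_{\ell\mid n}\frac{\log^{k-r}(\ell)}{\ell}\Phi'_r(x)\right]=\sum_{r=1}^{k}\binom{k}{r}\tilde\gamma_{k-r}\left[\sum_\gamma v_\gamma\frac{\log^r(ax+b)}{(ax+b)(cx+d)}-\sum_{\ell\mid n}\frac{\log^r(\ell x)}{\ell x}\right],$$ where $\tilde\gamma_0=1$ and $\tilde\gamma_r=-r\gamma_{r-1}$ for $1\le r\le k$, with $\gamma_j$ the $j$-th Stieltjes constant.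
   Context: For a positive integer $n$, $\mathcal{M}_n$ is the set of $2\times2$ integer matrices of determinant $n$ modulo $\{\pm1\}$, $\mathcal{M}=\bigcup_{n\ge 1}\mathcal{M}_n$, $\mathcal{R}_n=\mathbb{Q}[\mathcal{M}_n]$ (finite formal $\mathbb{Q}$-linear combinations), and $\mathcal{R}=\mathbb{Q}[\mathcal{M}]=\bigoplus_n\mathcal{R}_n$ is the ring with multiplication induced by matrix multiplication, $1$ being the class of the identity matrix. Put $T=\begin{bmatrix}1&1\\0&1\end{bmatrix}$, $S=\begin{bmatrix}0&-1\\1&0\end{bmatrix}$, and $T_n^\infty=\sum_{ad=n}\sum_{0\le b<d}\begin{bmatrix}a&b\\0&d\end{bmatrix}\in\mathcal{R}_n$ (sum over positive $a,d$ with $ad=n$). Extended slash operator: for $\gamma=\begin{bmatrix}a&b\\c&d\end{bmatrix}$ and an integer $\ell\ge0$, $(f|_m^{(\ell)}\gamma)(x)=\frac{(ad-bc)^{m/2}}{(cx+d)^m}\log^\ell(cx+d)\,f\left(\frac{ax+b}{cx+d}\right)$, extended linearly to $\sum_\gamma v_\gamma\gamma$; each $\gamma$ is represented by its matrix with non-negative entries, so that $ax+b,cx+d>0$ for $x>0$. Here $\log^j(t)=(\log t)^j$, with $\log^0(t)=1$ (also for $t=1$). Higher order Herglotz-Zagier function: for a positive integer $k$ and $x\in\mathbb{C}\setminus(-\infty,0]$, $$\Phi_k(x)=\sum_{n=1}^\infty\frac{k\,\psi_{k-1}(nx)-\log^k(nx)}{n},$$ where $\psi_k(x)=\Gamma_k'(x)/\Gamma_k(x)$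 is the logarithmic derivative of Dilcher's generalized gamma function $$\Gamma_k(x)=\lim_{N\to\infty}\frac{\exp\left(\frac{\log^{k+1}(N)}{k+1}x\right)\prod_{j=1}^N\exp\left(\frac{\log^{k+1}(j)}{k+1}\right)}{\prod_{j=0}^N\exp\left(\frac{\log^{k+1}(j+x)}{k+1}\right)};$$ equivalently $\psi_k(x)=-\gamma_k(x)$, the negative of the $k$-th generalized Stieltjes constant. $\Phi_k'$ is the derivative of $\Phi_k$. The Stieltjes constants $\gamma_j$ are defined by $\zeta(s)=\frac1{s-1}+\sum_{j\ge0}\frac{(-1)^j\gamma_j}{j!}(s-1)^j$. *)

(* Defs.v *)
From Stdlib Require Import Reals ZArith QArith Qreals List Arith.
From Coquelicot Require Export Coquelicot.
Export ListNotations.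

(** * The ring R = Q[M] *)

Record mat := Mat { ma : Z; mb : Z; mc : Z; md : Z }.

Definition mdet (g : mat) : Z := (ma g * md g - mb g * mc g)%Z.

Definition mopp (g : mat) : mat :=
  Mat (- ma g)%Z (- mb g)%Z (- mc g)%Z (- md g)%Z.

Definition mmul (g h : mat) : mat :=
  Mat (ma g * ma h + mb g * mc h)%Z (ma g * mb h + mb g * md h)%Z
      (mc g * ma h + md g * mc h)%Z (mc g * mb h + md g * md h)%Z.

Definition mat_eqb (g h : mat) : bool :=
  (Z.eqb (ma g) (ma h) && Z.eqb (mb g) (mb h) &&
   Z.eqb (mc g) (mc h) && Z.eqb (md g) (md h))%bool.

Definition nonneg_entries (g : mat) : Prop :=
  (0 <= ma g /\ 0 <= mb g /\ 0 <= mc g /\ 0 <= md g)%Z.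

Definition matI : mat := Mat 1 0 0 1.
Definition matT : mat := Mat 1 1 0 1.
Definition matS : mat := Mat 0 (-1) 1 0.

(** Equality of classes modulo {1, -1}. *)
Definition mat_eqpm (g h : mat) : bool := (mat_eqb g h || mat_eqb g (mopp h))%bool.

(** An element of Q[M] is presented by a list of terms [(v, g)], standing for
    the sum of the [v * class of g]; two lists present the same element when
    they have the same coefficient at every class, which is [req]. *)
Definition comb := list (Q * mat).

Definition coef (A : comb) (g : mat) : Q :=
  fold_right (fun t s => if mat_eqpm (snd t) g then (fst t + s)%Q else s) 0%Q A.

Definition req (A B : comb) : Prop := forall g : mat, (coef A g == coef B g)%Q.

Definition rbase (g : mat) : comb := [(1%Q, g)].
Definition radd (A B : comb) : comb := A ++ B.
Definition ropp (A : comb) : comb := map (fun t => ((- fst t)%Q, snd t)) A.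
Definition rsub (A B : comb) : comb := radd A (ropp B).
Definition rmul (A B : comb) : comb :=
  flat_map (fun s => map (fun t => ((fst s * fst t)%Q, mmul (snd s) (snd t))) B) A.

Definition in_R (n : nat) (A : comb) : Prop :=
  List.Forall (fun t => mdet (snd t) = Z.of_nat n) A.

Definition divisors (n : nat) : list nat :=
  filter (fun l => Nat.eqb (n mod l) 0) (seq 1 n).

Definition Tinf (n : nat) : comb :=
  flat_map (fun d =>
    map (fun b => (1%Q, Mat (Z.of_nat (n / d)) (Z.of_nat b) 0 (Z.of_nat d)))
        (seq 0 d))
    (divisors n).

Definition acts_like_Hecke (n : nat) (A : comb) : Prop :=
  exists Y : comb, in_R n Y /\
    req (rmul (rsub (rbase matI) (rbase matS)) A)
        (radd (rmul (Tinf n) (rsub (rbase matI) (rbase matS)))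
              (rmul (rsub (rbase matI) (rbase matT)) Y)).

Open Scope R_scope.

(** * Finite sums, limits and elementary functions over the complex numbers *)

Definition Rsum {A : Type} (f : A -> R) (l : list A) : R :=
  fold_right Rplus 0 (map f l).
Definition Csum {A : Type} (f : A -> C) (l : list A) : C :=
  fold_right Cplus (RtoC 0) (map f l).
Definition Cprod {A : Type} (f : A -> C) (l : list A) : C :=
  fold_right Cmult (RtoC 1) (map f l).

Definition CLim_seq (u : nat -> C) : C :=
  (real (Lim_seq (fun N => fst (u N))), real (Lim_seq (fun N => snd (u N)))).
Definition CSeries (u : nat -> C) : C :=
  (Series (fun i => fst (u i)), Series (fun i => snd (u i))).

Definition Cexp (z : C) : C :=
  (exp (fst z) * cos (snd z), exp (fst z) * sin (snd z)).

(** Principal argument and logarithm; the values at [0] are irrelevant. *)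
Definition Carg (z : C) : R :=
  if Rle_dec 0 (snd z) then acos (fst z / Cmod z) else - acos (fst z / Cmod z).
Definition Clog (z : C) : C := (ln (Cmod z), Carg z).

(** * Extended slash operator *)

(** The factor [log (c x + d)] depends on the representative of the class, so
    [slash] is computed on the matrices listed in the combination. *)
Definition slash1 (m l : nat) (f : C -> C) (g : mat) (x : C) : C :=
  let a := RtoC (IZR (ma g)) in let b := RtoC (IZR (mb g)) in
  let c := RtoC (IZR (mc g)) in let d := RtoC (IZR (md g)) in
  (RtoC (Rpower (IZR (mdet g)) (INR m / 2)) / (c * x + d) ^ m
   * Clog (c * x + d) ^ l * f ((a * x + b) / (c * x + d)))%C.

Definition slash (m l : nat) (f : C -> C) (A : comb) (x : C) : C :=
  Csum (fun t => (RtoC (Q2R (fst t)) * slash1 m l f (snd t) x)%C) A.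

(** * Higher order Herglotz-Zagier functions *)

Definition Dilcher_Gamma (k : nat) (x : C) : C :=
  CLim_seq (fun N =>
    (Cexp (RtoC (ln (INR N) ^ (k + 1) / INR (k + 1)) * x)
     * Cprod (fun j => Cexp (RtoC (ln (INR j) ^ (k + 1) / INR (k + 1)))) (seq 1 N)
     / Cprod (fun j => Cexp (Clog (RtoC (INR j) + x) ^ (k + 1) / RtoC (INR (k + 1))))
             (seq 0 (N + 1)))%C).

(** [C_derive] is Coquelicot's total complex derivative: it is the derivative
    wherever the function is complex differentiable ([is_C_derive_unique]). *)
Definition Dilcher_psi (k : nat) (x : C) : C :=
  (C_derive (Dilcher_Gamma k) x / Dilcher_Gamma k x)%C.

(** Meant for [1 <= k] and [x] outside the half-line (-oo, 0]; the series index
    is shifted, [n = S i]. *)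
Definition Phi (k : nat) (x : C) : C :=
  CSeries (fun i =>
    let n := RtoC (INR (S i)) in
    ((RtoC (INR k) * Dilcher_psi (k - 1) (n * x) - Clog (n * x) ^ k) / n)%C).

Definition dPhi (k : nat) (x : C) : C := C_derive (Phi k) x.

(** * Zeta function and Stieltjes constants *)

(** The Dirichlet series on [Re s > 1], continued holomorphically to [s <> 1];
    its value at the pole is left free. *)
Definition is_zeta (zeta : C -> C) : Prop :=
  (forall s : C, 1 < fst s ->
     @is_series C_AbsRing C_NormedModule
       (fun i => Cexp (- s * RtoC (ln (INR (S i))))%C) (zeta s)) /\
  (forall s : C, s <> RtoC 1 -> @ex_derive C_AbsRing C_NormedModule zeta s).

Definition are_Stieltjes_constants (gam : nat -> R) : Prop :=
  exists zeta : C -> C, is_zeta zeta /\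
  forall s : C, s <> RtoC 1 ->
    @is_series C_AbsRing C_NormedModule
      (fun j => RtoC ((-1) ^ j * gam j / INR (fact j)) * (s - RtoC 1) ^ j)%C
      (zeta s - RtoC 1 / (s - RtoC 1))%C.

Definition gamma_tilde (gam : nat -> R) (r : nat) : R :=
  match r with
  | O => 1
  | S j => - INR r * gam j
  end.

(* Main.v *)
Require Import Defs.
From Stdlib Require Import Lra Lia Permutation Bool.
From Stdlib Require Import Reals ZArith QArith Qreals List.
From Coquelicot Require Import Coquelicot.
Open Scope R_scope.

(** Write [y_ij = (i + 1) x + j]. On the positive axis [Phi_r'] is the double
    sum of [h'(y + 1) - h'(y) - h''(y)] over [y = y_ij] for [h = ln^r]. Replacing
    [ln^r] by [y^eps] gives a generating function [P_eps] with
    [P_eps = sum_r Phi_r' eps^r / r!] asymptotically as [eps -> 0-]; for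
    [eps < 0] its first part telescopes, so that
    [P_eps(x) - G(eps) x^(eps - 1) = - eps (eps - 1) sum_ij y_ij^(eps - 2)] with
    [G(eps) = - eps zeta(1 - eps) = sum_r gamma~_r eps^r / r!].

    The absolutely convergent double sum on the right is an eigenfunction of
    [T~_n] for the slash action [(c x + d)^(eps - 2) f(g x)], with eigenvalue
    [sum_(l | n) l^(eps - 1)]. This is a statement about lattice points: for a
    fixed vector [v] in the closed quadrant, let [phi(g)] tell whether [v g^-1]
    is integral with positive first coordinate, where [g] is taken modulo sign
    with lexicographically positive bottom row. Then [phi(T g) = phi(g)], and
    [phi(g) - phi(S g)] is the indicator of [v g^-1] lying in the quadrant when
    [g] has nonnegative entries; so applying [phi] to the relation defining
    [T~_n] counts the [g] in [T_n^oo] with [v g^-1] integral, and this number is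
    the sum of the common divisors of [n] and [v].

    The theorem is the coefficient of [eps^k] of the eigenvalue equation. *)

(** Second differences arise because [k psi_(k-1)(w) - log^k w] is the sum over [j] of
    [h(w + j + 1) - h(w + j) - h'(w + j)] for [h = ln^k]: the divergent normalisation in the limit
    defining [psi] telescopes away. After differentiation in [x] they decay like the third
    derivative of [h], which suffices for absolute convergence over the lattice, also for [y^eps] on
    both sides of [eps = 0]. The two pieces into which they are split are summable over the lattice
    only for [eps < 0]; hence the one-sided asymptotic expansions, whose coefficients are unique.

    The relation in Q[M] contains an arbitrary [Y], so it has to be tested with a function defined
    on all classes. An indicator of the quadrant is not invariant under [T]; the sign of one
    coordinate is, once the sign of the matrix is fixed by the bottom row, which [T] leaves alone.
    Testing one vector at a time keeps every identity finite; convergence enters only when the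
    vectors are summed over growing boxes. *)

Section FiniteSums.
Context {A : Type}.

Lemma Rsum_cons (f : A -> R) x l : Rsum f (x :: l) = f x + Rsum f l.
Proof. reflexivity. Qed.

Lemma Rsum_app (f : A -> R) l1 l2 : Rsum f (l1 ++ l2) = Rsum f l1 + Rsum f l2.
Proof.
induction l1 as [|x l1 IH]; [unfold Rsum; simpl; ring|].
rewrite <- app_comm_cons, !Rsum_cons, IH; ring.
Qed.

Lemma Rsum_ext_in (f g : A -> R) l : (forall x, In x l -> f x = g x) -> Rsum f l = Rsum g l.
Proof.
induction l as [|x l IH]; intros H; [reflexivity|].
rewrite !Rsum_cons, (H x (or_introl eq_refl)), IH; [reflexivity|].
intros y Hy; apply H; right; exact Hy.
Qed.

Lemma Rsum_plus (f g : A -> R) l : Rsum (fun x => f x + g x) l = Rsum f l + Rsum g l.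
Proof. induction l as [|x l IH]; [unfold Rsum; simpl; ring|]. rewrite !Rsum_cons, IH; ring. Qed.

Lemma Rsum_minus (f g : A -> R) l : Rsum (fun x => f x - g x) l = Rsum f l - Rsum g l.
Proof. induction l as [|x l IH]; [unfold Rsum; simpl; ring|]. rewrite !Rsum_cons, IH; ring. Qed.

Lemma Rsum_scal (c : R) (f : A -> R) l : Rsum (fun x => c * f x) l = c * Rsum f l.
Proof. induction l as [|x l IH]; [unfold Rsum; simpl; ring|]. rewrite !Rsum_cons, IH; ring. Qed.

Lemma Rsum_zero (f : A -> R) l : (forall x, In x l -> f x = 0) -> Rsum f l = 0.
Proof.
intros H. rewrite (Rsum_ext_in f (fun x => 0 * 0)); [rewrite Rsum_scal; ring|].
intros x Hx; rewrite H by exact Hx; ring.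
Qed.

Lemma Rsum_le (f g : A -> R) l : (forall x, In x l -> f x <= g x) -> Rsum f l <= Rsum g l.
Proof.
induction l as [|x l IH]; intros H; [apply Rle_refl|].
rewrite !Rsum_cons. apply Rplus_le_compat; [apply H; left; reflexivity|].
apply IH; intros y Hy; apply H; right; exact Hy.
Qed.

Lemma Rsum_Permutation (f : A -> R) l l' : Permutation l l' -> Rsum f l = Rsum f l'.
Proof.
induction 1 as [|x l l' _ IH|x y l|l l' l'' _ IH1 _ IH2];
  [reflexivity|rewrite !Rsum_cons, IH; reflexivity|rewrite !Rsum_cons; ring|congruence].
Qed.

Lemma Rsum_filter (P : A -> bool) (f : A -> R) l :
  Rsum f l = Rsum f (filter P l) + Rsum f (filter (fun x => negb (P x)) l).
Proof.
induction l as [|x l IH]; [unfold Rsum; simpl; ring|].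
cbn [filter]; rewrite Rsum_cons, IH; destruct (P x); cbn [negb]; rewrite Rsum_cons; ring.
Qed.

Lemma Rsum_single (f : A -> R) l x :
  NoDup l -> In x l -> (forall y, In y l -> y <> x -> f y = 0) -> Rsum f l = f x.
Proof.
induction l as [|z l IH]; intros Hl Hx H; [destruct Hx|].
apply NoDup_cons_iff in Hl as [Hz Hl]; rewrite Rsum_cons.
destruct Hx as [->|Hx].
- rewrite Rsum_zero; [ring|]. intros y Hy; apply H; [right; exact Hy|].
  intros ->; exact (Hz Hy).
- rewrite IH; [rewrite H; [ring|left; reflexivity|]|exact Hl|exact Hx|].
  + intros ->; exact (Hz Hx).
  + intros y Hy; apply H; right; exact Hy.
Qed.

End FiniteSums.

Lemma Rsum_map {A B : Type} (h : A -> B) (f : B -> R) l : Rsum f (map h l) = Rsum (fun x => f (h x)) l.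
Proof. unfold Rsum; rewrite map_map; reflexivity. Qed.

Lemma Rsum_flat_map {A B : Type} (h : A -> list B) (f : B -> R) l :
  Rsum f (flat_map h l) = Rsum (fun x => Rsum f (h x)) l.
Proof.
induction l as [|x l IH]; [reflexivity|].
cbn [flat_map]; rewrite Rsum_app, Rsum_cons, IH; reflexivity.
Qed.

Lemma Rsum_exchange {A B : Type} (f : A -> B -> R) l m :
  Rsum (fun x => Rsum (f x) m) l = Rsum (fun y => Rsum (fun x => f x y) l) m.
Proof.
induction l as [|x l IH].
- symmetry; apply Rsum_zero; reflexivity.
- rewrite Rsum_cons, IH, <- Rsum_plus; reflexivity.
Qed.

(** * Evaluating even functions of a matrix on Q[M] *)

Definition eval (phi : mat -> R) (A : comb) : R :=
  Rsum (fun t => Q2R (fst t) * phi (snd t)) A.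

Definition even_fun (phi : mat -> R) : Prop := forall g, phi (mopp g) = phi g.

Lemma mat_eqb_eq g h : mat_eqb g h = true <-> g = h.
Proof.
unfold mat_eqb; rewrite !andb_true_iff, !Z.eqb_eq.
destruct g, h; cbn; split; [intros [[[-> ->] ->] ->]; reflexivity|].
intros [= -> -> -> ->]; auto.
Qed.

Lemma mopp_mopp g : mopp (mopp g) = g.
Proof. destruct g; unfold mopp; cbn; rewrite !Z.opp_involutive; reflexivity. Qed.

Lemma mat_eqpm_eq g h : mat_eqpm g h = true <-> g = h \/ g = mopp h.
Proof. unfold mat_eqpm; rewrite orb_true_iff, !mat_eqb_eq; reflexivity. Qed.

Lemma mat_eqpm_congr g g' h : mat_eqpm g g' = true -> mat_eqpm g h = mat_eqpm g' h.
Proof.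
intros H; apply eq_iff_eq_true; apply mat_eqpm_eq in H; rewrite !mat_eqpm_eq.
destruct H as [->| ->]; [reflexivity|].
split; intros [H|H].
- right; rewrite <- H, mopp_mopp; reflexivity.
- left; rewrite <- (mopp_mopp g'), H, mopp_mopp; reflexivity.
- right; rewrite H; reflexivity.
- left; rewrite H, mopp_mopp; reflexivity.
Qed.

Lemma mat_eqpm_sym g h : mat_eqpm g h = mat_eqpm h g.
Proof.
apply eq_iff_eq_true; rewrite !mat_eqpm_eq.
split; intros [H|H]; subst; rewrite ?mopp_mopp; auto.
Qed.

Lemma coef_cons q m A g :
  coef ((q, m) :: A) g = if mat_eqpm m g then (q + coef A g)%Q else coef A g.
Proof. reflexivity. Qed.

Lemma coef_filter_class A g h :
  mat_eqpm g h = true -> coef (filter (fun t => negb (mat_eqpm (snd t) g)) A) h = 0%Q.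
Proof.
intros Hgh; induction A as [|[q m] A IH]; [reflexivity|].
cbn [filter snd]; destruct (mat_eqpm m g) eqn:E; cbn [negb]; [exact IH|].
rewrite coef_cons, mat_eqpm_sym, <- (mat_eqpm_congr _ _ m Hgh), mat_eqpm_sym, E; exact IH.
Qed.

Lemma coef_filter_other A g h :
  mat_eqpm g h = false ->
  coef (filter (fun t => negb (mat_eqpm (snd t) g)) A) h = coef A h.
Proof.
intros Hgh; induction A as [|[q m] A IH]; [reflexivity|].
cbn [filter snd]; rewrite coef_cons; destruct (mat_eqpm m g) eqn:E; cbn [negb].
- rewrite (mat_eqpm_congr _ _ h E), Hgh; exact IH.
- rewrite coef_cons, IH; reflexivity.
Qed.

Lemma eval_class phi A g : even_fun phi ->
  eval phi (filter (fun t => mat_eqpm (snd t) g) A) = Q2R (coef A g) * phi g.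
Proof.
intros Hphi; induction A as [|[q m] A IH]; [unfold eval, Rsum; cbn; rewrite RMicromega.Q2R_0; ring|].
cbn [filter snd]; rewrite coef_cons; destruct (mat_eqpm m g) eqn:E; [|exact IH].
unfold eval in *; rewrite Rsum_cons, IH, Q2R_plus; cbn [fst snd].
apply mat_eqpm_eq in E as [->| ->]; rewrite ?Hphi; ring.
Qed.

(** Induction on the number of terms: the terms in the class of the first matrix contribute their
    total coefficient, which is 0, times one value of [phi]. Deleting them leaves every other
    coefficient unchanged. *)
Lemma eval_coef_zero phi A : even_fun phi -> (forall g, (coef A g == 0)%Q) -> eval phi A = 0.
Proof.
intros Hphi; remember (length A) as N eqn:HN; revert A HN.
induction N as [N IH] using lt_wf_ind; intros [|[q g] A] HN HA; [reflexivity|].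
unfold eval; rewrite (Rsum_filter (fun t => mat_eqpm (snd t) g)).
fold (eval phi (filter (fun t => mat_eqpm (snd t) g) ((q, g) :: A))).
rewrite eval_class, (Qeq_eqR _ _ (HA g)), RMicromega.Q2R_0 by exact Hphi.
fold (eval phi (filter (fun t => negb (mat_eqpm (snd t) g)) ((q, g) :: A))).
rewrite (IH (length (filter (fun t => negb (mat_eqpm (snd t) g)) ((q, g) :: A)))); [ring| |reflexivity|].
- subst N; cbn.
  replace (mat_eqpm g g) with true by (symmetry; apply mat_eqpm_eq; auto); cbn.
  pose proof (filter_length_le (fun t : Q * mat => negb (mat_eqpm (snd t) g)) A); lia.
- intros h; destruct (mat_eqpm g h) eqn:E.
  + rewrite coef_filter_class by exact E; reflexivity.
  + rewrite coef_filter_other by exact E; apply HA.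
Qed.

Lemma eval_radd phi A B : eval phi (radd A B) = eval phi A + eval phi B.
Proof. apply Rsum_app. Qed.

Lemma eval_ropp phi A : eval phi (ropp A) = - eval phi A.
Proof.
unfold eval, ropp; rewrite Rsum_map; cbn.
transitivity (Rsum (fun t => -1 * (Q2R (fst t) * phi (snd t))) A).
- apply Rsum_ext_in; intros t _; rewrite Q2R_opp; ring.
- rewrite Rsum_scal; ring.
Qed.

Lemma coef_app A B g : (coef (A ++ B) g == coef A g + coef B g)%Q.
Proof.
induction A as [|[q m] A IH]; [change (coef B g == 0 + coef B g)%Q; ring|].
cbn [app]; rewrite !coef_cons; destruct (mat_eqpm m g); rewrite IH; ring.
Qed.

Lemma coef_ropp A g : (coef (ropp A) g == - coef A g)%Q.
Proof.
induction A as [|[q m] A IH]; [reflexivity|].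
change (ropp ((q, m) :: A)) with (((- q)%Q, m) :: ropp A); rewrite !coef_cons; destruct (mat_eqpm m g); rewrite IH; ring.
Qed.

Lemma eval_req phi A B : even_fun phi -> req A B -> eval phi A = eval phi B.
Proof.
intros Hphi HAB.
assert (H : eval phi (radd A (ropp B)) = 0).
{ apply eval_coef_zero; [exact Hphi|]; intros g; unfold radd.
  rewrite coef_app, coef_ropp, (HAB g); ring. }
rewrite eval_radd, eval_ropp in H; lra.
Qed.

Lemma eval_rmul phi A B :
  eval phi (rmul A B) = eval (fun g => eval (fun h => phi (mmul g h)) B) A.
Proof.
unfold eval, rmul; rewrite Rsum_flat_map; apply Rsum_ext_in; intros s _.
rewrite Rsum_map, <- Rsum_scal; apply Rsum_ext_in; intros t _; cbn.
rewrite Q2R_mult; ring.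
Qed.

Lemma Q2R_1 : Q2R 1 = 1.
Proof. unfold Q2R; cbn; field. Qed.

Lemma eval_rsub_base phi g h : eval phi (rsub (rbase g) (rbase h)) = phi g - phi h.
Proof.
unfold rsub; rewrite eval_radd, eval_ropp; unfold eval, Rsum, rbase; cbn.
rewrite Q2R_1; ring.
Qed.

Lemma mmul_matI_l g : mmul matI g = g.
Proof. destruct g as [a b c d]; unfold mmul, matI; cbn [ma mb mc md]; f_equal; ring. Qed.

Lemma mmul_matI_r g : mmul g matI = g.
Proof. destruct g as [a b c d]; unfold mmul, matI; cbn [ma mb mc md]; f_equal; ring. Qed.

Lemma mmul_mopp_r g h : mmul g (mopp h) = mopp (mmul g h).
Proof. destruct g as [a b c d], h as [a2 b2 c2 d2]; unfold mmul, mopp; cbn [ma mb mc md]; f_equal; ring. Qed.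

(** * Counting sublattices *)

Definition ind (b : bool) : R := if b then 1 else 0.

Lemma mod_eqb_divide (m d : Z) : (d <> 0)%Z -> ((m mod d =? 0)%Z = true <-> (d | m)%Z).
Proof. intros Hd; rewrite Z.eqb_eq; apply Z.mod_divide; exact Hd. Qed.

Lemma Z_of_nat_divide (a b : nat) : (Z.of_nat a | Z.of_nat b)%Z <-> Nat.divide a b.
Proof.
split; intros [z Hz]; [|exists (Z.of_nat z); lia].
destruct a as [|a]; [exists 0%nat; lia|].
exists (Z.to_nat z); assert (0 <= z)%Z by nia; lia.
Qed.

Lemma count_residue_block (d s : nat) (r : Z) : (0 < d)%nat ->
  Rsum (fun b => ind ((Z.of_nat b - r) mod Z.of_nat d =? 0)%Z) (seq s d) = 1.
Proof.
intros Hd.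
pose proof (Z.mod_pos_bound (r - Z.of_nat s) (Z.of_nat d) ltac:(lia)) as Hb.
set (m := ((r - Z.of_nat s) mod Z.of_nat d)%Z) in Hb.
assert (Hm : (r - Z.of_nat s = Z.of_nat d * ((r - Z.of_nat s) / Z.of_nat d) + m)%Z)
  by (apply Z.div_mod; lia).
set (e := ((r - Z.of_nat s) / Z.of_nat d)%Z) in Hm.
(* The unique hit in the block is [s] plus the residue [m] of [r - s]. *)
rewrite (Rsum_single _ _ (s + Z.to_nat m)%nat).
- replace (_ =? 0)%Z with true; [reflexivity|]; symmetry.
  apply mod_eqb_divide; [lia|]. exists (- e)%Z. lia.
- apply seq_NoDup.
- apply in_seq; lia.
- intros y Hy Hne; apply in_seq in Hy.
  destruct (_ =? 0)%Z eqn:E; [exfalso|reflexivity].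
  apply mod_eqb_divide in E; [|lia]; destruct E as [f Hf].
  assert (Hc : (Z.of_nat y - Z.of_nat s - m = Z.of_nat d * (f + e))%Z) by lia.
  assert (f + e = 0)%Z by nia. nia.
Qed.

Lemma count_residue (d g s : nat) (r : Z) : (0 < d)%nat ->
  Rsum (fun b => ind ((Z.of_nat b - r) mod Z.of_nat d =? 0)%Z) (seq s (g * d)) = INR g.
Proof.
intros Hd; revert s; induction g as [|g IH]; intros s; [reflexivity|].
cbn [Nat.mul]; rewrite seq_app, Rsum_app, count_residue_block, IH, S_INR by exact Hd; ring.
Qed.

Lemma count_linear_congruence (d P q : nat) : (0 < d)%nat ->
  Rsum (fun b => ind ((Z.of_nat q - Z.of_nat P * Z.of_nat b) mod Z.of_nat d =? 0)%Z) (seq 0 d)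
  = let g := Nat.gcd d P in INR g * ind (q mod g =? 0)%nat.
Proof.
intros Hd; cbn zeta.
destruct (Nat.gcd_divide d P) as [[d' Hd'] [P' HP']].
assert (Hg0 : Nat.gcd d P <> 0%nat) by (intros E; rewrite E in Hd'; lia).
(* Bezout for the coprime cofactors: [u] inverts [P'] modulo [d']. *)
assert (Hbez : exists u w, (u * Z.of_nat P' + w * Z.of_nat d' = 1)%Z).
{ destruct (Nat.gcd_bezout d P) as [(u & w & Huw)|(u & w & Huw)].
  - exists (- Z.of_nat w)%Z, (Z.of_nat u).
    assert (u * d' = 1 + w * P')%nat; [|lia].
    apply (Nat.mul_cancel_r _ _ (Nat.gcd d P)); [exact Hg0|].
    rewrite Nat.mul_add_distr_r, <- !Nat.mul_assoc, <- HP', <- Hd'; lia.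
  - exists (Z.of_nat u), (- Z.of_nat w)%Z.
    assert (u * P' = 1 + w * d')%nat; [|lia].
    apply (Nat.mul_cancel_r _ _ (Nat.gcd d P)); [exact Hg0|].
    rewrite Nat.mul_add_distr_r, <- !Nat.mul_assoc, <- HP', <- Hd'; lia. }
set (g := Nat.gcd d P) in *.
destruct (q mod g =? 0)%nat eqn:E.
- apply Nat.eqb_eq, Nat.Lcm0.mod_divide in E as [q' Hq'].
  destruct Hbez as (u & w & Huw).
  (* After division by the gcd, the solutions form the single class of [u * q'] modulo [d'], which
     meets an interval of length [g * d'] in [g] points. *)
  rewrite (Rsum_ext_in _ (fun b => ind ((Z.of_nat b - u * Z.of_nat q') mod Z.of_nat d' =? 0)%Z)).
  + rewrite Hd', (Nat.mul_comm d'), count_residue; [cbn; ring|]. nia.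
  + intros b _; f_equal; apply eq_iff_eq_true; rewrite !mod_eqb_divide by nia.
    rewrite Hd', HP', Hq', !Nat2Z.inj_mul.
    replace (Z.of_nat q' * Z.of_nat g - Z.of_nat P' * Z.of_nat g * Z.of_nat b)%Z
      with ((Z.of_nat q' - Z.of_nat P' * Z.of_nat b) * Z.of_nat g)%Z by ring.
    split.
    * intros H; apply Z.mul_divide_cancel_r in H; [|lia].
      destruct H as [z Hz]. exists (w * Z.of_nat b - u * z)%Z.
      transitivity (Z.of_nat b * (u * Z.of_nat P' + w * Z.of_nat d')
        - u * (z * Z.of_nat d' + Z.of_nat P' * Z.of_nat b))%Z; [|ring].
      rewrite Huw, <- Hz; ring.
    * intros [z Hz]; apply Z.mul_divide_mono_r.
      exists (w * Z.of_nat q' - Z.of_nat P' * z)%Z.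
      transitivity (Z.of_nat q' * (u * Z.of_nat P' + w * Z.of_nat d')
        - Z.of_nat P' * (z * Z.of_nat d' + u * Z.of_nat q'))%Z; [|ring].
      rewrite Huw, <- Hz; ring.
- rewrite Rsum_zero; [cbn; ring|]. intros b _.
  destruct (_ =? 0)%Z eqn:F; [exfalso|reflexivity].
  apply mod_eqb_divide in F; [|lia].
  apply Nat.eqb_neq in E; apply E, Nat.Lcm0.mod_divide.
  destruct F as [z Hz]; apply Z_of_nat_divide.
  exists (z * Z.of_nat d' + Z.of_nat P' * Z.of_nat b)%Z.
  rewrite Hd', HP', !Nat2Z.inj_mul in Hz. nia.
Qed.

Lemma in_divisors n d : (1 <= n)%nat -> In d (divisors n) <-> Nat.divide d n /\ (1 <= d)%nat.
Proof.
intros Hn; unfold divisors; rewrite filter_In, in_seq, Nat.eqb_eq.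
split.
- intros [Hd H]; split; [apply Nat.Lcm0.mod_divide; exact H|lia].
- intros [H Hd]; split; [|apply Nat.Lcm0.mod_divide; exact H].
  apply Nat.divide_pos_le in H; lia.
Qed.

Lemma NoDup_divisors n : NoDup (divisors n).
Proof. apply NoDup_filter, seq_NoDup. Qed.

(* With [G = gcd n p], the divisors [d] of [n] whose codivisor [n / d] divides
   [p] are the [l * (n / G)] for [l] dividing [G]. *)
Lemma Rsum_divisors_gcd (n p : nat) (H : nat -> R) : (1 <= n)%nat ->
  Rsum (fun d => ind (p mod (n / d) =? 0)%nat * H (Nat.gcd d (p / (n / d)))) (divisors n)
  = Rsum (fun l => ind (p mod l =? 0)%nat * H l) (divisors n).
Proof.
intros Hn.
assert (Hz : forall (f : nat -> R) (P : nat -> bool) l,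
  Rsum (fun d => ind (P d) * f d) l = Rsum f (filter P l)).
{ intros f P l; rewrite (Rsum_filter P), (Rsum_zero _ (filter (fun x => negb (P x)) l)).
  - rewrite (Rsum_ext_in _ f); [ring|].
    intros x Hx; apply filter_In in Hx as [_ ->]; cbn; ring.
  - intros x Hx; apply filter_In in Hx as [_ Hx].
    destruct (P x); [discriminate|]; cbn; ring. }
rewrite (Hz (fun d => H (Nat.gcd d (p / (n / d)))) (fun d => p mod (n / d) =? 0)%nat), (Hz H); clear Hz.
pose proof (Nat.gcd_divide n p) as [[m Hm] HGp].
set (G := Nat.gcd n p) in *.
assert (HG : (1 <= G)%nat) by (destruct G; lia).
assert (Hm1 : (1 <= m)%nat) by (destruct m; lia).
assert (HdG : forall l, (1 <= l)%nat -> Nat.divide l n -> Nat.divide l p -> Nat.divide l G)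
  by (intros l _; apply Nat.gcd_greatest).
rewrite (Rsum_Permutation _ _ (map (fun l => l * m)%nat
   (filter (fun l => (p mod l =? 0)%nat) (divisors n)))).
- rewrite Rsum_map; apply Rsum_ext_in; intros l Hl.
  apply filter_In in Hl as [Hl Hlp]; apply in_divisors in Hl as [Hl Hl1]; [|exact Hn].
  apply Nat.eqb_eq, Nat.Lcm0.mod_divide in Hlp.
  destruct (HdG l Hl1 Hl Hlp) as [e He].
  replace (n / (l * m))%nat with e.
  2:{ rewrite Hm, He; apply Nat.div_unique_exact; nia. }
  assert (He1 : (1 <= e)%nat) by (destruct e; lia).
  f_equal. destruct HGp as [p' Hp'].
  (* Multiplied by the codivisor [e = n / (l * m)], the gcd becomes [gcd n p = G = e * l]. *)
  apply (Nat.mul_cancel_r _ _ e); [lia|].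
  rewrite <- Nat.gcd_mul_mono_r.
  replace (p / e * e)%nat with p.
  2:{ replace (p / e)%nat with (p' * l)%nat by (apply Nat.div_unique_exact; nia); nia. }
  replace (l * m * e)%nat with n by nia. fold G; nia.
- apply NoDup_Permutation.
  + apply NoDup_filter, NoDup_divisors.
  + apply FinFun.Injective_map_NoDup; [|apply NoDup_filter, NoDup_divisors].
    intros a b Hab; nia.
  + intros d; rewrite in_map_iff; setoid_rewrite filter_In.
    setoid_rewrite Nat.eqb_eq; setoid_rewrite (fun d => in_divisors n d Hn).
    split.
    * intros [[[a Ha] Hd1] Hdp].
      assert (Ha1 : (1 <= a)%nat) by (destruct a; lia).
      replace (n / d)%nat with a in Hdp
        by (apply Nat.div_unique_exact; lia).
      apply Nat.Lcm0.mod_divide in Hdp.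
      destruct (HdG a Ha1 ltac:(exists d; lia) Hdp) as [l Hl].
      exists l; split; [nia|].
      assert (Hl1 : (1 <= l)%nat) by (destruct l; lia).
      repeat split; [exists (m * a)%nat; nia|exact Hl1|].
      apply Nat.Lcm0.mod_divide. destruct HGp as [p' Hp']; exists (p' * a)%nat; nia.
    * intros (l & <- & [Hl Hl1] & Hlp).
      apply Nat.Lcm0.mod_divide in Hlp.
      destruct (HdG l Hl1 Hl Hlp) as [e He].
      assert (He1 : (1 <= e)%nat) by (destruct e; lia).
      replace (n / (l * m))%nat with e
        by (apply Nat.div_unique_exact; nia).
      repeat split; [exists e; nia|nia|].
      apply Nat.Lcm0.mod_divide. destruct HGp as [p' Hp']; exists (p' * l)%nat; nia.
Qed.

(** * The Hecke relation on lattice points *)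

Section Lattice.
Variables (n : nat) (p q : nat).
Hypothesis Hn : (1 <= n)%nat.

Let zn := Z.of_nat n.

(* For [det g = n], the vector [(p, q) g^-1] is [(vec1 g, vec2 g) / n]. *)
Definition vec1 (g : mat) : Z := (Z.of_nat p * md g - Z.of_nat q * mc g)%Z.
Definition vec2 (g : mat) : Z := (Z.of_nat q * ma g - Z.of_nat p * mb g)%Z.

Definition integral (g : mat) : bool := ((vec1 g mod zn =? 0) && (vec2 g mod zn =? 0))%Z.

Definition bottom_pos (g : mat) : bool := ((0 <? mc g) || ((mc g =? 0) && (0 <? md g)))%Z.

(* The first coordinate of [(p, q) g^-1] is positive for the representative of
   [g] modulo sign whose bottom row is lexicographically positive. *)
Definition first_pos (g : mat) : bool :=
  (integral g && if bottom_pos g then (0 <? vec1 g)%Z else (vec1 g <? 0)%Z)%bool.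

(** Half open, so as to match the vectors [(i + 1, j)] that index the double sums. *)
Definition in_quadrant (g : mat) : bool :=
  (integral g && (0 <? vec1 g)%Z && (0 <=? vec2 g)%Z)%bool.

Lemma integral_iff g : integral g = true <-> (zn | vec1 g)%Z /\ (zn | vec2 g)%Z.
Proof. unfold integral; rewrite andb_true_iff, !mod_eqb_divide by (unfold zn; lia); reflexivity. Qed.

Lemma integral_congr g h :
  ((zn | vec1 g)%Z /\ (zn | vec2 g)%Z <-> (zn | vec1 h)%Z /\ (zn | vec2 h)%Z) ->
  integral g = integral h.
Proof. intros H; apply eq_iff_eq_true; rewrite !integral_iff; exact H. Qed.

Lemma first_pos_mopp g : first_pos (mopp g) = first_pos g.
Proof.
unfold first_pos.
assert (H1 : vec1 (mopp g) = (- vec1 g)%Z) by (unfold vec1; cbn; ring).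
assert (H2 : vec2 (mopp g) = (- vec2 g)%Z) by (unfold vec2; cbn; ring).
rewrite (integral_congr (mopp g) g), H1 by (rewrite H1, H2, !Z.divide_opp_r; reflexivity).
f_equal; unfold bottom_pos; cbn.
destruct (Z.ltb_spec 0 (mc g)), (Z.ltb_spec 0 (- mc g)), (Z.eqb_spec (mc g) 0),
  (Z.eqb_spec (- mc g) 0), (Z.ltb_spec 0 (md g)), (Z.ltb_spec 0 (- md g)); cbn; try lia;
  apply eq_iff_eq_true; rewrite !Z.ltb_lt; try lia.
(* Only a zero bottom row is left; there [vec1 g] vanishes and both sides are false. *)
all: unfold vec1; replace (md g) with 0%Z by lia; replace (mc g) with 0%Z by lia; lia.
Qed.

(** Left multiplication by [T] keeps the bottom row and [vec1], and subtracts [vec1] from [vec2], so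
    integrality is preserved as well. *)
Lemma first_pos_T g : first_pos (mmul matT g) = first_pos g.
Proof.
destruct g as [a b c d]; unfold first_pos.
set (g := Mat a b c d).
assert (H1 : vec1 (mmul matT g) = vec1 g) by (unfold vec1, g, mmul, matT; cbn -[Z.mul Z.add]; ring).
assert (H2 : vec2 (mmul matT g) = (vec2 g - vec1 g)%Z)
  by (unfold vec1, vec2, g, mmul, matT; cbn -[Z.mul Z.add Z.sub]; ring).
rewrite (integral_congr (mmul matT g) g).
- unfold bottom_pos; rewrite H1.
  replace (mc (mmul matT g)) with c by (unfold g; cbn -[Z.mul Z.add]; ring).
  replace (md (mmul matT g)) with d by (unfold g; cbn -[Z.mul Z.add]; ring).
  reflexivity.
- rewrite H1, H2; split; intros [A B]; split; trivial.
  + replace (vec2 g) with (vec2 g - vec1 g + vec1 g)%Z by ring; apply Z.divide_add_r; trivial.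
  + apply Z.divide_sub_r; trivial.
Qed.

(* If [(p, q) = u g] with [u = (u1, u2)] then [u1 <= 0] and [u2 < 0] is
   impossible, so [1(u1 > 0) - 1(u2 < 0)] is the indicator of [u1 > 0, u2 >= 0]. *)
Lemma first_pos_S g : nonneg_entries g -> mdet g = zn ->
  ind (first_pos g) - ind (first_pos (mmul matS g)) = ind (in_quadrant g).
Proof.
destruct g as [a b c d]; unfold nonneg_entries, mdet; cbn [ma mb mc md].
intros (Ha & Hb & Hc & Hd) Hdet.
set (g := Mat a b c d).
assert (H1 : vec1 (mmul matS g) = (- vec2 g)%Z)
  by (unfold vec1, vec2, g, mmul, matS; cbn -[Z.mul Z.add Z.sub]; ring).
assert (H2 : vec2 (mmul matS g) = vec1 g)
  by (unfold vec1, vec2, g, mmul, matS; cbn -[Z.mul Z.add Z.sub]; ring).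
unfold first_pos, in_quadrant.
rewrite (integral_congr (mmul matS g) g) by (rewrite H1, H2, Z.divide_opp_r; tauto).
rewrite H1.
replace (bottom_pos (mmul matS g)) with true.
2:{ symmetry; unfold bottom_pos.
    replace (mc (mmul matS g)) with a by (unfold g, mmul, matS; cbn -[Z.mul Z.add]; ring).
    replace (md (mmul matS g)) with b by (unfold g, mmul, matS; cbn -[Z.mul Z.add]; ring).
    destruct (Z.ltb_spec 0 a), (Z.eqb_spec a 0), (Z.ltb_spec 0 b); cbn; try lia; unfold zn in *; nia. }
replace (bottom_pos g) with true.
2:{ symmetry; unfold bottom_pos; unfold g; cbn [mc md].
    destruct (Z.ltb_spec 0 c), (Z.eqb_spec c 0), (Z.ltb_spec 0 d); cbn; try lia; unfold zn in *; nia. }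
destruct (integral g); cbn [andb]; [|cbn; ring].
destruct (Z.ltb_spec 0 (vec1 g)), (Z.ltb_spec 0 (- vec2 g)), (Z.leb_spec 0 (vec2 g));
  cbn; try lra; try lia.
exfalso.
assert (E1 : (zn * Z.of_nat p = vec1 g * a + vec2 g * c)%Z)
  by (unfold vec1, vec2, g; cbn [ma mb mc md]; rewrite <- Hdet; ring).
assert (E2 : (zn * Z.of_nat q = vec1 g * b + vec2 g * d)%Z)
  by (unfold vec1, vec2, g; cbn [ma mb mc md]; rewrite <- Hdet; ring).
assert (0 <= zn)%Z by (unfold zn; lia).
assert (c = 0)%Z by nia. assert (d = 0)%Z by nia. unfold zn in *; nia.
Qed.

(** For [g] with rows [(a, b)] and [(0, d)], the product [g S] has bottom row [(d, 0)] and
    [vec1 = - q d], so it never counts. For [p > 0], the matrix [g] itself counts when [a] divides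
    [p] and [d] divides [q - (p / a) b]. For fixed [d] the admissible [b] are counted by the linear
    congruence, and the sum over [d] is then reindexed by common divisors. *)
Lemma eval_first_pos_Tinf :
  eval (fun g => ind (first_pos g) - ind (first_pos (mmul g matS))) (Tinf n)
  = Rsum (fun l => INR l * ind ((p mod l =? 0) && (q mod l =? 0) && (0 <? p))%nat) (divisors n).
Proof.
unfold eval, Tinf; rewrite Rsum_flat_map.
transitivity (Rsum (fun d => ind (p mod (n / d) =? 0)%nat *
   (fun g => INR g * ind ((q mod g =? 0) && (0 <? p))%nat) (Nat.gcd d (p / (n / d)))) (divisors n)).
2:{ rewrite (Rsum_divisors_gcd n p (fun g => INR g * ind ((q mod g =? 0) && (0 <? p))%nat) Hn).
    apply Rsum_ext_in; intros l _.
    destruct (p mod l =? 0)%nat; cbn; ring. }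
apply Rsum_ext_in; intros d Hd.
apply in_divisors in Hd as [[a Ha] Hd1]; [|exact Hn].
rewrite Rsum_map; cbn [fst snd].
replace (n / d)%nat with a by (apply Nat.div_unique_exact; lia).
assert (Ha1 : (1 <= a)%nat) by (destruct a; lia).
assert (Hb : forall b, first_pos (mmul (Mat (Z.of_nat a) (Z.of_nat b) 0 (Z.of_nat d)) matS) = false).
{ intros b; unfold first_pos.
  set (g := mmul _ _).
  replace (bottom_pos g) with true.
  2:{ symmetry; unfold bottom_pos.
      replace (mc g) with (Z.of_nat d) by (unfold g, mmul, matS; cbn -[Z.mul Z.add]; ring).
      destruct (Z.ltb_spec 0 (Z.of_nat d)); [reflexivity|lia]. }
  replace (vec1 g) with (- (Z.of_nat q * Z.of_nat d))%Z
    by (unfold vec1, g, mmul, matS; cbn -[Z.mul Z.add Z.sub]; ring).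
  apply andb_false_iff; right; apply Z.ltb_ge; lia. }
destruct (Nat.ltb_spec 0 p) as [Hp|Hp].
2:{ rewrite Rsum_zero; [rewrite andb_false_r; cbn; ring|].
    intros b _; rewrite Hb.
    replace (first_pos _) with false; [cbn; ring|].
    symmetry; apply andb_false_iff; right.
    unfold vec1, bottom_pos; cbn [ma mb mc md]; replace p with 0%nat by lia.
    cbn [Z.of_nat Z.mul]; rewrite Z.mul_0_r.
    destruct (_ || _)%bool; reflexivity. }
destruct (p mod a =? 0)%nat eqn:E.
- apply Nat.eqb_eq, Nat.Lcm0.mod_divide in E as [P HP].
  replace (p / a)%nat with P by (apply Nat.div_unique_exact; lia).
  rewrite andb_true_r.
  cbv beta; cbn [ind]; rewrite Rmult_1_l, <- count_linear_congruence by exact Hd1.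
  apply Rsum_ext_in; intros b _; rewrite Hb, Q2R_1; cbn [ind].
  rewrite Rminus_0_r, Rmult_1_l; f_equal.
  apply eq_iff_eq_true; unfold first_pos.
  rewrite andb_true_iff, integral_iff, mod_eqb_divide by lia.
  unfold vec1, vec2, bottom_pos; cbn [ma mb mc md]; rewrite Z.mul_0_r, Z.sub_0_r.
  replace (_ || _)%bool with true
    by (symmetry; cbn [Z.ltb Z.compare orb Z.eqb andb]; apply Z.ltb_lt; lia).
  unfold zn; rewrite Ha, HP, !Nat2Z.inj_mul, Z.ltb_lt.
  replace (Z.of_nat q * Z.of_nat a - Z.of_nat P * Z.of_nat a * Z.of_nat b)%Z
    with (Z.of_nat a * (Z.of_nat q - Z.of_nat P * Z.of_nat b))%Z by ring.
  rewrite Z.mul_divide_cancel_l by lia.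
  split; [tauto|]. intros H; repeat split; [|exact H|].
  + apply Z.mul_divide_mono_r; exists (Z.of_nat P); ring.
  + nia.
- cbn [ind]; rewrite Rmult_0_l; apply Rsum_zero; intros b _; rewrite Hb.
  replace (first_pos _) with false; [cbn; ring|].
  symmetry; apply andb_false_iff; left; apply not_true_is_false; intros F.
  apply integral_iff in F as [F _]; unfold vec1 in F; cbn [ma mb mc md] in F.
  rewrite Z.mul_0_r, Z.sub_0_r in F; unfold zn in F; rewrite Ha, Nat2Z.inj_mul in F.
  apply Z.mul_divide_cancel_r in F; [|lia].
  apply Nat.eqb_neq in E; apply E, Nat.Lcm0.mod_divide, Z_of_nat_divide, F.
Qed.

Lemma Hecke_in_quadrant (Tn v : comb) :
  acts_like_Hecke n Tn -> in_R n v -> req Tn v ->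
  List.Forall (fun t => nonneg_entries (snd t)) v ->
  Rsum (fun t => Q2R (fst t) * ind (in_quadrant (snd t))) v
  = Rsum (fun l => INR l * ind ((p mod l =? 0) && (q mod l =? 0) && (0 <? p))%nat) (divisors n).
Proof.
intros (Y & _ & HY) Hv HTv Hnn.
rewrite <- eval_first_pos_Tinf.
assert (Hev : even_fun (fun g => ind (first_pos g))) by (intros g; rewrite first_pos_mopp; reflexivity).
(* [Tn] and [v] agree only as combinations of classes modulo sign, so the value can be carried from
   one to the other only for an even function. *)
assert (Hev2 : even_fun (fun g => ind (first_pos g) - ind (first_pos (mmul matS g)))).
{ intros g; rewrite mmul_mopp_r, !first_pos_mopp; reflexivity. }
transitivity (eval (fun g => ind (first_pos g) - ind (first_pos (mmul matS g))) v).
{ rewrite Forall_forall in Hnn; unfold in_R in Hv; rewrite Forall_forall in Hv.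
  apply Rsum_ext_in; intros t Ht; rewrite first_pos_S; [reflexivity|apply Hnn, Ht|apply Hv, Ht]. }
rewrite <- (eval_req _ _ _ Hev2 HTv).
apply (eval_req _ _ _ Hev) in HY; revert HY.
rewrite eval_radd, !eval_rmul, !eval_rsub_base.
assert (Hsub : forall f1 f2 A, eval (fun g => f1 g - f2 g) A = eval f1 A - eval f2 A).
{ intros f1 f2 A; unfold eval; rewrite <- Rsum_minus; apply Rsum_ext_in; intros; ring. }
assert (HI : forall A, eval (fun h => ind (first_pos (mmul matI h))) A = eval (fun h => ind (first_pos h)) A).
{ intros A; apply Rsum_ext_in; intros; rewrite mmul_matI_l; reflexivity. }
assert (HT : forall A, eval (fun h => ind (first_pos (mmul matT h))) A = eval (fun h => ind (first_pos h)) A).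
{ intros A; apply Rsum_ext_in; intros; rewrite first_pos_T; reflexivity. }
rewrite HT, !HI, Hsub; intros HY; rewrite HY, Rminus_diag, Rplus_0_r.
apply Rsum_ext_in; intros t _; rewrite eval_rsub_base, mmul_matI_r; reflexivity.
Qed.

End Lattice.

(** * Nonnegative double series *)

Lemma Rsum_nonneg {A : Type} (f : A -> R) l : (forall x, 0 <= f x) -> 0 <= Rsum f l.
Proof.
intros Hf; induction l as [|x l IH]; [apply Rle_refl|].
rewrite Rsum_cons; specialize (Hf x); lra.
Qed.

Lemma Rsum_incl_le {A : Type} (f : A -> R) l1 l2 :
  (forall x, 0 <= f x) -> NoDup l1 -> incl l1 l2 -> Rsum f l1 <= Rsum f l2.
Proof.
intros Hf; revert l2; induction l1 as [|x l1 IH]; intros l2 Hl Hi.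
- apply Rsum_nonneg, Hf.
- apply NoDup_cons_iff in Hl as [Hx Hl].
  destruct (in_split x l2 (Hi x (or_introl eq_refl))) as (a & b & ->).
  rewrite Rsum_app, !Rsum_cons.
  assert (H : Rsum f l1 <= Rsum f (a ++ b)).
  { apply IH; [exact Hl|]; intros y Hy; pose proof (Hi y (or_intror Hy)) as H.
    apply in_or_app; apply in_app_or in H as [H|[H|H]]; auto; subst; contradiction. }
  rewrite Rsum_app in H; lra.
Qed.

Lemma Rsum_seq_S (a : nat -> R) N : Rsum a (seq 0 (S N)) = Rsum a (seq 0 N) + a N.
Proof. rewrite seq_S, Rsum_app; unfold Rsum at 2; cbn; ring. Qed.

Lemma Rsum_seq_sum_n (a : nat -> R) N : Rsum a (seq 0 (S N)) = sum_n a N.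
Proof.
induction N as [|N IH]; [rewrite sum_O; unfold Rsum; cbn; ring|].
rewrite Rsum_seq_S, IH, sum_Sn; reflexivity.
Qed.

Lemma is_series_Rsum (a : nat -> R) (l : R) :
  is_series a l <-> is_lim_seq (fun N => Rsum a (seq 0 N)) l.
Proof.
rewrite is_lim_seq_incr_1; unfold is_series, is_lim_seq.
split; apply filterlim_ext; intros N; rewrite Rsum_seq_sum_n; reflexivity.
Qed.

Lemma ex_series_lim_Rsum (a : nat -> R) : ex_series a ->
  is_lim_seq (fun N => Rsum a (seq 0 N)) (Series a).
Proof. intros H; apply is_series_Rsum, Series_correct, H. Qed.

Lemma Rsum_le_Series (a : nat -> R) N : (forall i, 0 <= a i) -> ex_series a ->
  Rsum a (seq 0 N) <= Series a.
Proof.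
intros Ha Hs; apply (is_lim_seq_incr_compare _ _ (ex_series_lim_Rsum a Hs)).
intros k; rewrite Rsum_seq_S; specialize (Ha k); lra.
Qed.

Lemma is_lim_seq_Rsum {A : Type} (u : A -> nat -> R) (l : A -> R) (L : list A) :
  (forall x, In x L -> is_lim_seq (u x) (l x)) ->
  is_lim_seq (fun N => Rsum (fun x => u x N) L) (Rsum l L).
Proof.
induction L as [|x L IH]; intros H; [apply is_lim_seq_const|].
eapply is_lim_seq_plus'; [apply H; left; reflexivity|].
apply IH; intros y Hy; apply H; right; exact Hy.
Qed.

Definition box (N : nat) : list (nat * nat) := list_prod (seq 0 N) (seq 0 N).

Lemma in_box N i j : In (i, j) (box N) <-> (i < N)%nat /\ (j < N)%nat.
Proof. unfold box; rewrite in_prod_iff, !in_seq; lia. Qed.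

Lemma NoDup_box N : NoDup (box N).
Proof.
unfold box; generalize (seq_NoDup N 0), (seq_NoDup N 0).
generalize (seq 0 N) at 1 3 as l; generalize (seq 0 N) as m; intros m l Hl Hm.
induction Hl as [|i l Hi Hl IH]; [constructor|].
cbn [list_prod]; apply NoDup_app; [|exact IH|].
- apply FinFun.Injective_map_NoDup; [intros a b [= H]; exact H|exact Hm].
- intros [a b] H1 H2; apply in_map_iff in H1 as (y & [= <- <-] & _).
  apply in_prod_iff in H2; tauto.
Qed.

Lemma incl_box (l : list (nat * nat)) : exists N, incl l (box N).
Proof.
induction l as [|[i j] l [N IH]]; [exists 0%nat; intros x []|].
exists (S (N + i + j)); intros [a b] [[= <- <-]|H]; apply in_box; [lia|].
apply IH, in_box in H; lia.
Qed.

Lemma Rsum_box (F : nat -> nat -> R) I J :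
  Rsum (fun v => F (fst v) (snd v)) (list_prod (seq 0 I) (seq 0 J))
  = Rsum (fun i => Rsum (F i) (seq 0 J)) (seq 0 I).
Proof.
generalize (seq 0 I) as l; intros l; induction l as [|i l IH]; [reflexivity|].
cbn [list_prod]; rewrite Rsum_app, Rsum_cons, Rsum_map, IH; reflexivity.
Qed.

Section DoubleSeries.
Variable F : nat -> nat -> R.
Hypothesis F_nonneg : forall i j, 0 <= F i j.
Hypothesis F_row : forall i, ex_series (F i).
Hypothesis F_sum : ex_series (fun i => Series (F i)).

Lemma Series_row_nonneg i : 0 <= Series (F i).
Proof. apply (Rsum_le_Series (F i) 0 (F_nonneg i) (F_row i)). Qed.

Lemma Rsum_box_le N :
  Rsum (fun v => F (fst v) (snd v)) (box N) <= Series (fun i => Series (F i)).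
Proof.
unfold box; rewrite Rsum_box.
apply Rle_trans with (Rsum (fun i => Series (F i)) (seq 0 N)).
- apply Rsum_le; intros i _; apply Rsum_le_Series; auto.
- apply Rsum_le_Series; auto using Series_row_nonneg.
Qed.

Lemma Rsum_box_approx (eps : posreal) :
  exists N, Series (fun i => Series (F i)) - eps < Rsum (fun v => F (fst v) (snd v)) (box N).
Proof.
pose proof (ex_series_lim_Rsum _ F_sum) as H.
apply is_lim_seq_spec in H; destruct (H (pos_div_2 eps)) as [I HI].
specialize (HI I (Nat.le_refl _)); cbn in HI; apply Rabs_def2 in HI as [_ HI].
assert (H2 : is_lim_seq (fun J => Rsum (fun i => Rsum (F i) (seq 0 J)) (seq 0 I))
  (Rsum (fun i => Series (F i)) (seq 0 I)))
  by (apply is_lim_seq_Rsum; intros i _; apply ex_series_lim_Rsum, F_row).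
apply is_lim_seq_spec in H2; destruct (H2 (pos_div_2 eps)) as [J HJ].
exists (Nat.max I J); specialize (HJ (Nat.max I J) (Nat.le_max_r _ _)).
cbn in HJ; apply Rabs_def2 in HJ as [_ HJ].
unfold box; rewrite Rsum_box.
apply Rlt_le_trans with (Rsum (fun i => Rsum (F i) (seq 0 (Nat.max I J))) (seq 0 I)); [lra|].
apply Rsum_incl_le; [intros i; apply Rsum_nonneg; auto|apply seq_NoDup|].
intros i; rewrite !in_seq; lia.
Qed.

End DoubleSeries.

(** The region [D] is exhausted in two ways: by boxes of target points, and by images under [h] of
    boxes of parameters. Each finite piece of one kind lies in a piece of the other, so
    nonnegativity squeezes both limits together. Sums over the images of different maps [h] thereby
    become limits over the same boxes. *)
Lemma box_sum_lim (f : nat * nat -> R) (h : nat * nat -> nat * nat) (D : nat * nat -> bool) :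
  (forall v, 0 <= f v) -> (forall u u', h u = h u' -> u = u') ->
  (forall v, D v = true <-> exists u, h u = v) ->
  (forall i, ex_series (fun j => f (h (i, j)))) ->
  ex_series (fun i => Series (fun j => f (h (i, j)))) ->
  is_lim_seq (fun N => Rsum (fun v => ind (D v) * f v) (box N))
    (Series (fun i => Series (fun j => f (h (i, j))))).
Proof.
intros Hf Hinj HD Hrow Hsum.
set (F := fun i j => f (h (i, j))) in *.
assert (HF : forall i j, 0 <= F i j) by (intros; apply Hf).
assert (Hbox : forall M, Rsum (fun v => F (fst v) (snd v)) (box M) = Rsum f (map h (box M))).
{ intros M; rewrite Rsum_map; apply Rsum_ext_in; intros [i j] _; reflexivity. }
assert (HDf : forall l, Rsum (fun v => ind (D v) * f v) l = Rsum f (filter D l)).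
{ induction l as [|v l IH]; [reflexivity|]. rewrite Rsum_cons, IH; cbn [filter].
  destruct (D v); cbn [ind]; rewrite ?Rsum_cons; ring. }
apply is_lim_seq_spec; intros eps.
destruct (Rsum_box_approx F HF Hrow Hsum eps) as [M HM].
destruct (incl_box (map h (box M))) as [N HN].
exists N; intros K HK; rewrite HDf.
assert (Hup : Rsum f (filter D (box K)) <= Series (fun i => Series (F i))).
{ assert (Hpre : forall l : list (nat * nat), exists lu, incl (filter D l) (map h lu)).
  { induction l as [|v l [lu IH]]; [exists nil; intros x []|].
    cbn [filter]; destruct (D v) eqn:E; [|exists lu; exact IH].
    apply HD in E as [u Hu]; exists (u :: lu); intros w [<-|Hw]; [left; exact Hu|].
    right; apply IH, Hw. }
  destruct (Hpre (box K)) as [lu Hlu]; destruct (incl_box lu) as [P HP].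
  apply Rle_trans with (Rsum f (map h (box P))).
  - apply Rsum_incl_le; [exact Hf|apply NoDup_filter, NoDup_box|].
    intros v Hv; apply (incl_map h HP), Hlu, Hv.
  - rewrite <- Hbox; apply Rsum_box_le; assumption. }
assert (Hlow : Rsum f (map h (box M)) <= Rsum f (filter D (box K))).
{ apply Rsum_incl_le; [exact Hf| |].
  - apply FinFun.Injective_map_NoDup; [intros u u'; apply Hinj|apply NoDup_box].
  - intros v Hv; apply filter_In; split.
    + apply HN in Hv; destruct v as [a b]; apply in_box in Hv; apply in_box; lia.
    + apply HD; apply in_map_iff in Hv as (u & Hu & _); exists u; exact Hu. }
rewrite <- Hbox in Hlow; pose proof (cond_pos eps).
change (fun i => Series (fun j => f (h (i, j)))) with (fun i => Series (F i)).
apply Rabs_def1; lra.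
Qed.

(** The row vector [(i + 1, j)] times a nonnegative matrix. *)
Definition vec_mul (g : mat) (u : nat * nat) : nat * nat :=
  ((fst u + 1) * Z.to_nat (ma g) + snd u * Z.to_nat (mc g),
   (fst u + 1) * Z.to_nat (mb g) + snd u * Z.to_nat (md g))%nat.

Lemma vec_mul_inj n g u u' : (1 <= n)%nat -> nonneg_entries g -> mdet g = Z.of_nat n ->
  vec_mul g u = vec_mul g u' -> u = u'.
Proof.
destruct g as [a b c d], u as [i j], u' as [i' j']; unfold nonneg_entries, mdet, vec_mul.
cbn [ma mb mc md fst snd]; intros Hn (Ha & Hb & Hc & Hd) Hdet H.
injection H as H1 H2; apply (f_equal Z.of_nat) in H1, H2.
rewrite !Nat2Z.inj_add, !Nat2Z.inj_mul, !Nat2Z.inj_add, !Z2Nat.id in H1, H2 by assumption.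
assert (E1 : ((Z.of_nat i - Z.of_nat i') * a + (Z.of_nat j - Z.of_nat j') * c = 0)%Z) by lia.
assert (E2 : ((Z.of_nat i - Z.of_nat i') * b + (Z.of_nat j - Z.of_nat j') * d = 0)%Z) by lia.
assert (E3 : ((Z.of_nat i - Z.of_nat i') * (a * d - b * c) = 0)%Z)
  by (transitivity (d * ((Z.of_nat i - Z.of_nat i') * a + (Z.of_nat j - Z.of_nat j') * c)
     - c * ((Z.of_nat i - Z.of_nat i') * b + (Z.of_nat j - Z.of_nat j') * d))%Z;
     [ring|rewrite E1, E2; ring]).
assert (E4 : ((Z.of_nat j - Z.of_nat j') * (a * d - b * c) = 0)%Z)
  by (transitivity (a * ((Z.of_nat i - Z.of_nat i') * b + (Z.of_nat j - Z.of_nat j') * d)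
     - b * ((Z.of_nat i - Z.of_nat i') * a + (Z.of_nat j - Z.of_nat j') * c))%Z;
     [ring|rewrite E1, E2; ring]).
apply Z.mul_eq_0 in E3, E4; f_equal; lia.
Qed.

(** By Cramer's rule [(vec1 g, vec2 g) / n] is the only rational row vector that [g] sends to [v].
    Its first coordinate is [i + 1], whence the shift by one in the witness. *)
Lemma in_quadrant_vec_mul n g v : (1 <= n)%nat -> nonneg_entries g -> mdet g = Z.of_nat n ->
  in_quadrant n (fst v) (snd v) g = true <-> exists u, vec_mul g u = v.
Proof.
destruct g as [a b c d], v as [p q]; intros Hn Hg Hdet.
unfold in_quadrant; rewrite !andb_true_iff, integral_iff, Z.ltb_lt, Z.leb_le by exact Hn.
unfold vec1, vec2, nonneg_entries, mdet, vec_mul in *.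
cbn [ma mb mc md fst snd] in *; destruct Hg as (Ha & Hb & Hc & Hd).
split.
- intros [[[[u1 H1] [u2 H2]] P1] P2].
  assert (0 < u1)%Z by nia. assert (0 <= u2)%Z by nia.
  exists (Z.to_nat (u1 - 1), Z.to_nat u2); cbn [fst snd].
  assert (E1 : (Z.of_nat n * Z.of_nat p = Z.of_nat n * (u1 * a + u2 * c))%Z).
  { transitivity ((Z.of_nat p * d - Z.of_nat q * c) * a + (Z.of_nat q * a - Z.of_nat p * b) * c)%Z;
      [rewrite <- Hdet; ring|rewrite H1, H2; ring]. }
  assert (E2 : (Z.of_nat n * Z.of_nat q = Z.of_nat n * (u1 * b + u2 * d))%Z).
  { transitivity ((Z.of_nat p * d - Z.of_nat q * c) * b + (Z.of_nat q * a - Z.of_nat p * b) * d)%Z;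
      [rewrite <- Hdet; ring|rewrite H1, H2; ring]. }
  apply Z.mul_cancel_l in E1, E2; [|lia|lia].
  f_equal; apply Nat2Z.inj; rewrite Nat2Z.inj_add, !Nat2Z.inj_mul, Nat2Z.inj_add, !Z2Nat.id by lia;
    lia.
- intros [[i j] [= <- <-]]; cbn [fst snd].
  rewrite !Nat2Z.inj_add, !Nat2Z.inj_mul, !Nat2Z.inj_add, !Z2Nat.id by assumption.
  set (zi := Z.of_nat i); set (zj := Z.of_nat j).
  replace (_ - _)%Z with ((zi + 1) * Z.of_nat n)%Z by (rewrite <- Hdet; cbn; ring).
  replace (_ - _)%Z with (zj * Z.of_nat n)%Z at 1 by (rewrite <- Hdet; cbn; ring).
  replace (_ - _)%Z with (zj * Z.of_nat n)%Z by (rewrite <- Hdet; cbn; ring).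
  unfold zi, zj; repeat split; try apply Z.divide_factor_r; lia.
Qed.

(** * Series *)

Lemma ex_series_nonneg_bounded (a : nat -> R) (M : R) :
  (forall i, 0 <= a i) -> (forall N, Rsum a (seq 0 N) <= M) -> ex_series a.
Proof.
intros Ha HM.
destruct (ex_finite_lim_seq_incr (fun N => Rsum a (seq 0 N)) M) as [l Hl].
- intros N; rewrite Rsum_seq_S; specialize (Ha N); lra.
- exact HM.
- exists l; apply is_series_Rsum, Hl.
Qed.

Lemma is_series_telescope (t : nat -> R) (l : R) :
  is_lim_seq t l -> is_series (fun i => t i - t (S i)) (t 0%nat - l).
Proof.
intros Ht; apply is_series_Rsum.
apply is_lim_seq_ext with (fun N => t 0%nat - t N).
- induction n as [|N IH]; [unfold Rsum; cbn; ring|]. rewrite Rsum_seq_S, <- IH; ring.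
- eapply is_lim_seq_minus'; [apply is_lim_seq_const|exact Ht].
Qed.

Lemma Rpower_pos y b : 0 < Rpower y b.
Proof. apply exp_pos. Qed.

Lemma is_derive_Rpower b y : 0 < y -> is_derive (fun y => Rpower y b) y (b * Rpower y (b - 1)).
Proof.
intros Hy; unfold Rpower; auto_derive; [exact Hy|].
replace ((b - 1) * ln y) with (b * ln y + - ln y) by ring.
rewrite exp_plus, exp_Ropp, exp_ln by exact Hy; field; lra.
Qed.

Lemma is_derive_MVT (f df : R -> R) (a b : R) : a <= b ->
  (forall y, a <= y <= b -> is_derive f y (df y)) ->
  exists c, a <= c <= b /\ f b - f a = df c * (b - a).
Proof.
intros Hab Hf; destruct (MVT_gen f a b df) as (c & Hc & E).
- intros y Hy; rewrite Rmin_left, Rmax_right in Hy by exact Hab; apply Hf; lra.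
- intros y Hy; rewrite Rmin_left, Rmax_right in Hy by exact Hab.
  apply continuity_pt_filterlim, (ex_derive_continuous f); exists (df y); apply Hf, Hy.
- rewrite Rmin_left, Rmax_right in Hc by exact Hab; exists c; auto.
Qed.

Lemma Rpower_antitone y z a : 0 < y <= z -> 0 <= a -> Rpower z (- a) <= Rpower y (- a).
Proof.
intros Hy Ha; unfold Rpower; 
destruct (Req_dec y z) as [->|Hne]; [apply Rle_refl|].
assert (ln y < ln z) by (apply ln_increasing; lra).
apply Rnot_lt_le; intros H1; apply exp_lt_inv in H1; nra.
Qed.

Lemma INR_S_pos i : 0 < INR (S i).
Proof. apply lt_0_INR; lia. Qed.

(** Integral comparison: by the mean value theorem the term at [y + 1] is at most [1 / (a - 1)]
    times the drop of [y ^ (1 - a)] from [y] to [y + 1], and these drops telescope. *)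
Lemma ex_series_Rpower a : 1 < a -> ex_series (fun i => Rpower (INR (S i)) (- a)).
Proof.
intros Ha.
apply (ex_series_nonneg_bounded _ (1 + / (a - 1))); [intros; apply Rlt_le, Rpower_pos|].
assert (H1 : forall b, Rpower 1 b = 1) by (intros b; unfold Rpower; rewrite ln_1, Rmult_0_r; apply exp_0).
assert (Hi : 0 < / (a - 1)) by (apply Rinv_0_lt_compat; lra).
assert (H : forall N, Rsum (fun i => Rpower (INR (S i)) (- a)) (seq 0 (S N))
   <= 1 + / (a - 1) * (1 - Rpower (INR (S N)) (1 - a))).
{ induction N as [|N IH].
  - unfold Rsum; cbn [seq map fold_right INR]; rewrite !H1; lra.
  - rewrite Rsum_seq_S; set (y := INR (S N)) in *.
    assert (Hy : 0 < y) by apply INR_S_pos.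
    replace (INR (S (S N))) with (y + 1) by (rewrite (S_INR (S N)); reflexivity).
    destruct (is_derive_MVT (fun y => Rpower y (1 - a)) (fun y => (1 - a) * Rpower y (1 - a - 1)) y (y + 1))
      as (c & Hc & E); [lra|intros z Hz; apply is_derive_Rpower; lra|].
    assert (Hp : Rpower (y + 1) (- a) <= Rpower c (- a)) by (apply Rpower_antitone; lra).
    replace (1 - a - 1) with (- a) in E by ring.
    assert (E2 : Rpower c (- a) = / (a - 1) * (Rpower y (1 - a) - Rpower (y + 1) (1 - a)))
      by (field_simplify_eq; [|lra]; nra).
    nra. }
intros [|N]; [unfold Rsum; cbn; lra|].
eapply Rle_trans; [apply H|].
pose proof (Rpower_pos (INR (S N)) (1 - a)); nra.
Qed.

Lemma ex_series_le_abs (a b : nat -> R) : (forall i, Rabs (a i) <= b i) -> ex_series b -> ex_series a.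
Proof. intros H Hb; apply (ex_series_le a b); [exact H|exact Hb]. Qed.

Lemma Series_abs_le (a b : nat -> R) :
  (forall i, Rabs (a i) <= b i) -> ex_series b -> Rabs (Series a) <= Series b.
Proof.
intros H Hb.
eapply Rle_trans; [apply Series_Rabs|].
- apply (ex_series_le_abs _ b); [intros i; rewrite Rabs_Rabsolu; apply H|exact Hb].
- apply Series_le; [intros i; split; [apply Rabs_pos|apply H]|exact Hb].
Qed.

Section DoublyDominated.
Variables (F : nat -> nat -> R) (K : R) (w : nat -> R).
Hypothesis HF : forall i j, Rabs (F i j) <= K * w i * w j.
Hypothesis Hw : ex_series w.

Lemma dominated_row i : ex_series (F i).
Proof.
apply (ex_series_le_abs _ (fun j => (K * w i) * w j)); [apply HF|].
apply (ex_series_scal_l (K * w i) w Hw).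
Qed.

Lemma dominated_row_le i : Rabs (Series (F i)) <= (K * Series w) * w i.
Proof.
replace (K * Series w * w i) with (Series (fun j => (K * w i) * w j))
  by (rewrite Series_scal_l; ring).
apply Series_abs_le; [apply HF|apply (ex_series_scal_l (K * w i) w Hw)].
Qed.

Lemma dominated_sum : ex_series (fun i => Series (F i)).
Proof.
apply (ex_series_le_abs _ (fun i => (K * Series w) * w i)); [apply dominated_row_le|].
apply (ex_series_scal_l (K * Series w) w Hw).
Qed.

Lemma dominated_sum_le : Rabs (Series (fun i => Series (F i))) <= K * (Series w * Series w).
Proof.
replace (K * (Series w * Series w)) with (Series (fun i => (K * Series w) * w i))
  by (rewrite Series_scal_l; ring).
apply Series_abs_le; [apply dominated_row_le|apply (ex_series_scal_l (K * Series w) w Hw)].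
Qed.

End DoublyDominated.

Definition node (x : R) (i j : nat) : R := INR (S i) * x + INR j.

Lemma node_ge x c i j : 0 < c -> c <= x -> c <= 1 ->
  c * INR (S i) <= node x i j /\ c * INR (S j) <= node x i j.
Proof.
intros Hc Hx H1; unfold node; rewrite !S_INR.
pose proof (pos_INR i); pose proof (pos_INR j); split; nra.
Qed.

Lemma node_pos x i j : 0 < x -> 0 < node x i j.
Proof. intros Hx; unfold node; rewrite S_INR; pose proof (pos_INR i); pose proof (pos_INR j); nra. Qed.

Lemma node_ge_min x c i j : 0 < c -> c <= x -> c <= 1 -> c <= node x i j.
Proof.
intros Hc Hx H1; destruct (node_ge x c i j Hc Hx H1) as [H _].
rewrite S_INR in H; pose proof (pos_INR i); nra.
Qed.

(** The node dominates both [c (i + 1)] and [c (j + 1)], so the share [a] of the exponent can be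
    spent on [i] and the share [b] on [j]. This bounds a double series by a product of two single
    ones. *)
Lemma Rpower_node_le x c a b i j : 0 < c -> c <= x -> c <= 1 -> 0 <= a -> 0 <= b ->
  Rpower (node x i j) (- (a + b)) <=
  Rpower c (- (a + b)) * Rpower (INR (S i)) (- a) * Rpower (INR (S j)) (- b).
Proof.
intros Hc Hx H1 Ha Hb; destruct (node_ge x c i j Hc Hx H1) as [Hi Hj].
pose proof (INR_S_pos i); pose proof (INR_S_pos j).
assert (L : forall u v, 0 < u -> u <= v -> ln u <= ln v).
{ intros u v Hu [Huv| ->]; [left; apply ln_increasing; assumption|right; reflexivity]. }
apply L in Hi, Hj; [|nra|nra]; rewrite ln_mult in Hi, Hj by assumption.
unfold Rpower; rewrite <- !exp_plus.
apply Rnot_lt_le; intros H2; apply exp_lt_inv in H2; nra.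
Qed.

(** * The Hecke relation for the double zeta function *)

(** Barnes's double zeta function with periods [x] and 1, taken at the point [x]. *)
Definition dzeta (s x : R) : R :=
  Series (fun i => Series (fun j => Rpower (node x i j) (- s))).

Lemma dzeta_dominated s x : 2 < s -> 0 < x ->
  exists K w, ex_series w /\ forall i j, Rabs (Rpower (node x i j) (- s)) <= K * w i * w j.
Proof.
intros Hs Hx.
exists (Rpower (Rmin x 1) (- s)), (fun i => Rpower (INR (S i)) (- (s / 2))); split.
- apply ex_series_Rpower; lra.
- intros i j; rewrite Rabs_pos_eq by apply Rlt_le, Rpower_pos.
  replace s with (s / 2 + s / 2) at 1 2 by field.
  apply Rpower_node_le; [apply Rmin_pos; lra|apply Rmin_l|apply Rmin_r|lra|lra].
Qed.

Lemma IZR_nonneg_INR z : (0 <= z)%Z -> INR (Z.to_nat z) = IZR z.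
Proof. intros Hz; rewrite INR_IZR_INZ, Z2Nat.id by exact Hz; reflexivity. Qed.

Lemma Rpower_mult_base u v b : 0 < u -> 0 < v -> Rpower (u * v) b = Rpower u b * Rpower v b.
Proof. intros Hu Hv; unfold Rpower; rewrite ln_mult, <- exp_plus by assumption; f_equal; ring. Qed.

Lemma det_pos_linear_pos n g x : (1 <= n)%nat -> nonneg_entries g -> mdet g = Z.of_nat n -> 0 < x ->
  0 < IZR (ma g) * x + IZR (mb g) /\ 0 < IZR (mc g) * x + IZR (md g).
Proof.
destruct g as [a b c d]; unfold nonneg_entries, mdet; cbn [ma mb mc md].
intros Hn (Ha & Hb & Hc & Hd) Hdet Hx.
assert (H : forall u v, (0 <= u)%Z -> (0 <= v)%Z -> (u <> 0 \/ v <> 0)%Z -> 0 < IZR u * x + IZR v).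
{ intros u v Hu Hv [H|H].
  - assert (1 <= IZR u) by (apply IZR_le; lia). apply IZR_le in Hv; nra.
  - assert (1 <= IZR v) by (apply IZR_le; lia). apply IZR_le in Hu; nra. }
split; apply H; trivial; nia.
Qed.

(** With [u = a x + b] and [w = c x + d], the product [w * node (u / w) i j] equals [p x + q] for
    [(p, q) = (i + 1, j) g]. A slashed double zeta function is therefore the sum of
    [(p x + q) ^ (- s)] over the points whose preimage under [g] lies in the quadrant, and the
    eigenvalue terms are sums over multiples of [l]. The weights of each point [(p, q)] agree on the
    two sides. *)
Lemma dzeta_Hecke (n : nat) (Tn v : comb) (s x : R) :
  (1 <= n)%nat -> acts_like_Hecke n Tn -> in_R n v -> req Tn v ->
  List.Forall (fun t => nonneg_entries (snd t)) v -> 2 < s -> 0 < x ->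
  Rsum (fun t => let g := snd t in
     let u := IZR (ma g) * x + IZR (mb g) in let w := IZR (mc g) * x + IZR (md g) in
     Q2R (fst t) * (Rpower w (- s) * dzeta s (u / w))) v
  = Rsum (fun l => INR l * (Rpower (INR l) (- s) * dzeta s x)) (divisors n).
Proof.
intros Hn HT Hv HTv Hnn Hs Hx.
set (f := fun v : nat * nat => Rpower (INR (fst v) * x + INR (snd v)) (- s)).
assert (Hf : forall v, 0 <= f v) by (intros; apply Rlt_le, Rpower_pos).
(* [h] parametrises the points of the region [D], and [C] is the scale between the form [p x + q] at
   these points and the nodes of the argument [y]. *)
assert (Hlim : forall h D C y, 0 < y -> 0 < C ->
   (forall u u', h u = h u' -> u = u') -> (forall v, D v = true <-> exists u, h u = v) ->
   (forall i j, INR (fst (h (i, j))) * x + INR (snd (h (i, j))) = C * node y i j) ->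
   is_lim_seq (fun N => Rsum (fun v => ind (D v) * f v) (box N)) (Rpower C (- s) * dzeta s y)).
{ intros h D C y Hy HC Hinj HD HE.
  destruct (dzeta_dominated s y Hs Hy) as (K & w & Hw & HK).
  assert (E : forall i j, f (h (i, j)) = Rpower C (- s) * Rpower (node y i j) (- s)).
  { intros i j; unfold f; rewrite HE, Rpower_mult_base by auto using node_pos; reflexivity. }
  replace (Rpower C (- s) * dzeta s y) with (Series (fun i => Series (fun j => f (h (i, j))))).
  2:{ unfold dzeta; rewrite <- Series_scal_l; apply Series_ext; intros i.
      rewrite <- Series_scal_l; apply Series_ext; intros j; apply E. }
  assert (HK2 : forall i j, Rabs (f (h (i, j))) <= (Rpower C (- s) * K) * w i * w j).
  { intros i j; rewrite E, Rabs_mult, (Rabs_pos_eq (Rpower C _)) by apply Rlt_le, Rpower_pos.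
    rewrite !Rmult_assoc; apply Rmult_le_compat_l; [apply Rlt_le, Rpower_pos|].
    rewrite <- Rmult_assoc; apply HK. }
  apply box_sum_lim; trivial.
  - exact (dominated_row _ _ _ HK2 Hw).
  - exact (dominated_sum _ _ _ HK2 Hw). }
assert (Hleft : is_lim_seq (fun N => Rsum (fun t => Q2R (fst t) *
    Rsum (fun pq => ind (in_quadrant n (fst pq) (snd pq) (snd t)) * f pq) (box N)) v)
  (Rsum (fun t => let g := snd t in
     let u := IZR (ma g) * x + IZR (mb g) in let w := IZR (mc g) * x + IZR (md g) in
     Q2R (fst t) * (Rpower w (- s) * dzeta s (u / w))) v)).
{ apply (is_lim_seq_Rsum (fun t N => Q2R (fst t) *
    Rsum (fun pq => ind (in_quadrant n (fst pq) (snd pq) (snd t)) * f pq) (box N))).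
  intros t Ht; cbn zeta; unfold in_R in Hv; rewrite Forall_forall in Hv, Hnn.
  specialize (Hv t Ht); specialize (Hnn t Ht); cbn beta in Hv, Hnn.
  destruct (det_pos_linear_pos n (snd t) x Hn Hnn Hv Hx) as [Hu Hw].
  apply (is_lim_seq_scal_l _ (Q2R (fst t)) (Finite _)).
  apply (Hlim (vec_mul (snd t))).
  - apply Rdiv_lt_0_compat; assumption.
  - exact Hw.
  - intros u u'; apply (vec_mul_inj n); assumption.
  - intros w; apply in_quadrant_vec_mul; assumption.
  - intros i j; unfold vec_mul, node; cbn [fst snd].
    destruct Hnn as (Ha & Hb & Hc & Hd).
    rewrite !plus_INR, !mult_INR, !plus_INR, !IZR_nonneg_INR, (S_INR i) by assumption; cbn [INR].
    field; lra. }
assert (Hright : is_lim_seq (fun N => Rsum (fun l => INR l *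
    Rsum (fun pq => ind ((fst pq mod l =? 0) && (snd pq mod l =? 0) && (0 <? fst pq))%nat * f pq) (box N))
    (divisors n))
  (Rsum (fun l => INR l * (Rpower (INR l) (- s) * dzeta s x)) (divisors n))).
{ apply (is_lim_seq_Rsum (fun l N => INR l *
    Rsum (fun pq => ind ((fst pq mod l =? 0) && (snd pq mod l =? 0) && (0 <? fst pq))%nat * f pq) (box N))).
  intros l Hl; apply in_divisors in Hl as [_ Hl]; [|exact Hn].
  apply (is_lim_seq_scal_l _ (INR l) (Finite _)).
  apply (Hlim (fun u => ((fst u + 1) * l, snd u * l)%nat)).
  - exact Hx.
  - apply lt_0_INR; lia.
  - intros [i j] [i' j']; cbn [fst snd]; intros E; injection E as E1 E2; f_equal; nia.
  - intros [p q]; cbn [fst snd].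
    rewrite !andb_true_iff, !Nat.eqb_eq, !Nat.Lcm0.mod_divide, Nat.ltb_lt; split.
    + intros [[[i2 Hi] [j2 Hj]] Hp]; exists (i2 - 1, j2)%nat; cbn [fst snd].
      assert (i2 <> 0)%nat by (intros ->; lia).
      replace (i2 - 1 + 1)%nat with i2 by lia; congruence.
    + intros [[i2 j2] E]; cbn [fst snd] in E; injection E as <- <-.
      repeat split; try apply Nat.divide_factor_r; nia.
  - intros i j; unfold node; cbn [fst snd]; rewrite !mult_INR, plus_INR, (S_INR i); cbn [INR]; ring. }
apply is_lim_seq_unique in Hleft, Hright.
enough (E : Finite (Rsum (fun t => let g := snd t in
     let u := IZR (ma g) * x + IZR (mb g) in let w := IZR (mc g) * x + IZR (md g) in
     Q2R (fst t) * (Rpower w (- s) * dzeta s (u / w))) v) =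
  Finite (Rsum (fun l => INR l * (Rpower (INR l) (- s) * dzeta s x)) (divisors n)))
  by (injection E; auto).
(* The box sums agree before the limit: exchanging the finite sums leaves one instance of
   [Hecke_in_quadrant] for each point. *)
rewrite <- Hleft, <- Hright; apply Lim_seq_ext; intros N.
transitivity (Rsum (fun pq => f pq *
  Rsum (fun t => Q2R (fst t) * ind (in_quadrant n (fst pq) (snd pq) (snd t))) v) (box N)).
- rewrite (Rsum_ext_in _ (fun t => Rsum (fun pq =>
    Q2R (fst t) * ind (in_quadrant n (fst pq) (snd pq) (snd t)) * f pq) (box N))).
  + rewrite Rsum_exchange; apply Rsum_ext_in; intros pq _; rewrite <- Rsum_scal.
    apply Rsum_ext_in; intros; ring.
  + intros t _; rewrite <- Rsum_scal; apply Rsum_ext_in; intros; ring.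
- rewrite (Rsum_ext_in (fun l => INR l * _) (fun l => Rsum (fun pq =>
    INR l * ind ((fst pq mod l =? 0) && (snd pq mod l =? 0) && (0 <? fst pq))%nat * f pq) (box N))).
  + rewrite (Rsum_exchange (fun l pq => INR l *
      ind ((fst pq mod l =? 0) && (snd pq mod l =? 0) && (0 <? fst pq))%nat * f pq)).
    apply Rsum_ext_in; intros pq _; rewrite (Hecke_in_quadrant n _ _ Hn Tn) by assumption.
    rewrite <- Rsum_scal; apply Rsum_ext_in; intros; ring.
  + intros t _; rewrite <- Rsum_scal; apply Rsum_ext_in; intros; ring.
Qed.

(** * Derivatives of powers of the logarithm *)

Lemma is_derive_eq (f : R -> R) x (l l' : R) : is_derive f x l -> l = l' -> is_derive f x l'.
Proof. intros H <-; exact H. Qed.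

Lemma is_derive_positive_ext (f g : R -> R) x (l : R) : 0 < x ->
  (forall y, 0 < y -> f y = g y) -> is_derive f x l -> is_derive g x l.
Proof.
intros Hx H; apply is_derive_ext_loc; exists (mkposreal x Hx); intros y Hy; apply H.
apply Rabs_def2 in Hy as [_ Hy]; unfold minus, plus, opp in Hy; cbn in Hy; lra.
Qed.

Lemma is_derive_Rsum {A : Type} (f df : A -> R -> R) l x :
  (forall a, In a l -> is_derive (f a) x (df a x)) ->
  is_derive (fun y => Rsum (fun a => f a y) l) x (Rsum (fun a => df a x) l).
Proof.
induction l as [|a l IH]; intros H; [apply (is_derive_const (V := R_NormedModule) 0 x)|].
apply (is_derive_plus (V := R_NormedModule) (f a)); [apply H; left; reflexivity|].
apply IH; intros b Hb; apply H; right; exact Hb.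
Qed.

(* These forms are closed under differentiation, with [i] raised by one. *)
Definition log_form (i : nat) (l : list (R * nat)) (y : R) : R :=
  Rsum (fun cm => fst cm * ln y ^ snd cm / y ^ i) l.

Definition log_form_derive (i : nat) (l : list (R * nat)) : list (R * nat) :=
  flat_map (fun cm => [(fst cm * INR (snd cm), pred (snd cm)); (- (fst cm * INR i), snd cm)]) l.

Lemma is_derive_log_form i l y : 0 < y ->
  is_derive (log_form i l) y (log_form (S i) (log_form_derive i l) y).
Proof.
intros Hy; unfold log_form, log_form_derive; rewrite Rsum_flat_map.
apply (is_derive_Rsum (fun cm y => fst cm * ln y ^ snd cm / y ^ i)
  (fun x y => Rsum (fun cm => fst cm * ln y ^ snd cm / y ^ S i)
     [(fst x * INR (snd x), pred (snd x)); (- (fst x * INR i), snd x)])); intros [c m] _; cbn [fst snd].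
assert (y ^ i <> 0) by (apply pow_nonzero; lra).
auto_derive; [repeat split; trivial|].
unfold Rsum; cbn [map fold_right fst snd].
destruct i as [|i]; cbn [pow pred]; [rewrite !Rmult_0_l; cbn [INR]; field; lra|].
cbn [pow] in H; apply Rmult_neq_0_reg in H.
field; tauto.
Qed.

Lemma pow_le_exp (m : nat) t : 0 <= t -> t ^ m <= INR (fact m) * exp t.
Proof.
intros Ht; assert (Hf : 0 < INR (fact m)) by apply INR_fact_lt_0.
assert (H : t ^ m / INR (fact m) <= exp t).
{ eapply Rle_trans; [|apply (exp_ge_taylor t m Ht)].
  destruct m as [|m]; [apply Rle_refl|]; cbn [sum_f_R0].
  apply Rle_trans with (0 + t ^ S m / INR (fact (S m))); [lra|].
  apply Rplus_le_compat_r, cond_pos_sum; intros k.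
  apply Rdiv_le_0_compat; [apply pow_le, Ht|apply INR_fact_lt_0]. }
apply Rle_div_l in H; lra.
Qed.

Lemma exp_le a b : a <= b -> exp a <= exp b.
Proof. intros [H| ->]; [left; apply exp_increasing, H|right; reflexivity]. Qed.

(** With [L = |ln y|], one factor [exp (L / 4)] absorbs [L ^ m]; the other is reserved for
    [exp |eps ln y|] with [|eps| <= 1/4]. Together they cost half a power of [y], and [exp (- ln c)]
    covers the range [c <= y < 1], where [ln y] is negative. *)
Lemma log_pow_bound (m : nat) c y : 0 < c <= 1 -> c <= y ->
  Rabs (ln y) ^ m * exp (Rabs (ln y) / 4) <=
  (4 ^ m * INR (fact m) * exp (- ln c)) * Rpower y (1 / 2).
Proof.
intros Hc Hy; set (L := Rabs (ln y)).
assert (HL : 0 <= L) by apply Rabs_pos.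
assert (H1 : L ^ m <= 4 ^ m * (INR (fact m) * exp (L / 4))).
{ replace (L ^ m) with (4 ^ m * (L / 4) ^ m) by (rewrite <- Rpow_mult_distr; f_equal; field).
  apply Rmult_le_compat_l; [apply pow_le; lra|apply pow_le_exp; lra]. }
assert (H2 : exp (L / 4) * exp (L / 4) <= exp (- ln c) * Rpower y (1 / 2)).
{ unfold Rpower; rewrite <- !exp_plus; apply exp_le.
  assert (ln c <= ln y) by (destruct Hy as [Hy| ->]; [left; apply ln_increasing; lra|lra]).
  assert (ln c <= 0) by (rewrite <- ln_1; destruct Hc as [Hc1 [Hc2| ->]]; [left; apply ln_increasing; lra|lra]).
  unfold L; unfold Rabs; destruct (Rcase_abs (ln y)); lra. }
assert (0 <= 4 ^ m * INR (fact m))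
  by (apply Rmult_le_pos; [apply pow_le; lra|apply Rlt_le, INR_fact_lt_0]).
apply Rle_trans with ((4 ^ m * (INR (fact m) * exp (L / 4))) * exp (L / 4)).
- apply Rmult_le_compat_r; [apply Rlt_le, exp_pos|exact H1].
- apply Rle_trans with ((4 ^ m * INR (fact m)) * (exp (L / 4) * exp (L / 4))); [lra|].
  rewrite (Rmult_assoc (4 ^ m * _)); apply Rmult_le_compat_l; assumption.
Qed.

Lemma Rpower_div_pow y b i : 0 < y -> Rpower y b / y ^ i = Rpower y (b - INR i).
Proof.
intros Hy; unfold Rminus, Rdiv; rewrite Rpower_plus, Rpower_Ropp, Rpower_pow by exact Hy; reflexivity.
Qed.

Lemma log_form_bound i l c : 0 < c <= 1 ->
  exists K, 0 <= K /\ forall y, c <= y -> Rabs (log_form i l y) <= K * Rpower y (1 / 2 - INR i).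
Proof.
intros Hc; induction l as [|[a m] l (K & HK0 & HK)].
- exists 0; split; [lra|]; intros y _; unfold log_form, Rsum; cbn; rewrite Rabs_R0; lra.
- exists (Rabs a * (4 ^ m * INR (fact m) * exp (- ln c)) + K); split.
  + apply Rplus_le_le_0_compat; [|exact HK0].
    repeat apply Rmult_le_pos; try apply Rabs_pos; try (apply pow_le; lra);
      apply Rlt_le; [apply INR_fact_lt_0|apply exp_pos].
  + intros y Hy; unfold log_form; rewrite Rsum_cons; cbn [fst snd].
    rewrite Rmult_plus_distr_r; eapply Rle_trans; [apply Rabs_triang|].
    apply Rplus_le_compat; [|apply HK, Hy].
    assert (Hyi : 0 < y ^ i) by (apply pow_lt; lra).
    rewrite <- Rpower_div_pow by lra.
    assert (Hi : 0 <= / y ^ i) by apply Rlt_le, Rinv_0_lt_compat, Hyi.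
    assert (H : Rabs (ln y) ^ m <= 4 ^ m * INR (fact m) * exp (- ln c) * Rpower y (1 / 2)).
    { eapply Rle_trans; [|apply log_pow_bound; eassumption].
      rewrite <- (Rmult_1_r (Rabs (ln y) ^ m)) at 1.
      apply Rmult_le_compat_l; [apply pow_le, Rabs_pos|].
      rewrite <- exp_0; apply exp_le; pose proof (Rabs_pos (ln y)); lra. }
    unfold Rdiv; rewrite !Rabs_mult, (Rabs_pos_eq (/ y ^ i)), <- RPow_abs by exact Hi.
    rewrite <- Rmult_assoc; apply Rmult_le_compat_r; [exact Hi|].
    rewrite Rmult_assoc; apply Rmult_le_compat_l; [apply Rabs_pos|exact H].
Qed.

Fixpoint Dlog_coefs (r i : nat) : list (R * nat) :=
  match i with
  | O => [(1, r)]
  | S i => log_form_derive i (Dlog_coefs r i)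
  end.

(** The [i]-th derivative of [ln ^ r]. *)
Definition Dlog (i r : nat) : R -> R := log_form i (Dlog_coefs r i).

Lemma Dlog_0 r y : Dlog 0 r y = ln y ^ r.
Proof. unfold Dlog, log_form, Rsum; cbn; field. Qed.

Lemma is_derive_Dlog i r y : 0 < y -> is_derive (Dlog i r) y (Dlog (S i) r y).
Proof. apply is_derive_log_form. Qed.

Lemma Dlog_bound i r c : 0 < c <= 1 ->
  exists K, 0 <= K /\ forall y, c <= y -> Rabs (Dlog i r y) <= K * Rpower y (- (INR i - 1 / 2)).
Proof.
intros Hc; destruct (log_form_bound i (Dlog_coefs r i) c Hc) as (K & HK0 & HK).
exists K; split; [exact HK0|]; intros y Hy.
replace (- (INR i - 1 / 2)) with (1 / 2 - INR i) by ring; apply HK, Hy.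
Qed.

(** * Second differences *)

(** Meant for [u1 = u'] and [u2 = u'']. *)
Definition diff2 (u1 u2 : R -> R) (y : R) : R := u1 (y + 1) - u1 y - u2 y.

(** Two mean value steps: [u1 (y + 1) - u1 y = u2 a], then [u2 a - u2 y = u3 b * (a - y)] with
    [0 <= a - y <= 1]. *)
Lemma diff2_bound (u1 u2 u3 : R -> R) y M :
  (forall z, y <= z <= y + 1 -> is_derive u1 z (u2 z)) ->
  (forall z, y <= z <= y + 1 -> is_derive u2 z (u3 z)) ->
  (forall z, y <= z <= y + 1 -> Rabs (u3 z) <= M) ->
  Rabs (diff2 u1 u2 y) <= M.
Proof.
intros H1 H2 H3; unfold diff2.
destruct (is_derive_MVT u1 u2 y (y + 1)) as (a & Ha & E1); [lra|exact H1|].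
destruct (is_derive_MVT u2 u3 y a) as (b & Hb & E2); [lra|intros z Hz; apply H2; lra|].
replace (u1 (y + 1) - u1 y - u2 y) with (u3 b * (a - y)) by lra.
specialize (H3 b ltac:(lra)).
rewrite Rabs_mult, (Rabs_pos_eq (a - y)) by lra.
pose proof (Rabs_pos (u3 b)); nra.
Qed.

(** The second difference behaves like [Dlog (i + 2)], that is [y ^ (- (i + 2))] up to logarithms,
    for which the exponent gives up 1/2. At [i = 1] this leaves 5/2, more than the 2 needed for
    summation over a planar lattice. *)
Lemma diff2_Dlog_bound i r c : 0 < c <= 1 ->
  exists K, 0 <= K /\ forall y, c <= y ->
    Rabs (diff2 (Dlog i r) (Dlog (S i) r) y) <= K * Rpower y (- (INR i + 3 / 2)).
Proof.
intros Hc; destruct (Dlog_bound (S (S i)) r c Hc) as (K & HK0 & HK).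
exists K; split; [exact HK0|]; intros y Hy.
apply (diff2_bound _ _ (Dlog (S (S i)) r)).
- intros z Hz; apply is_derive_Dlog; lra.
- intros z Hz; apply is_derive_Dlog; lra.
- intros z Hz; eapply Rle_trans; [apply HK; lra|].
  rewrite !S_INR; replace (INR i + 1 + 1 - 1 / 2) with (INR i + 3 / 2) by field.
  pose proof (pos_INR i).
  apply Rmult_le_compat_l; [exact HK0|]; apply Rpower_antitone; lra.
Qed.

(** * The Taylor remainder of the exponential *)

Definition exp_tail (m : nat) (t : R) : R :=
  exp t - Rsum (fun i => t ^ i / INR (fact i)) (seq 0 m).

Lemma exp_tail_S m t : exp_tail (S m) t = exp_tail m t - t ^ m / INR (fact m).
Proof. unfold exp_tail; rewrite Rsum_seq_S; ring. Qed.

Lemma is_derive_exp_tail m t : is_derive (exp_tail m) t (exp_tail (pred m) t).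
Proof.
destruct m as [|m]; cbn [pred].
- apply is_derive_ext with exp; [intros y; unfold exp_tail, Rsum; cbn; ring|].
  apply (is_derive_eq _ _ (exp t)); [apply is_derive_exp|unfold exp_tail, Rsum; cbn; ring].
- induction m as [|m IH].
  + apply is_derive_ext with (fun y => exp y - 1);
      [intros y; unfold exp_tail, Rsum; cbn; field|].
    auto_derive; [trivial|]; unfold exp_tail, Rsum; cbn; ring.
  + apply is_derive_ext with (fun y => exp_tail (S m) y - y ^ S m / INR (fact (S m)));
      [intros y; rewrite (exp_tail_S (S m)); reflexivity|].
    rewrite exp_tail_S.
    apply (is_derive_minus (V := R_NormedModule) (exp_tail (S m))); [exact IH|].
    assert (HF : INR (fact (S m)) = INR (S m) * INR (fact m)) by (rewrite fact_simpl; apply mult_INR).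
    rewrite HF; pose proof (INR_fact_neq_0 m); pose proof (INR_S_pos m).
    apply (is_derive_eq _ _ (INR (S m) * t ^ m * / (INR (S m) * INR (fact m)))).
    * apply (is_derive_ext (fun y => / (INR (S m) * INR (fact m)) * y ^ S m));
        [intros y; apply Rmult_comm|].
      rewrite (Rmult_comm (INR (S m) * t ^ m)); apply is_derive_scal.
      auto_derive; [trivial|]; rewrite Rmult_1_l; reflexivity.
    * field; split; [assumption|lra].
Qed.

Lemma exp_tail_0 m : exp_tail (S m) 0 = 0.
Proof.
induction m as [|m IH]; rewrite exp_tail_S.
- unfold exp_tail, Rsum; cbn; rewrite exp_0; field.
- rewrite IH, pow_i by lia; unfold Rdiv; ring.
Qed.

(** Each tail of positive order vanishes at 0 and has the preceding tail as derivative, so the mean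
    value theorem gains one factor [|t|] per order. *)
Lemma exp_tail_bound m t : Rabs (exp_tail m t) <= Rabs t ^ m * exp (Rabs t).
Proof.
revert t; induction m as [|m IH]; intros t.
- unfold exp_tail, Rsum; cbn; rewrite Rminus_0_r, Rmult_1_l, Rabs_pos_eq by apply Rlt_le, exp_pos.
  apply exp_le, Rle_abs.
- destruct (MVT_gen (exp_tail (S m)) 0 t (exp_tail m)) as (c & Hc & E).
  + intros x _; apply is_derive_exp_tail.
  + intros x _; apply continuity_pt_filterlim, (ex_derive_continuous (exp_tail (S m))).
    exists (exp_tail m x); apply is_derive_exp_tail.
  + rewrite exp_tail_0, !Rminus_0_r in E; rewrite E, Rabs_mult.
    assert (Hct : Rabs c <= Rabs t).
    { unfold Rmin, Rmax in Hc; destruct (Rle_dec 0 t); unfold Rabs;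
        destruct (Rcase_abs c), (Rcase_abs t); lra. }
    cbn [pow]; rewrite (Rmult_comm (Rabs t)), (Rmult_assoc), (Rmult_comm (Rabs t)), <- Rmult_assoc.
    apply Rmult_le_compat_r; [apply Rabs_pos|].
    eapply Rle_trans; [apply IH|].
    apply Rmult_le_compat; [apply pow_le, Rabs_pos|apply Rlt_le, exp_pos| |apply exp_le, Hct].
    apply pow_incr; split; [apply Rabs_pos|exact Hct].
Qed.

Ltac nonneg_terms :=
  repeat first [lra | apply pos_INR | apply Rabs_pos | apply Rlt_le, exp_pos | apply pow_le
               | apply Rplus_le_le_0_compat | apply Rmult_le_pos].

Lemma is_derive_unique_eq (f : R -> R) x (l l' : R) : is_derive f x l -> is_derive f x l' -> l = l'.
Proof. intros H H'; rewrite <- (is_derive_unique f x l H); apply is_derive_unique, H'. Qed.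

(** * Powers with small exponent and their Taylor polynomials in the exponent *)

Definition Dpow1 (eps y : R) : R := eps * Rpower y (eps - 1).
Definition Dpow2 (eps y : R) : R := eps * (eps - 1) * Rpower y (eps - 2).

Definition taylor_term (eps : R) (r : nat) : R := eps ^ r / INR (fact r).

(** The [i]-th derivative of the Taylor polynomial of [y ^ eps] at [eps = 0]. *)
Definition pow_taylor (N i : nat) (eps y : R) : R :=
  Rsum (fun r => taylor_term eps r * Dlog i r y) (seq 0 N).

Lemma is_derive_pow_taylor N i eps y : 0 < y ->
  is_derive (pow_taylor N i eps) y (pow_taylor N (S i) eps y).
Proof.
intros Hy; apply (is_derive_Rsum (fun r y => taylor_term eps r * Dlog i r y)
  (fun r y => taylor_term eps r * Dlog (S i) r y)).
intros r _; apply is_derive_scal, is_derive_Dlog, Hy.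
Qed.

Lemma exp_tail_ln N eps y : exp_tail N (eps * ln y) = Rpower y eps - pow_taylor N 0 eps y.
Proof.
unfold exp_tail, pow_taylor, Rpower; f_equal; apply Rsum_ext_in; intros r _.
rewrite Dlog_0, Rpow_mult_distr; unfold taylor_term, Rdiv; ring.
Qed.

Lemma is_derive_exp_tail_ln N eps y : 0 < y ->
  is_derive (fun y => exp_tail N (eps * ln y)) y (exp_tail (pred N) (eps * ln y) * (eps / y)).
Proof.
intros Hy; eapply is_derive_eq.
- apply (is_derive_comp (exp_tail N) (fun y => eps * ln y)); [apply is_derive_exp_tail|].
  instantiate (1 := eps / y); auto_derive; [exact Hy|field; lra].
- unfold scal; cbn; unfold mult; cbn; ring.
Qed.

Section TaylorInExponent.
Variables (N : nat) (eps : R).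

Let E (m : nat) (y : R) := exp_tail m (eps * ln y).

(** The first three derivatives of the remainder [E (N + 3)] of [y ^ eps]. Differentiating [E m]
    lowers [m] by one and produces a factor [eps / y]; since [E m] is of size [eps ^ m], every
    summand keeps the total order [eps ^ (N + 3)]. Three derivatives are taken because a second
    difference of first derivatives is controlled by the third. *)
Let v1 (y : R) : R := eps * E (S (S N)) y / y.
Let v2 (y : R) : R := (eps ^ 2 * E (S N) y - eps * E (S (S N)) y) / y ^ 2.
Let v3 (y : R) : R :=
  (eps ^ 3 * E N y - 3 * eps ^ 2 * E (S N) y + 2 * eps * E (S (S N)) y) / y ^ 3.

Let is_derive_E m y : 0 < y -> is_derive (E m) y (E (pred m) y * (eps / y)).
Proof. apply is_derive_exp_tail_ln. Qed.

Let is_derive_v1 y : 0 < y -> is_derive v1 y (v2 y).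
Proof.
intros Hy; unfold v1, v2.
assert (ex_derive (E (S (S N))) y) by (eexists; apply is_derive_E, Hy).
auto_derive; [repeat split; trivial; lra|].
replace (Derive _ y) with (E (S N) y * (eps / y))
  by (symmetry; apply is_derive_unique, is_derive_E, Hy).
field; lra.
Qed.

Let is_derive_v2 y : 0 < y -> is_derive v2 y (v3 y).
Proof.
intros Hy; unfold v2, v3.
assert (ex_derive (E (S (S N))) y) by (eexists; apply is_derive_E, Hy).
assert (ex_derive (E (S N)) y) by (eexists; apply is_derive_E, Hy).
auto_derive; [repeat split; trivial; nra|].
replace (Derive (fun x : R => E (S (S N)) x) y) with (E (S N) y * (eps / y))
  by (symmetry; apply is_derive_unique, is_derive_E, Hy).
replace (Derive (fun x : R => E (S N) x) y) with (E N y * (eps / y))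
  by (symmetry; apply is_derive_unique, is_derive_E, Hy).
field; lra.
Qed.

Let v1_eq y : 0 < y -> v1 y = Dpow1 eps y - pow_taylor (S (S (S N))) 1 eps y.
Proof.
intros Hy; apply (is_derive_unique_eq (E (S (S (S N)))) y).
- apply (is_derive_eq _ _ _ _ (is_derive_E _ y Hy)); unfold v1; cbn [pred plus]; field; lra.
- apply is_derive_ext with (fun y => Rpower y eps - pow_taylor (S (S (S N))) 0 eps y);
    [intros z; symmetry; apply exp_tail_ln|].
  apply (is_derive_minus (V := R_NormedModule) (fun y => Rpower y eps));
    [apply is_derive_Rpower, Hy|apply is_derive_pow_taylor, Hy].
Qed.

Let v2_eq y : 0 < y -> v2 y = Dpow2 eps y - pow_taylor (S (S (S N))) 2 eps y.
Proof.
intros Hy; apply (is_derive_unique_eq v1 y); [apply is_derive_v1, Hy|].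
apply (is_derive_positive_ext (fun y => Dpow1 eps y - pow_taylor (S (S (S N))) 1 eps y));
  [exact Hy|intros z Hz; symmetry; apply v1_eq, Hz|].
apply (is_derive_minus (V := R_NormedModule) (Dpow1 eps)); [|apply is_derive_pow_taylor, Hy].
unfold Dpow1; eapply is_derive_eq; [apply is_derive_scal, is_derive_Rpower, Hy|].
unfold Dpow2; replace (eps - 1 - 1) with (eps - 2) by ring; ring.
Qed.

Lemma diff2_taylor_remainder_eq y : 0 < y ->
  diff2 v1 v2 y = diff2 (Dpow1 eps) (Dpow2 eps) y
   - Rsum (fun r => taylor_term eps r * diff2 (Dlog 1 r) (Dlog 2 r) y) (seq 0 (S (S (S N)))).
Proof.
intros Hy; unfold diff2; rewrite !v1_eq, v2_eq by lra.
rewrite (Rsum_ext_in (fun r => _ * (_ - _ - _)) (fun r => taylor_term eps r * Dlog 1 r (y + 1)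
  - taylor_term eps r * Dlog 1 r y - taylor_term eps r * Dlog 2 r y)) by (intros; ring).
rewrite !Rsum_minus; unfold pow_taylor; ring.
Qed.

Lemma v3_bound c y : 0 < c <= 1 -> c <= y -> Rabs eps <= 1 / 4 ->
  Rabs (v3 y) <= Rabs eps ^ (S (S (S N))) *
    ((4 ^ N * INR (fact N) + 3 * (4 ^ (S N) * INR (fact (S N)))
      + 2 * (4 ^ (S (S N)) * INR (fact (S (S N))))) * exp (- ln c)) * Rpower y (- (5 / 2)).
Proof.
intros Hc Hy He.
set (L := Rabs (ln y)).
assert (HE : forall m, Rabs (E m y) <= Rabs eps ^ m * (4 ^ m * INR (fact m) * exp (- ln c) * Rpower y (1 / 2))).
{ intros m; eapply Rle_trans; [apply exp_tail_bound|].
  rewrite Rabs_mult, Rpow_mult_distr, Rmult_assoc.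
  apply Rmult_le_compat_l; [apply pow_le, Rabs_pos|].
  eapply Rle_trans; [|apply log_pow_bound; eassumption].
  apply Rmult_le_compat_l; [apply pow_le, Rabs_pos|].
  apply exp_le; pose proof (Rabs_pos (ln y)); nra. }
assert (Hy3 : 0 < y ^ 3) by (apply pow_lt; lra).
(* The decay [y ^ (-3)] of a third derivative, less the half power spent on logarithms. *)
replace (Rpower y (- (5 / 2))) with (Rpower y (1 / 2) * / y ^ 3)
  by (fold (Rpower y (1 / 2) / y ^ 3); rewrite Rpower_div_pow by lra; f_equal; cbn; field).
unfold v3, Rdiv at 1; rewrite Rabs_mult, (Rabs_pos_eq (/ y ^ 3)) by apply Rlt_le, Rinv_0_lt_compat, Hy3.
rewrite <- Rmult_assoc.
apply Rmult_le_compat_r; [apply Rlt_le, Rinv_0_lt_compat, Hy3|].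
pose proof (HE N) as H0; pose proof (HE (S N)%nat) as H1; pose proof (HE (S (S N))%nat) as H2.
set (Y := Rpower y (1 / 2)) in *; set (X := exp (- ln c)) in *; set (e := Rabs eps) in *.
assert (He0 : 0 <= e) by apply Rabs_pos.
apply Rle_trans with (e ^ 3 * Rabs (E N y) + 3 * e ^ 2 * Rabs (E (S N) y) + 2 * e * Rabs (E (S (S N)) y)).
- eapply Rle_trans; [apply Rabs_triang|]; apply Rplus_le_compat.
  + eapply Rle_trans; [apply Rabs_triang|]; apply Rplus_le_compat.
    * rewrite Rabs_mult, <- RPow_abs; apply Rle_refl.
    * rewrite Rabs_Ropp, !Rabs_mult, <- RPow_abs, (Rabs_pos_eq 3) by lra; apply Rle_refl.
  + rewrite !Rabs_mult, (Rabs_pos_eq 2) by lra; apply Rle_refl.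
- assert (0 <= e ^ 3) by (apply pow_le; assumption).
  assert (0 <= e ^ 2) by (apply pow_le; assumption).
  apply (Rmult_le_compat_l (e ^ 3)) in H0; [|assumption].
  apply (Rmult_le_compat_l (3 * e ^ 2)) in H1; [|lra].
  apply (Rmult_le_compat_l (2 * e)) in H2; [|lra].
  replace (e ^ (S (S (S N)))) with (e ^ N * (e * e * e)) by (cbn; ring).
  replace (e ^ (S (S N))) with (e ^ N * (e * e)) in H2 by (cbn; ring).
  replace (e ^ (S N)) with (e ^ N * e) in H1 by (cbn; ring).
  eapply Rle_trans; [apply Rplus_le_compat; [apply Rplus_le_compat; [exact H0|exact H1]|exact H2]|].
  right; ring.
Qed.

Lemma diff2_taylor_remainder c y : 0 < c <= 1 -> c <= y -> Rabs eps <= 1 / 4 ->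
  Rabs (diff2 (Dpow1 eps) (Dpow2 eps) y
   - Rsum (fun r => taylor_term eps r * diff2 (Dlog 1 r) (Dlog 2 r) y) (seq 0 (S (S (S N)))))
  <= Rabs eps ^ (S (S (S N))) *
    ((4 ^ N * INR (fact N) + 3 * (4 ^ (S N) * INR (fact (S N)))
      + 2 * (4 ^ (S (S N)) * INR (fact (S (S N))))) * exp (- ln c)) * Rpower y (- (5 / 2)).
Proof.
intros Hc Hy He; rewrite <- diff2_taylor_remainder_eq by lra.
apply (diff2_bound v1 v2 v3).
- intros z Hz; apply is_derive_v1; lra.
- intros z Hz; apply is_derive_v2; lra.
- intros z Hz; eapply Rle_trans; [apply (v3_bound c); [exact Hc|lra|exact He]|].
  apply Rmult_le_compat_l; [|apply Rpower_antitone; lra].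
  nonneg_terms.
Qed.

End TaylorInExponent.

(** * The functions Phi_r' and their generating function *)

Definition is_dsum (F : nat -> nat -> R) (S : R) : Prop :=
  (forall i, ex_series (F i)) /\ is_series (fun i => Series (F i)) S.

Lemma is_dsum_dominated F K w : (forall i j, Rabs (F i j) <= K * w i * w j) -> ex_series w ->
  is_dsum F (Series (fun i => Series (F i))).
Proof.
intros HF Hw; split; [exact (dominated_row F K w HF Hw)|].
apply Series_correct, (dominated_sum F K w HF Hw).
Qed.

Lemma is_dsum_ext F G S : (forall i j, F i j = G i j) -> is_dsum F S -> is_dsum G S.
Proof.
intros E [H1 H2]; split.
- intros i; apply (ex_series_ext (F i)); [apply E|apply H1].
- apply (is_series_ext (fun i => Series (F i))); [|exact H2].
  intros i; apply Series_ext, E.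
Qed.

Lemma is_dsum_plus F G S T : is_dsum F S -> is_dsum G T -> is_dsum (fun i j => F i j + G i j) (S + T).
Proof.
intros [H1 H2] [H3 H4]; split.
- intros i; apply (ex_series_plus (V := R_NormedModule) (F i) (G i)); auto.
- apply (is_series_ext (fun i => Series (F i) + Series (G i))).
  + intros i; symmetry; apply Series_plus; auto.
  + apply (is_series_plus (V := R_NormedModule)); assumption.
Qed.

Lemma is_dsum_scal c F S : is_dsum F S -> is_dsum (fun i j => c * F i j) (c * S).
Proof.
intros [H1 H2]; split.
- intros i; apply (ex_series_scal_l c (F i)); auto.
- apply (is_series_ext (fun i => c * Series (F i))).
  + intros i; symmetry; apply Series_scal_l.
  + apply (is_series_scal (V := R_NormedModule) c); assumption.
Qed.

Lemma is_series_zero : is_series (fun _ : nat => 0) 0.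
Proof.
apply is_series_Rsum, is_lim_seq_ext with (fun _ => 0); [|apply is_lim_seq_const].
intros N; symmetry; apply Rsum_zero; reflexivity.
Qed.

Lemma is_dsum_Rsum {A : Type} (F : A -> nat -> nat -> R) (S : A -> R) l :
  (forall a, In a l -> is_dsum (F a) (S a)) ->
  is_dsum (fun i j => Rsum (fun a => F a i j) l) (Rsum S l).
Proof.
induction l as [|a l IH]; intros H.
- split; [intros i; exists 0; exact is_series_zero|].
  apply (is_series_ext (fun _ => 0)); [|exact is_series_zero].
  intros i; symmetry; apply (is_series_unique _ _ is_series_zero).
- apply (is_dsum_plus (F a)); [apply H; left; reflexivity|].
  apply IH; intros b Hb; apply H; right; exact Hb.
Qed.

Lemma is_dsum_unique F S : is_dsum F S -> Series (fun i => Series (F i)) = S.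
Proof. intros [_ H]; apply is_series_unique, H. Qed.

Definition dphi (r : nat) (x : R) : R :=
  Series (fun i => Series (fun j => diff2 (Dlog 1 r) (Dlog 2 r) (node x i j))).

Definition gen (eps x : R) : R :=
  Series (fun i => Series (fun j => diff2 (Dpow1 eps) (Dpow2 eps) (node x i j))).

Lemma Rmin_1_bounds x : 0 < x -> 0 < Rmin x 1 <= 1 /\ Rmin x 1 <= x.
Proof. intros Hx; repeat split; [apply Rmin_pos; lra|apply Rmin_r|apply Rmin_l]. Qed.

(** The exponent is half of the decay 5/2 of the second differences; each half still exceeds 1. *)
Definition weight (i : nat) : R := Rpower (INR (S i)) (- (5 / 4)).

Lemma ex_series_weight : ex_series weight.
Proof. apply ex_series_Rpower; lra. Qed.

Lemma node_weight_bound x : 0 < x -> exists K, 0 <= K /\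
  forall i j, Rpower (node x i j) (- (5 / 2)) <= K * weight i * weight j.
Proof.
intros Hx; destruct (Rmin_1_bounds x Hx) as [[Hc H1] Hcx].
exists (Rpower (Rmin x 1) (- (5 / 2))); split; [apply Rlt_le, Rpower_pos|]; intros i j.
unfold weight; replace (5 / 2) with (5 / 4 + 5 / 4) by field.
apply Rpower_node_le; trivial; lra.
Qed.

Lemma is_dsum_dphi r x : 0 < x ->
  is_dsum (fun i j => diff2 (Dlog 1 r) (Dlog 2 r) (node x i j)) (dphi r x).
Proof.
intros Hx; destruct (Rmin_1_bounds x Hx) as [Hc Hcx].
destruct (diff2_Dlog_bound 1 r _ Hc) as (K & HK0 & HK).
destruct (node_weight_bound x Hx) as (K2 & _ & HK2).
apply (is_dsum_dominated _ (K * K2) weight); [|apply ex_series_weight].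
intros i j; eapply Rle_trans; [apply HK, node_ge_min; tauto|].
cbn [INR]; replace (1 + 3 / 2) with (5 / 2) by field.
rewrite !Rmult_assoc; apply Rmult_le_compat_l; [exact HK0|].
rewrite <- Rmult_assoc; apply HK2.
Qed.

(** At every node the Taylor remainder is at most [|eps| ^ (N + 3)] times a multiple of
    [node ^ (- 5/2)] that does not depend on [eps], so the remainders can be summed over the
    lattice. *)
Lemma gen_taylor N x : 0 < x -> exists K, forall eps, Rabs eps <= 1 / 4 ->
  Rabs (gen eps x - Rsum (fun r => taylor_term eps r * dphi r x) (seq 0 (S (S (S N)))))
    <= K * Rabs eps ^ (S (S (S N))).
Proof.
intros Hx; destruct (Rmin_1_bounds x Hx) as [Hc Hcx].
destruct (node_weight_bound x Hx) as (K2 & HK20 & HK2).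
set (C := (4 ^ N * INR (fact N) + 3 * (4 ^ (S N) * INR (fact (S N)))
      + 2 * (4 ^ (S (S N)) * INR (fact (S (S N))))) * exp (- ln (Rmin x 1))).
assert (HC : 0 <= C).
{ unfold C; nonneg_terms. }
exists (C * K2 * (Series weight * Series weight)); intros eps He.
set (Rm := fun i j => diff2 (Dpow1 eps) (Dpow2 eps) (node x i j)
   - Rsum (fun r => taylor_term eps r * diff2 (Dlog 1 r) (Dlog 2 r) (node x i j)) (seq 0 (S (S (S N))))).
assert (HR : forall i j, Rabs (Rm i j) <= (Rabs eps ^ (S (S (S N))) * C * K2) * weight i * weight j).
{ intros i j; eapply Rle_trans.
  - apply (diff2_taylor_remainder N eps (Rmin x 1)); [exact Hc|apply node_ge_min; tauto|exact He].
  - fold C; rewrite !(Rmult_assoc (Rabs eps ^ (S (S (S N))) * C)); apply Rmult_le_compat_l.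
    + apply Rmult_le_pos; [apply pow_le, Rabs_pos|exact HC].
    + apply HK2. }
assert (E : is_dsum (fun i j => diff2 (Dpow1 eps) (Dpow2 eps) (node x i j))
  (Series (fun i => Series (Rm i)) + Rsum (fun r => taylor_term eps r * dphi r x) (seq 0 (S (S (S N)))))).
{ eapply is_dsum_ext; [|apply is_dsum_plus; [exact (is_dsum_dominated _ _ _ HR ex_series_weight)|]].
  - intros i j; unfold Rm; instantiate (1 := fun i j => Rsum (fun r => taylor_term eps r *
      diff2 (Dlog 1 r) (Dlog 2 r) (node x i j)) (seq 0 (S (S (S N))))); cbn beta; ring.
  - apply (is_dsum_Rsum (fun r i j => taylor_term eps r * diff2 (Dlog 1 r) (Dlog 2 r) (node x i j))).
    intros r _; apply is_dsum_scal, is_dsum_dphi, Hx. }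
unfold gen; rewrite (is_dsum_unique _ _ E).
replace (_ + _ - _) with (Series (fun i => Series (Rm i))) by ring.
eapply Rle_trans; [apply (dominated_sum_le _ _ _ HR ex_series_weight)|right; ring].
Qed.

(** * The generating function at negative [eps] *)

Lemma is_lim_seq_Rpower_neg (u : nat -> R) a : 0 < a -> is_lim_seq u p_infty ->
  is_lim_seq (fun j => Rpower (u j) (- a)) 0.
Proof.
intros Ha Hu; unfold Rpower.
apply (is_lim_comp_seq exp (fun j => - a * ln (u j)) m_infty 0);
  [apply is_lim_exp_m|exists 0%nat; discriminate|].
apply is_lim_seq_ext with (fun j => - (ln (u j) * a)); [intros; ring|].
apply (is_lim_seq_opp _ p_infty).
apply (is_lim_seq_mult _ _ p_infty a); [|apply is_lim_seq_const|apply is_Rbar_mult_p_infty_pos, Ha].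
apply (is_lim_comp_seq ln u p_infty p_infty); [apply is_lim_ln_p|exists 0%nat; discriminate|exact Hu].
Qed.

Lemma is_lim_seq_node x i : is_lim_seq (node x i) p_infty.
Proof.
unfold node; eapply is_lim_seq_plus; [apply is_lim_seq_const|apply is_lim_seq_INR|reflexivity].
Qed.

Definition rzeta (s : R) : R := Series (fun i => Rpower (INR (S i)) (- s)).

(** For fixed [i] the first differences telescope to the boundary term at [j = 0], where the node is
    [(i + 1) x]. Summing these boundary terms over [i] yields the zeta value, and it is there that
    [eps < 0] secures convergence. *)
Lemma gen_neg eps x : eps < 0 -> 0 < x ->
  gen eps x = - eps * rzeta (1 - eps) * Rpower x (eps - 1) - eps * (eps - 1) * dzeta (2 - eps) x.
Proof.
intros He Hx.
destruct (dzeta_dominated (2 - eps) x) as (K & w & Hw & HK); [lra|exact Hx|].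
pose proof (dominated_row _ _ _ HK Hw) as Hrow.
pose proof (dominated_sum _ _ _ HK Hw) as Hsum.
assert (Hz : is_series (fun i => Rpower (INR (S i)) (- (1 - eps))) (rzeta (1 - eps)))
  by (apply Series_correct, ex_series_Rpower; lra).
unfold gen; apply is_series_unique.
apply is_series_ext with (fun i =>
  (- eps * Rpower x (eps - 1)) * Rpower (INR (S i)) (- (1 - eps))
  + (- eps * (eps - 1)) * Series (fun j => Rpower (node x i j) (- (2 - eps)))).
- intros i; symmetry; apply is_series_unique.
  assert (Ht : is_series (fun j => Rpower (node x i j) (- (1 - eps)) - Rpower (node x i (S j)) (- (1 - eps)))
     (Rpower (node x i 0) (- (1 - eps)) - 0))
    by (apply is_series_telescope, is_lim_seq_Rpower_neg; [lra|apply is_lim_seq_node]).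
  apply (is_series_scal (V := R_NormedModule) (- eps)) in Ht.
  pose proof (is_series_scal (V := R_NormedModule) (- eps * (eps - 1)) _ _ (Series_correct _ (Hrow i))) as Hr.
  pose proof (is_series_plus (V := R_NormedModule) _ _ _ _ Ht Hr) as Hp.
  apply (is_series_ext (V := R_NormedModule) _ (fun j => diff2 (Dpow1 eps) (Dpow2 eps) (node x i j))) in Hp.
  + match goal with |- is_series _ ?l => match type of Hp with is_series _ ?m =>
      replace l with m; [exact Hp|] end end.
    unfold plus; cbn [AbelianMonoid.plus]; cbn -[Series Rpower INR].
    replace (node x i 0) with (INR (S i) * x) by (unfold node; cbn [INR]; ring).
    rewrite Rpower_mult_base by (trivial; apply INR_S_pos).
    replace (- (1 - eps)) with (eps - 1) by ring; ring.
  + intros j; unfold plus; cbn -[Rpower node diff2 INR].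
    unfold diff2, Dpow1, Dpow2.
    replace (node x i j + 1) with (node x i (S j)) by (unfold node; rewrite (S_INR j); ring).
    replace (- (1 - eps)) with (eps - 1) by ring.
    replace (- (2 - eps)) with (eps - 2) by ring; ring.
- replace (- eps * rzeta (1 - eps) * Rpower x (eps - 1) - eps * (eps - 1) * dzeta (2 - eps) x)
    with ((- eps * Rpower x (eps - 1)) * rzeta (1 - eps) + (- eps * (eps - 1)) * dzeta (2 - eps) x) by ring.
  apply (is_series_plus (V := R_NormedModule)).
  + apply (is_series_scal (V := R_NormedModule) (- eps * Rpower x (eps - 1))); exact Hz.
  + apply (is_series_scal (V := R_NormedModule) (- eps * (eps - 1))); apply Series_correct, Hsum.
Qed.

(** * Asymptotic expansions at [0-] *)

Definition bigO (N : nat) (f : R -> R) : Prop :=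
  exists C d, 0 < d /\ forall eps, - d < eps < 0 -> Rabs (f eps) <= C * Rabs eps ^ N.

Definition taylor (N : nat) (a : nat -> R) (eps : R) : R :=
  Rsum (fun r => taylor_term eps r * a r) (seq 0 N).

(** [f eps = a 0 + a 1 eps + ... + a (N - 1) eps ^ (N - 1) / (N - 1)! + O(eps ^ N)]
    as [eps] tends to [0] from the left. *)
Definition has_expansion (N : nat) (f : R -> R) (a : nat -> R) : Prop :=
  bigO N (fun eps => f eps - taylor N a eps).

Lemma bigO_ext N f g d : 0 < d -> (forall eps, - d < eps < 0 -> f eps = g eps) -> bigO N f -> bigO N g.
Proof.
intros Hd E (C & d' & Hd' & H); exists C, (Rmin d d'); split; [apply Rmin_pos; assumption|].
pose proof (Rmin_l d d'); pose proof (Rmin_r d d').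
intros eps He; rewrite <- E by lra; apply H; lra.
Qed.

Lemma bigO_plus N f g : bigO N f -> bigO N g -> bigO N (fun eps => f eps + g eps).
Proof.
intros (C & d & Hd & H) (C' & d' & Hd' & H').
exists (C + C'), (Rmin d d'); split; [apply Rmin_pos; assumption|].
pose proof (Rmin_l d d'); pose proof (Rmin_r d d').
intros eps He; eapply Rle_trans; [apply Rabs_triang|]; rewrite Rmult_plus_distr_r.
apply Rplus_le_compat; [apply H|apply H']; lra.
Qed.

Lemma bigO_mult N M f g : bigO N f -> bigO M g -> bigO (N + M) (fun eps => f eps * g eps).
Proof.
intros (C & d & Hd & H) (C' & d' & Hd' & H').
exists (C * C'), (Rmin d d'); split; [apply Rmin_pos; assumption|].
pose proof (Rmin_l d d'); pose proof (Rmin_r d d').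
intros eps He; rewrite Rabs_mult, pow_add.
replace (C * C' * (Rabs eps ^ N * Rabs eps ^ M)) with ((C * Rabs eps ^ N) * (C' * Rabs eps ^ M)) by ring.
apply Rmult_le_compat; try apply Rabs_pos; [apply H|apply H']; lra.
Qed.

Lemma bigO_const c : bigO 0 (fun _ => c).
Proof. exists (Rabs c), 1; split; [lra|]; intros eps _; cbn; lra. Qed.

Lemma bigO_taylor_term r : bigO r (fun eps => taylor_term eps r).
Proof.
exists (/ INR (fact r)), 1; split; [lra|]; intros eps _; unfold taylor_term, Rdiv.
rewrite Rabs_mult, <- RPow_abs, (Rabs_pos_eq (/ _)); [lra|].
apply Rlt_le, Rinv_0_lt_compat, INR_fact_lt_0.
Qed.

Lemma bigO_scal N c f : bigO N f -> bigO N (fun eps => c * f eps).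
Proof. apply (bigO_mult 0 N _ _ (bigO_const c)). Qed.

Lemma bigO_Rsum {A : Type} N (f : A -> R -> R) l :
  (forall a, In a l -> bigO N (f a)) -> bigO N (fun eps => Rsum (fun a => f a eps) l).
Proof.
induction l as [|a l IH]; intros H.
- exists 0, 1; split; [lra|]; intros eps _; unfold Rsum; cbn [map fold_right]; rewrite Rabs_R0; lra.
- apply (bigO_plus N (f a)); [apply H; left; reflexivity|].
  apply IH; intros b Hb; apply H; right; exact Hb.
Qed.

Lemma bigO_weaken N M f : (M <= N)%nat -> bigO N f -> bigO M f.
Proof.
intros HM (C & d & Hd & H); exists (Rabs C), (Rmin d 1); split; [apply Rmin_pos; lra|].
pose proof (Rmin_l d 1); pose proof (Rmin_r d 1).
intros eps He; eapply Rle_trans; [apply H; lra|].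
apply Rle_trans with (Rabs C * Rabs eps ^ N).
- apply Rmult_le_compat_r; [apply pow_le, Rabs_pos|apply Rle_abs].
- apply Rmult_le_compat_l; [apply Rabs_pos|].
  replace N with (M + (N - M))%nat by lia; rewrite pow_add.
  rewrite <- (Rmult_1_r (Rabs eps ^ M)) at 2.
  apply Rmult_le_compat_l; [apply pow_le, Rabs_pos|].
  rewrite <- (pow1 (N - M)); apply pow_incr; split; [apply Rabs_pos|].
  rewrite Rabs_left by lra; lra.
Qed.

Lemma taylor_S N a eps : taylor (S N) a eps = taylor N a eps + taylor_term eps N * a N.
Proof. apply Rsum_seq_S. Qed.

Lemma bigO_taylor_diff N M a : (M <= N)%nat -> bigO M (fun eps => taylor N a eps - taylor M a eps).
Proof.
intros HMN; induction HMN as [|N HMN IH].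
- apply (bigO_ext M (fun eps => 0 * taylor_term eps M) _ 1); [lra|intros; ring|].
  apply bigO_scal, bigO_taylor_term.
- apply (bigO_ext M (fun eps => (taylor N a eps - taylor M a eps) + a N * taylor_term eps N) _ 1);
    [lra|intros; rewrite taylor_S; ring|].
  apply bigO_plus; [exact IH|].
  apply (bigO_weaken N); [exact HMN|apply bigO_scal, bigO_taylor_term].
Qed.

Lemma has_expansion_weaken N M f a : (M <= N)%nat -> has_expansion N f a -> has_expansion M f a.
Proof.
intros HM H.
apply (bigO_ext M (fun eps => (f eps - taylor N a eps) + (taylor N a eps - taylor M a eps)) _ 1);
  [lra|intros; ring|].
apply bigO_plus; [apply (bigO_weaken N); assumption|apply bigO_taylor_diff, HM].
Qed.

Lemma has_expansion_ext N f g a b d : 0 < d -> (forall eps, - d < eps < 0 -> f eps = g eps) ->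
  (forall r, (r < N)%nat -> a r = b r) -> has_expansion N f a -> has_expansion N g b.
Proof.
intros Hd E Eab; apply (bigO_ext _ _ _ d); [exact Hd|]; intros eps He; rewrite E by exact He.
f_equal; apply Rsum_ext_in; intros r Hr; apply in_seq in Hr; rewrite Eab by lia; reflexivity.
Qed.

Lemma has_expansion_plus N f g a b : has_expansion N f a -> has_expansion N g b ->
  has_expansion N (fun eps => f eps + g eps) (fun r => a r + b r).
Proof.
intros Hf Hg.
apply (bigO_ext N (fun eps => (f eps - taylor N a eps) + (g eps - taylor N b eps)) _ 1);
  [lra| |apply bigO_plus; assumption].
intros eps _; unfold taylor; rewrite (Rsum_ext_in (fun r => _ * (_ + _))
  (fun r => taylor_term eps r * a r + taylor_term eps r * b r)) by (intros; ring).
rewrite Rsum_plus; ring.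
Qed.

Lemma has_expansion_scal N c f a : has_expansion N f a ->
  has_expansion N (fun eps => c * f eps) (fun r => c * a r).
Proof.
intros Hf; apply (bigO_ext N (fun eps => c * (f eps - taylor N a eps)) _ 1);
  [lra| |apply bigO_scal; assumption].
intros eps _; unfold taylor; rewrite (Rsum_ext_in (fun r => _ * (_ * _))
  (fun r => c * (taylor_term eps r * a r))) by (intros; ring).
rewrite Rsum_scal; ring.
Qed.

Lemma has_expansion_minus N f g a b : has_expansion N f a -> has_expansion N g b ->
  has_expansion N (fun eps => f eps - g eps) (fun r => a r - b r).
Proof.
intros Hf Hg.
apply (has_expansion_ext N (fun eps => f eps + -1 * g eps) _ (fun r => a r + -1 * b r) _ 1);
  [lra|intros; ring|intros; ring|].
apply has_expansion_plus; [exact Hf|apply has_expansion_scal, Hg].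
Qed.

Lemma has_expansion_Rsum {A : Type} N (f : A -> R -> R) (a : A -> nat -> R) l :
  (forall x, In x l -> has_expansion N (f x) (a x)) ->
  has_expansion N (fun eps => Rsum (fun x => f x eps) l) (fun r => Rsum (fun x => a x r) l).
Proof.
intros H; apply (bigO_ext N (fun eps => Rsum (fun x => f x eps - taylor N (a x) eps) l) _ 1);
  [lra| |apply bigO_Rsum, H].
intros eps _; rewrite Rsum_minus; f_equal; unfold taylor; rewrite Rsum_exchange.
apply Rsum_ext_in; intros r _; apply Rsum_scal.
Qed.

Definition binomial_conv (a b : nat -> R) (r : nat) : R :=
  Rsum (fun i => Binomial.C r i * a i * b (r - i)%nat) (seq 0 (S r)).

(** Cauchy product over the triangle of total degree below [N]. Raising [N] by one adds the diagonal
    [r + s = N], on which the factorials combine to [Binomial.C N r * taylor_term eps N]. *)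
Lemma taylor_conv N a b eps :
  Rsum (fun r => taylor_term eps r * a r * taylor (N - r) b eps) (seq 0 N)
  = taylor N (binomial_conv a b) eps.
Proof.
induction N as [|N IH]; [reflexivity|].
rewrite taylor_S, <- IH; unfold binomial_conv; rewrite <- Rsum_scal.
rewrite (Rsum_ext_in _ (fun r => taylor_term eps r * a r * taylor (N - r) b eps +
  taylor_term eps N * (Binomial.C N r * a r * b (N - r)%nat)) (seq 0 (S N))).
- rewrite Rsum_plus; f_equal; rewrite Rsum_seq_S, Nat.sub_diag; unfold taylor, Rsum; cbn; ring.
- intros r Hr; apply in_seq in Hr.
  replace (S N - r)%nat with (S (N - r)) by lia; rewrite taylor_S; unfold taylor_term, Binomial.C.
  replace (eps ^ N) with (eps ^ r * eps ^ (N - r)) by (rewrite <- pow_add; f_equal; lia).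
  field; repeat split; apply INR_fact_neq_0.
Qed.

Lemma bigO_0_of_expansion N f a : has_expansion N f a -> bigO 0 f.
Proof.
intros H; apply (has_expansion_weaken N 0) in H; [|lia].
apply (bigO_ext 0 (fun eps => f eps - taylor 0 a eps) _ 1); [lra| |exact H].
intros eps _; unfold taylor, Rsum; cbn; ring.
Qed.

Lemma has_expansion_mult N f g a b : has_expansion N f a -> has_expansion N g b ->
  has_expansion N (fun eps => f eps * g eps) (binomial_conv a b).
Proof.
intros Hf Hg.
(* The expansion of [g] is cut at order [N - r] against the term of degree [r] of [f], so that the
   main part is exactly the triangle of [taylor_conv]. *)
apply (bigO_ext N (fun eps => (f eps - taylor N a eps) * g eps +
  Rsum (fun r => a r * (taylor_term eps r * (g eps - taylor (N - r) b eps))) (seq 0 N)) _ 1); [lra| |].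
- intros eps _; rewrite <- taylor_conv.
  rewrite (Rsum_ext_in (fun r => a r * _) (fun r => g eps * (taylor_term eps r * a r) -
    taylor_term eps r * a r * taylor (N - r) b eps)) by (intros; ring).
  rewrite Rsum_minus, Rsum_scal; unfold taylor at 1; ring.
- apply bigO_plus.
  + rewrite <- (Nat.add_0_r N) at 1; apply bigO_mult; [exact Hf|apply (bigO_0_of_expansion N g b), Hg].
  + apply bigO_Rsum; intros r Hr; apply in_seq in Hr; apply bigO_scal.
    replace N with (r + (N - r))%nat at 1 by lia.
    apply bigO_mult; [apply bigO_taylor_term|].
    apply (has_expansion_weaken N); [lia|exact Hg].
Qed.

(** If [a r] were the first nonzero coefficient, the error bound would give [|a r| / r! <= C e] for
    all small [e > 0]. *)
Lemma expansion_of_zero N f a d : 0 < d -> (forall eps, - d < eps < 0 -> f eps = 0) ->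
  has_expansion N f a -> forall r, (r < N)%nat -> a r = 0.
Proof.
intros Hd Hf H r; induction r as [r IH] using lt_wf_ind; intros Hr.
apply (has_expansion_weaken N (S r)) in H; [|lia].
destruct H as (C & d' & Hd' & H).
destruct (Req_dec (a r) 0) as [E|E]; [exact E|exfalso].
set (q := Rabs (a r) / INR (fact r)).
assert (Hq : 0 < q) by (apply Rdiv_lt_0_compat; [apply Rabs_pos_lt, E|apply INR_fact_lt_0]).
assert (HC : 0 < Rabs C + 1) by (pose proof (Rabs_pos C); lra).
(* Half the minimum, so that [- e] lies in both ranges and [(|C| + 1) * e] stays below [q]. *)
set (e := Rmin (Rmin d d') (q / (Rabs C + 1)) / 2).
assert (H1 : 0 < Rmin (Rmin d d') (q / (Rabs C + 1)))
  by (repeat apply Rmin_pos; trivial; apply Rdiv_lt_0_compat; assumption).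
pose proof (Rmin_l (Rmin d d') (q / (Rabs C + 1))); pose proof (Rmin_r (Rmin d d') (q / (Rabs C + 1))).
pose proof (Rmin_l d d'); pose proof (Rmin_r d d').
assert (He : 0 < e < q / (Rabs C + 1) /\ e < d /\ e < d') by (unfold e; lra).
specialize (H (- e) ltac:(lra)); rewrite Hf in H by lra.
unfold taylor in H; rewrite Rsum_seq_S, Rsum_zero in H.
2:{ intros i Hi; apply in_seq in Hi; rewrite IH by lia; ring. }
unfold taylor_term in H.
replace (0 - (0 + (- e) ^ r / INR (fact r) * a r)) with (- ((- e) ^ r * (a r / INR (fact r)))) in H
  by (field; apply INR_fact_neq_0).
rewrite Rabs_Ropp, Rabs_mult, <- RPow_abs, Rabs_Ropp, (Rabs_pos_eq e) in H by lra.
unfold Rdiv in H; rewrite Rabs_mult, (Rabs_pos_eq (/ _)) in H by apply Rlt_le, Rinv_0_lt_compat, INR_fact_lt_0.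
change (Rabs (a r) * / INR (fact r)) with q in H; cbn [pow] in H.
assert (Her : 0 < e ^ r) by (apply pow_lt; lra).
assert (Hqe : q <= C * e) by (apply (Rmult_le_reg_l (e ^ r)); [exact Her|lra]).
destruct He as [[He0 He1] _]; apply (Rmult_lt_compat_r (Rabs C + 1)) in He1; [|exact HC].
unfold Rdiv in He1; rewrite Rmult_assoc, Rinv_l, Rmult_1_r in He1 by lra.
pose proof (Rle_abs C); nra.
Qed.

(** * The expansions entering the Hecke relation *)

Lemma expansion_Rpower N y : has_expansion N (fun eps => Rpower y eps) (fun r => ln y ^ r).
Proof.
exists (Rabs (ln y) ^ N * exp (Rabs (ln y))), 1; split; [lra|]; intros eps He.
replace (Rpower y eps - taylor N (fun r => ln y ^ r) eps) with (exp_tail N (eps * ln y)).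
- eapply Rle_trans; [apply exp_tail_bound|].
  rewrite Rabs_mult, Rpow_mult_distr.
  rewrite (Rmult_comm (Rabs eps ^ N)), !Rmult_assoc.
  apply Rmult_le_compat_l; [apply pow_le, Rabs_pos|].
  rewrite (Rmult_comm (exp (Rabs (ln y)))); apply Rmult_le_compat_l; [apply pow_le, Rabs_pos|].
  apply exp_le; pose proof (Rabs_pos (ln y)); rewrite (Rabs_left eps) by lra; nra.
- rewrite exp_tail_ln; unfold taylor, pow_taylor; f_equal; apply Rsum_ext_in; intros r _.
  rewrite Dlog_0; reflexivity.
Qed.

Lemma expansion_gen N x : 0 < x -> has_expansion N (fun eps => gen eps x) (fun r => dphi r x).
Proof.
intros Hx; apply (has_expansion_weaken (S (S (S N)))); [lia|].
destruct (gen_taylor N x Hx) as [K HK]; exists K, (1 / 4); split; [lra|]; intros eps He.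
apply HK; rewrite Rabs_left by lra; lra.
Qed.

Lemma expansion_power_series N (c : nat -> R) (f : R -> R) :
  (forall eps, - 1 <= eps < 0 -> is_series (fun j => c j * eps ^ j) (f eps)) ->
  has_expansion N f (fun r => INR (fact r) * c r).
Proof.
intros Hf.
(* Convergence at [eps = -1] puts the radius of convergence above 1/2; absolute convergence at 1/2
   then bounds the tail by a constant times [(2 |eps|) ^ N]. *)
assert (Hr : Rbar_lt (Rabs (1 / 2)) (CV_radius c)).
{ destruct (Rbar_lt_le_dec (Rabs (1 / 2)) (CV_radius c)) as [H|H]; [exact H|exfalso].
  apply (CV_disk_outside c (-1)).
  - eapply Rbar_le_lt_trans; [exact H|]; cbn; rewrite Rabs_pos_eq, Rabs_left by lra; lra.
  - apply ex_series_lim_0; exists (f (-1)); apply Hf; lra. }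
apply CV_disk_inside in Hr.
apply (ex_series_incr_n _ N) in Hr.
set (b := fun j => Rabs (c (N + j)%nat * (1 / 2) ^ (N + j))) in Hr.
exists (2 ^ N * Series b), (1 / 2); split; [lra|]; intros eps He.
replace (f eps - taylor N (fun r => INR (fact r) * c r) eps)
  with (Series (fun j => c (N + j)%nat * eps ^ (N + j))).
- assert (Heps : Rabs eps <= 1 / 2) by (rewrite Rabs_left by lra; lra).
  replace (2 ^ N * Series b * Rabs eps ^ N) with (Series (fun j => (2 ^ N * Rabs eps ^ N) * b j))
    by (rewrite Series_scal_l; ring).
  apply Series_abs_le; [|apply (ex_series_scal_l (2 ^ N * Rabs eps ^ N) b Hr)].
  intros j; unfold b; rewrite !Rabs_mult, <- !RPow_abs, (Rabs_pos_eq (1 / 2)) by lra.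
  rewrite !pow_add.
  replace (2 ^ N * Rabs eps ^ N * (Rabs (c (N + j)%nat) * ((1 / 2) ^ N * (1 / 2) ^ j)))
    with ((2 ^ N * (1 / 2) ^ N) * (Rabs (c (N + j)%nat) * (Rabs eps ^ N * (1 / 2) ^ j))) by ring.
  rewrite <- Rpow_mult_distr; replace (2 * (1 / 2)) with 1 by field; rewrite pow1, Rmult_1_l.
  apply Rmult_le_compat_l; [apply Rabs_pos|]; apply Rmult_le_compat_l; [apply pow_le, Rabs_pos|].
  apply pow_incr; split; [apply Rabs_pos|exact Heps].
- specialize (Hf eps ltac:(lra)).
  assert (Ht : taylor N (fun r => INR (fact r) * c r) eps = Rsum (fun j => c j * eps ^ j) (seq 0 N)).
  { apply Rsum_ext_in; intros j _; unfold taylor_term; field; apply INR_fact_neq_0. }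
  rewrite Ht; destruct N as [|N].
  + cbn [seq]; unfold Rsum; cbn [map fold_right]; rewrite Rminus_0_r; apply is_series_unique, Hf.
  + rewrite Rsum_seq_sum_n; apply is_series_unique.
    apply (is_series_incr_n (fun j => c j * eps ^ j) (S N)); [lia|].
    cbn [Init.Nat.pred Nat.pred]; unfold plus; cbn -[sum_n].
    match goal with |- is_series _ ?l => replace l with (f eps); [exact Hf|] end.
    match goal with |- _ = _ - ?s1 + ?s2 => change s2 with s1 end; ring.
Qed.

(** At [s = 1 - eps] the alternating signs cancel and the pole becomes [- 1 / eps]. Multiplication
    by [- eps] turns the pole into the constant 1 and shifts the index; [eps ^ (j + 1) / j!] is
    [j + 1] times a Taylor term, which is the factor in [gamma_tilde]. *)
Lemma expansion_zeta N (gam : nat -> R) :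
  (forall s, 1 < s -> is_series (fun j => (-1) ^ j * gam j / INR (fact j) * (s - 1) ^ j) (rzeta s - 1 / (s - 1))) ->
  has_expansion N (fun eps => - eps * rzeta (1 - eps)) (gamma_tilde gam).
Proof.
intros Hg; apply (has_expansion_weaken (S N)); [lia|].
assert (H : has_expansion N (fun eps => rzeta (1 - eps) + 1 / eps) gam).
{ apply (has_expansion_ext N (fun eps => rzeta (1 - eps) + 1 / eps) _
    (fun r => INR (fact r) * (gam r / INR (fact r))) _ 1); [lra|reflexivity| |].
  - intros r _; field; apply INR_fact_neq_0.
  - apply (expansion_power_series N (fun j => gam j / INR (fact j))); intros eps He.
    specialize (Hg (1 - eps) ltac:(lra)).
    replace (rzeta (1 - eps) + 1 / eps) with (rzeta (1 - eps) - 1 / (1 - eps - 1)) by (field; lra).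
    revert Hg; apply is_series_ext; intros j.
    match goal with |- ?a = ?b => change (@eq R a b) end.
    replace (1 - eps - 1) with (-1 * eps) by ring; rewrite Rpow_mult_distr.
    assert (E : (-1) ^ j * (-1) ^ j = 1) by (rewrite <- Rpow_mult_distr; replace (-1 * -1) with 1 by ring; apply pow1).
    transitivity (((-1) ^ j * (-1) ^ j) * (gam j / INR (fact j) * eps ^ j)); [unfold Rdiv; ring|].
    rewrite E; ring. }
apply (bigO_ext (S N) (fun eps => -1 * (taylor_term eps 1 * (rzeta (1 - eps) + 1 / eps - taylor N gam eps))) _ 1);
  [lra| |apply bigO_scal, (bigO_mult 1 N); [apply bigO_taylor_term|exact H]].
intros eps He; unfold taylor at 2; cbn [seq]; rewrite Rsum_cons, <- seq_shift, Rsum_map.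
rewrite (Rsum_ext_in (fun r => _ * gamma_tilde _ _) (fun r => - eps * (taylor_term eps r * gam r))).
- rewrite Rsum_scal; unfold taylor, taylor_term; cbn [gamma_tilde pow fact INR Nat.mul Nat.add]; field; lra.
- intros r _; unfold taylor_term, gamma_tilde; rewrite fact_simpl, mult_INR; cbn [pow].
  pose proof (INR_S_pos r); field; split; [apply INR_fact_neq_0|lra].
Qed.

Lemma dphi_0 x : dphi 0 x = 0.
Proof.
unfold dphi.
assert (Hz : forall i y, Dlog (S i) 0 y = 0).
{ intros i y; unfold Dlog, log_form; apply Rsum_zero; intros [c m] Hcm.
  enough (c = 0) as -> by (cbn; unfold Rdiv; ring).
  revert c m Hcm; induction i as [|i IH]; intros c m Hcm.
  - cbn in Hcm; destruct Hcm as [[= <- _]|[[= <- _]|[]]]; ring.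
  - cbn [Dlog_coefs] in Hcm; unfold log_form_derive at 1 in Hcm; apply in_flat_map in Hcm as ([c' m'] & H & Hcm).
    apply (IH c' m') in H; subst c'; cbn [fst snd] in Hcm.
    destruct Hcm as [[= <- _]|[[= <- _]|[]]]; ring. }
transitivity (Series (fun _ : nat => 0)); [|apply is_series_unique, is_series_zero].
apply Series_ext; intros i; transitivity (Series (fun _ : nat => 0)); [|apply is_series_unique, is_series_zero].
apply Series_ext; intros j; unfold diff2; rewrite !Hz; ring.
Qed.

(** * Comparison of coefficients in the Hecke relation *)

Section HeckeExpansion.
Variables (n : nat) (Tn v : comb) (gam : nat -> R) (x : R).
Hypothesis Hn : (1 <= n)%nat.
Hypothesis HT : acts_like_Hecke n Tn.
Hypothesis Hv : in_R n v.
Hypothesis HTv : req Tn v.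
Hypothesis Hnn : List.Forall (fun t => nonneg_entries (snd t)) v.
Hypothesis Hgam : forall s, 1 < s ->
  is_series (fun j => (-1) ^ j * gam j / INR (fact j) * (s - 1) ^ j) (rzeta s - 1 / (s - 1)).
Hypothesis Hx : 0 < x.

Let num (t : Q * mat) : R := IZR (ma (snd t)) * x + IZR (mb (snd t)).
Let den (t : Q * mat) : R := IZR (mc (snd t)) * x + IZR (md (snd t)).

Lemma num_den_pos t : In t v -> 0 < num t /\ 0 < den t.
Proof.
intros Ht; unfold in_R in Hv; rewrite Forall_forall in Hv, Hnn.
apply (det_pos_linear_pos n); trivial; [apply Hnn, Ht|apply Hv, Ht].
Qed.

Lemma divisor_pos l : In l (divisors n) -> 0 < INR l.
Proof. intros Hl; apply in_divisors in Hl as [_ Hl]; [apply lt_0_INR; lia|exact Hn]. Qed.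

(** The relation for [dzeta] at [s = 2 - eps], multiplied by [- eps (eps - 1)] and rewritten by
    [gen_neg]. Under the slash action the boundary term becomes [(u / w) ^ (eps - 1) * w ^ (eps - 2)
    = u ^ eps / (u w)], the origin of the denominators [(a x + b)(c x + d)]. *)
Lemma Hecke_gen eps : eps < 0 ->
  Rsum (fun t => Q2R (fst t) * (/ den t ^ 2 * (gen eps (num t / den t) * Rpower (den t) eps)
     - / (num t * den t) * (Rpower (num t) eps * (- eps * rzeta (1 - eps))))) v
  - Rsum (fun l => / INR l * (gen eps x * Rpower (INR l) eps)
     - / (INR l * x) * (Rpower (INR l * x) eps * (- eps * rzeta (1 - eps)))) (divisors n) = 0.
Proof.
intros He.
pose proof (dzeta_Hecke n Tn v (2 - eps) x Hn HT Hv HTv Hnn ltac:(lra) Hx) as H.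
apply (f_equal (fun z => - eps * (eps - 1) * z)) in H; rewrite <- !Rsum_scal in H.
assert (Hpow : forall e y, 0 < y -> Rpower y (e - 1) = Rpower y e / y).
{ intros e y Hy; replace (Rpower y e / y) with (Rpower y e / y ^ 1) by (rewrite pow_1; reflexivity); rewrite Rpower_div_pow by exact Hy; reflexivity. }
assert (Hpow2 : forall e y, 0 < y -> Rpower y (- (2 - e)) = Rpower y e / y ^ 2).
{ intros e y Hy; rewrite Rpower_div_pow by exact Hy; f_equal; cbn; ring. }
apply Rminus_diag_eq; etransitivity; [|etransitivity; [exact H|]]; apply Rsum_ext_in.
- intros t Ht; cbn zeta; fold (num t) (den t).
  destruct (num_den_pos t Ht) as [H1 H2].
  rewrite gen_neg by (trivial; apply Rdiv_lt_0_compat; assumption).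
  assert (E1 : Rpower (num t) eps = Rpower (num t / den t) eps * Rpower (den t) eps).
  { rewrite <- Rpower_mult_base by (trivial; apply Rdiv_lt_0_compat; assumption).
    f_equal; field; lra. }
  rewrite E1, (Hpow eps), (Hpow2 eps) by (trivial; apply Rdiv_lt_0_compat; assumption).
  field; lra.
- intros l Hl; pose proof (divisor_pos l Hl) as H1.
  rewrite gen_neg by trivial.
  rewrite Rpower_mult_base, (Hpow eps), (Hpow2 eps) by trivial.
  field; lra.
Qed.

Lemma Hecke_dphi m :
  Rsum (fun r => Binomial.C m r *
    (Rsum (fun t => Q2R (fst t) * (/ den t ^ 2 * (dphi r (num t / den t) * ln (den t) ^ (m - r)))) v
     - Rsum (fun l => ln (INR l) ^ (m - r) / INR l) (divisors n) * dphi r x)) (seq 0 (S m))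
  = Rsum (fun r => Binomial.C m r * gamma_tilde gam (m - r) *
    (Rsum (fun t => Q2R (fst t) * (ln (num t) ^ r / (num t * den t))) v
     - Rsum (fun l => ln (INR l * x) ^ r / (INR l * x)) (divisors n))) (seq 0 (S m)).
Proof.
set (G := fun eps => - eps * rzeta (1 - eps)).
assert (HG : has_expansion (S m) G (gamma_tilde gam)) by apply expansion_zeta, Hgam.
assert (HL : has_expansion (S m)
  (fun eps => Rsum (fun t => Q2R (fst t) * (/ den t ^ 2 * (gen eps (num t / den t) * Rpower (den t) eps)
     - / (num t * den t) * (Rpower (num t) eps * G eps))) v)
  (fun k => Rsum (fun t => Q2R (fst t) *
     (/ den t ^ 2 * binomial_conv (fun r => dphi r (num t / den t)) (fun r => ln (den t) ^ r) k
      - / (num t * den t) * binomial_conv (fun r => ln (num t) ^ r) (gamma_tilde gam) k)) v)).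
{ apply (has_expansion_Rsum (S m) (fun t eps => Q2R (fst t) *
    (/ den t ^ 2 * (gen eps (num t / den t) * Rpower (den t) eps)
     - / (num t * den t) * (Rpower (num t) eps * G eps)))).
  intros t Ht; destruct (num_den_pos t Ht) as [H1 H2].
  apply has_expansion_scal, has_expansion_minus; apply has_expansion_scal, has_expansion_mult; trivial;
    try apply expansion_Rpower.
  apply expansion_gen, Rdiv_lt_0_compat; assumption. }
assert (HR : has_expansion (S m)
  (fun eps => Rsum (fun l => / INR l * (gen eps x * Rpower (INR l) eps)
     - / (INR l * x) * (Rpower (INR l * x) eps * G eps)) (divisors n))
  (fun k => Rsum (fun l =>
     / INR l * binomial_conv (fun r => dphi r x) (fun r => ln (INR l) ^ r) k
      - / (INR l * x) * binomial_conv (fun r => ln (INR l * x) ^ r) (gamma_tilde gam) k) (divisors n))).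
{ apply (has_expansion_Rsum (S m) (fun l eps => / INR l * (gen eps x * Rpower (INR l) eps)
     - / (INR l * x) * (Rpower (INR l * x) eps * G eps))).
  intros l Hl.
  apply has_expansion_minus; apply has_expansion_scal, has_expansion_mult; trivial;
    try apply expansion_Rpower.
  apply expansion_gen, Hx. }
pose proof (expansion_of_zero _ _ _ 1 Rlt_0_1 (fun eps He => Hecke_gen eps (proj2 He))
  (has_expansion_minus _ _ _ _ _ HL HR) m (Nat.lt_succ_diag_r m)) as E; cbn beta in E.
apply Rminus_diag_uniq; rewrite <- E; clear E HL HR.
unfold binomial_conv; rewrite <- Rsum_minus.
transitivity (Rsum (fun r =>
  Rsum (fun t => Q2R (fst t) * (/ den t ^ 2 * (Binomial.C m r * dphi r (num t / den t) * ln (den t) ^ (m - r))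
     - / (num t * den t) * (Binomial.C m r * ln (num t) ^ r * gamma_tilde gam (m - r)))) v
  - Rsum (fun l => / INR l * (Binomial.C m r * dphi r x * ln (INR l) ^ (m - r))
     - / (INR l * x) * (Binomial.C m r * ln (INR l * x) ^ r * gamma_tilde gam (m - r))) (divisors n))
  (seq 0 (S m))).
- apply Rsum_ext_in; intros r _.
  rewrite (Rsum_ext_in (fun t => Q2R (fst t) * (_ - _)) (fun t =>
     Binomial.C m r * (Q2R (fst t) * (/ den t ^ 2 * (dphi r (num t / den t) * ln (den t) ^ (m - r))))
     - Binomial.C m r * gamma_tilde gam (m - r) * (Q2R (fst t) * (ln (num t) ^ r / (num t * den t)))))
    by (intros; unfold Rdiv; ring).
  rewrite (Rsum_ext_in (fun l => _ - _) (fun l =>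
     (Binomial.C m r * dphi r x) * (ln (INR l) ^ (m - r) / INR l)
     - Binomial.C m r * gamma_tilde gam (m - r) * (ln (INR l * x) ^ r / (INR l * x))))
    by (intros; unfold Rdiv; ring).
  rewrite !Rsum_minus, !Rsum_scal; ring.
- rewrite Rsum_minus; f_equal; rewrite Rsum_exchange; apply Rsum_ext_in.
  + intros t _; rewrite Rsum_scal, Rsum_minus, !Rsum_scal; reflexivity.
  + intros l _; rewrite Rsum_minus, !Rsum_scal; reflexivity.
Qed.

(* The terms [r = 0] drop out: [dphi 0 = 0], and the remaining factor on the
   right is the relation of order [0]. *)
Lemma Hecke_dphi_positive k :
  Rsum (fun r => Binomial.C k r *
    (Rsum (fun t => Q2R (fst t) * (/ den t ^ 2 * (dphi r (num t / den t) * ln (den t) ^ (k - r)))) v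
     - Rsum (fun l => ln (INR l) ^ (k - r) / INR l) (divisors n) * dphi r x)) (seq 1 k)
  = Rsum (fun r => Binomial.C k r * gamma_tilde gam (k - r) *
    (Rsum (fun t => Q2R (fst t) * (ln (num t) ^ r / (num t * den t))) v
     - Rsum (fun l => ln (INR l * x) ^ r / (INR l * x)) (divisors n))) (seq 1 k).
Proof.
assert (HL : forall m, Rsum (fun t => Q2R (fst t) *
    (/ den t ^ 2 * (dphi 0 (num t / den t) * ln (den t) ^ (m - 0)))) v
     - Rsum (fun l => ln (INR l) ^ (m - 0) / INR l) (divisors n) * dphi 0 x = 0).
{ intros m; rewrite (Rsum_zero (fun t : Q * mat => _)); [rewrite dphi_0; ring|].
  intros t _; rewrite dphi_0; ring. }
pose proof (Hecke_dphi 0) as H0; unfold Rsum at 1 4 in H0; cbn [seq map fold_right] in H0.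
rewrite HL in H0.
pose proof (Hecke_dphi k) as Hk; cbn [seq] in Hk; rewrite !Rsum_cons, HL in Hk.
set (B := Rsum (fun t => Q2R (fst t) * (ln (num t) ^ 0 / (num t * den t))) v
     - Rsum (fun l => ln (INR l * x) ^ 0 / (INR l * x)) (divisors n)) in *.
assert (HB : B = 0).
{ cbn [Nat.sub gamma_tilde] in H0.
  replace (Binomial.C 0 0) with 1 in H0 by (unfold Binomial.C; cbn; field); lra. }
rewrite HB in Hk; lra.
Qed.

End HeckeExpansion.

(** * Termwise differentiation *)

Lemma is_derive_quadratic (f : R -> R) x l r M : 0 < r ->
  (forall y, Rabs (y - x) < r -> Rabs (f y - f x - l * (y - x)) <= M * Rabs (y - x) ^ 2) ->
  is_derive f x l.
Proof.
intros Hr H; apply is_derive_Reals; intros eps Heps.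
assert (HM : 0 < Rabs M + 1) by (pose proof (Rabs_pos M); lra).
assert (Hd : 0 < Rmin r (eps / (Rabs M + 1)))
  by (apply Rmin_pos; [exact Hr|apply Rdiv_lt_0_compat; assumption]).
exists (mkposreal _ Hd); intros h Hh0 Hh; cbn in Hh.
pose proof (Rmin_l r (eps / (Rabs M + 1))); pose proof (Rmin_r r (eps / (Rabs M + 1))).
specialize (H (x + h)); replace (x + h - x) with h in H by ring.
specialize (H ltac:(lra)).
assert (Hp : 0 < Rabs h) by (apply Rabs_pos_lt, Hh0).
replace ((f (x + h) - f x) / h - l) with ((f (x + h) - f x - l * h) * / h) by (field; exact Hh0).
rewrite Rabs_mult, Rabs_inv.
apply Rle_lt_trans with (M * Rabs h ^ 2 * / Rabs h).
- apply Rmult_le_compat_r; [apply Rlt_le, Rinv_0_lt_compat, Hp|exact H].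
- replace (M * Rabs h ^ 2 * / Rabs h) with (M * Rabs h) by (field; lra).
  apply Rle_lt_trans with ((Rabs M + 1) * Rabs h); [pose proof (Rle_abs M); nra|].
  apply Rlt_le_trans with ((Rabs M + 1) * (eps / (Rabs M + 1))); [apply Rmult_lt_compat_l; lra|].
  right; field; lra.
Qed.

Lemma is_derive_lipschitz (f df : R -> R) x y M :
  (forall z, Rmin x y <= z <= Rmax x y -> is_derive f z (df z)) ->
  (forall z, Rmin x y <= z <= Rmax x y -> Rabs (df z) <= M) ->
  Rabs (f y - f x) <= M * Rabs (y - x).
Proof.
intros H1 H2; destruct (MVT_gen f x y df) as (c & Hc & E).
- intros z Hz; apply H1; lra.
- intros z Hz; apply continuity_pt_filterlim, (ex_derive_continuous f); exists (df z); apply H1, Hz.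
- rewrite E, Rabs_mult; apply Rmult_le_compat_r; [apply Rabs_pos|apply H2, Hc].
Qed.

Lemma between_close x y z : Rmin x y <= z <= Rmax x y -> Rabs (z - x) <= Rabs (y - x).
Proof.
unfold Rmin, Rmax; destruct (Rle_dec x y); unfold Rabs;
  destruct (Rcase_abs (z - x)), (Rcase_abs (y - x)); lra.
Qed.

(** Termwise, the mean value theorem and the Lipschitz bound on [f' n] make the linearisation error
    at most [M n * |y - x| ^ 2]; summability of [M] gives a quadratic error for the sum. *)
Lemma is_derive_Series (f f' : nat -> R -> R) (x r : R) (M : nat -> R) :
  0 < r -> ex_series M ->
  (forall n y, Rabs (y - x) < r -> is_derive (f n) y (f' n y)) ->
  (forall n y, Rabs (y - x) < r -> Rabs (f' n y - f' n x) <= M n * Rabs (y - x)) ->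
  (forall y, Rabs (y - x) < r -> ex_series (fun n => f n y)) ->
  ex_series (fun n => f' n x) ->
  is_derive (fun y => Series (fun n => f n y)) x (Series (fun n => f' n x)).
Proof.
intros Hr HM Hf Hlip Hex Hex'.
apply (is_derive_quadratic _ x _ r (Series M) Hr); intros y Hy.
assert (Hx : ex_series (fun n => f n x)) by (apply Hex; rewrite Rminus_diag, Rabs_R0; exact Hr).
assert (Hs : ex_series (fun n => f' n x * (y - x))).
{ apply (ex_series_ext (fun n => (y - x) * f' n x)); [intros; apply Rmult_comm|].
  apply (ex_series_scal_l (y - x) (fun n => f' n x) Hex'). }
rewrite <- Series_scal_r, <- Series_minus by (assumption || apply Hex, Hy).
rewrite <- Series_minus; [|apply (ex_series_minus (V := R_NormedModule)); [apply Hex, Hy|exact Hx]|exact Hs].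
replace (Series M * Rabs (y - x) ^ 2) with (Series (fun n => Rabs (y - x) ^ 2 * M n))
  by (rewrite Series_scal_l; ring).
apply Series_abs_le; [|apply (ex_series_scal_l (Rabs (y - x) ^ 2) M HM)]; intros n.
assert (Hin : forall z, Rmin x y <= z <= Rmax x y -> Rabs (z - x) < r)
  by (intros z Hz; eapply Rle_lt_trans; [apply (between_close x y z), Hz|exact Hy]).
destruct (MVT_gen (f n) x y (f' n)) as (c & Hc & E).
- intros z Hz; apply Hf, Hin; lra.
- intros z Hz; apply continuity_pt_filterlim, (ex_derive_continuous (f n)); exists (f' n z).
  apply Hf, Hin, Hz.
- rewrite E, <- Rmult_minus_distr_r, Rabs_mult.
  replace (Rabs (y - x) ^ 2 * M n) with ((M n * Rabs (y - x)) * Rabs (y - x)) by ring.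
  apply Rmult_le_compat_r; [apply Rabs_pos|].
  pose proof (between_close x y c Hc) as Hcy.
  pose proof (Hlip n c (Hin c Hc)) as H1.
  destruct (Rle_lt_dec 0 (M n)) as [H0|H0].
  + eapply Rle_trans; [exact H1|]; apply Rmult_le_compat_l; assumption.
  (* A negative [M n] is compatible with the Lipschitz bound only at [y = x]. *)
  + assert (Hz : Rabs (y - x) = 0).
    { pose proof (Rabs_pos (f' n y - f' n x)); pose proof (Hlip n y Hy); pose proof (Rabs_pos (y - x)); nra. }
    pose proof (Rabs_pos (c - x)); rewrite Hz in *; replace (Rabs (c - x)) with 0 in H1 by lra; exact H1.
Qed.

(** * The logarithm of Dilcher's gamma function on the positive axis *)

(** For [k >= 1], [k] times the logarithm of the ratio of consecutive partial products in the limit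
    defining Dilcher's function of index [k - 1]. The factor of index 0 in the denominator is kept
    apart, as the term [- Dlog 0 k y] of [log_Gamma]. *)
Definition dil_term (k j : nat) (y : R) : R :=
  y * (ln (INR (S j)) ^ k - ln (INR j) ^ k) + ln (INR (S j)) ^ k - Dlog 0 k (INR (S j) + y).

Definition dil_term' (k j : nat) (y : R) : R :=
  ln (INR (S j)) ^ k - ln (INR j) ^ k - Dlog 1 k (INR (S j) + y).

Definition log_Gamma (k : nat) (y : R) : R :=
  / INR k * (- Dlog 0 k y + Series (fun j => dil_term k j y)).

Definition psi (k : nat) (y : R) : R :=
  / INR k * (- Dlog 1 k y + Series (fun j => dil_term' k j y)).

Lemma is_derive_dil_term k j y : 0 <= y -> is_derive (dil_term k j) y (dil_term' k j y).
Proof.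
intros Hy; unfold dil_term, dil_term'; pose proof (INR_S_pos j).
set (A := ln (INR (S j)) ^ k - ln (INR j) ^ k); set (B := ln (INR (S j)) ^ k).
apply (is_derive_minus (V := R_NormedModule) (fun y => y * A + B)).
- auto_derive; [trivial|ring].
- eapply is_derive_eq.
  + apply (is_derive_comp (Dlog 0 k) (fun y => INR (S j) + y)).
    * apply is_derive_Dlog; lra.
    * instantiate (1 := 1); auto_derive; [trivial|ring].
  + apply Rmult_1_l.
Qed.

Lemma Dlog_2_bound k : exists K, 0 <= K /\
  forall a z, 1 <= a -> a <= z -> Rabs (Dlog 2 k z) <= K * Rpower a (- (3 / 2)).
Proof.
destruct (Dlog_bound 2 k 1 ltac:(lra)) as (K & HK0 & HK); exists K; split; [exact HK0|].
intros a z Ha Hz; eapply Rle_trans; [apply HK; lra|].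
replace (INR 2 - 1 / 2) with (3 / 2) by (cbn; field).
apply Rmult_le_compat_l; [exact HK0|apply Rpower_antitone; lra].
Qed.

Lemma INR_S_ge_1 j : 1 <= INR (S j).
Proof. rewrite S_INR; pose proof (pos_INR j); lra. Qed.

(** A mean value [Dlog 1 k a] with [a] in [[j + 1, j + 2]] is compared with [Dlog 1 k (j + 2 + y)];
    the points are at most [1 + y] apart. The index starts at [S j] to keep the interval away from
    0. *)
Lemma dil_term'_bound k : exists K, 0 <= K /\ forall j y, 0 <= y ->
  Rabs (dil_term' k (S j) y) <= K * (1 + y) * Rpower (INR (S j)) (- (3 / 2)).
Proof.
destruct (Dlog_2_bound k) as (K & HK0 & HK); exists K; split; [exact HK0|]; intros j y Hy.
unfold dil_term'; rewrite <- !Dlog_0; pose proof (INR_S_ge_1 j) as Hj.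
rewrite (S_INR (S j)).
destruct (is_derive_MVT (Dlog 0 k) (Dlog 1 k) (INR (S j)) (INR (S j) + 1)) as (a & Ha & E1);
  [lra|intros; apply is_derive_Dlog; lra|].
destruct (is_derive_MVT (Dlog 1 k) (Dlog 2 k) a (INR (S j) + 1 + y)) as (b & Hb & E2);
  [lra|intros; apply is_derive_Dlog; lra|].
replace (Dlog 0 k (INR (S j) + 1) - Dlog 0 k (INR (S j)) - Dlog 1 k (INR (S j) + 1 + y))
  with (- (Dlog 2 k b * (INR (S j) + 1 + y - a))) by lra.
rewrite Rabs_Ropp, Rabs_mult, (Rabs_pos_eq (_ - a)) by lra.
replace (K * (1 + y) * Rpower (INR (S j)) (- (3 / 2)))
  with ((K * Rpower (INR (S j)) (- (3 / 2))) * (1 + y)) by ring.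
apply Rmult_le_compat; [apply Rabs_pos|lra|apply HK; lra|lra].
Qed.

Lemma ex_series_shift_bound (a : nat -> R) K :
  (forall j, Rabs (a (S j)) <= K * Rpower (INR (S j)) (- (3 / 2))) -> ex_series a.
Proof.
intros H; apply ex_series_incr_1, (ex_series_le_abs _ _ H).
apply (ex_series_scal_l K (fun j => Rpower (INR (S j)) (- (3 / 2)))), ex_series_Rpower; lra.
Qed.

Lemma ex_series_dil_term' k y : 0 <= y -> ex_series (fun j => dil_term' k j y).
Proof.
intros Hy; destruct (dil_term'_bound k) as (K & HK0 & HK).
apply (ex_series_shift_bound _ (K * (1 + y))); intros j; apply HK, Hy.
Qed.

(** Each term vanishes at [y = 0], so the bound on its derivative bounds the term itself. *)
Lemma ex_series_dil_term k y : 0 <= y -> ex_series (fun j => dil_term k j y).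
Proof.
intros Hy; destruct (dil_term'_bound k) as (K & HK0 & HK).
apply (ex_series_shift_bound _ (K * (1 + y) * y)); intros j.
assert (H : Rabs (dil_term k (S j) y - dil_term k (S j) 0) <=
  (K * (1 + y) * Rpower (INR (S j)) (- (3 / 2))) * Rabs (y - 0)).
{ apply (is_derive_lipschitz _ (dil_term' k (S j))); rewrite Rmin_left, Rmax_right by exact Hy.
  - intros z Hz; apply is_derive_dil_term; lra.
  - intros z Hz; eapply Rle_trans; [apply HK; lra|].
    apply Rmult_le_compat_r; [apply Rlt_le, Rpower_pos|].
    apply Rmult_le_compat_l; lra. }
replace (dil_term k (S j) 0) with 0 in H.
2:{ unfold dil_term; rewrite Dlog_0, Rplus_0_r; ring. }
rewrite !Rminus_0_r, (Rabs_pos_eq y) in H by exact Hy; lra.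
Qed.

Lemma is_derive_log_Gamma k y : 0 < y -> is_derive (log_Gamma k) y (psi k y).
Proof.
intros Hy; unfold log_Gamma, psi; apply is_derive_scal.
apply (is_derive_plus (V := R_NormedModule) (fun y => - Dlog 0 k y)).
- apply (is_derive_opp (V := R_NormedModule) (Dlog 0 k)), is_derive_Dlog, Hy.
- destruct (Dlog_2_bound k) as (K & HK0 & HK).
  assert (Hpos : forall z, Rabs (z - y) < y -> 0 < z).
  { intros z Hz; apply Rabs_def2 in Hz; lra. }
  apply (is_derive_Series (dil_term k) (dil_term' k) y y (fun j => K * Rpower (INR (S j)) (- (3 / 2)))).
  + exact Hy.
  + apply (ex_series_scal_l K (fun j => Rpower (INR (S j)) (- (3 / 2)))), ex_series_Rpower; lra.
  + intros j z Hz; apply is_derive_dil_term, Rlt_le, Hpos, Hz.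
  + intros j z Hz; apply Hpos in Hz; pose proof (INR_S_ge_1 j).
    replace (dil_term' k j z - dil_term' k j y)
      with (- (Dlog 1 k (INR (S j) + z) - Dlog 1 k (INR (S j) + y))) by (unfold dil_term'; ring).
    rewrite Rabs_Ropp.
    replace (z - y) with (INR (S j) + z - (INR (S j) + y)) by ring.
    assert (Hmin : INR (S j) <= Rmin (INR (S j) + y) (INR (S j) + z)) by (apply Rmin_glb; lra).
    apply (is_derive_lipschitz _ (Dlog 2 k)).
    * intros w Hw; apply is_derive_Dlog; lra.
    * intros w Hw; apply HK; lra.
  + intros z Hz; apply ex_series_dil_term, Rlt_le, Hpos, Hz.
  + apply ex_series_dil_term'; lra.
Qed.

(** This default value lets the telescoping of [ln N ^ k] start at [N = 0], since [ln 0 ^ k]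
    vanishes for [k >= 1]. *)
Lemma ln_0 : ln 0 = 0.
Proof. unfold ln; destruct (Rlt_dec 0 0) as [H|H]; [destruct (Rlt_irrefl 0 H)|reflexivity]. Qed.

Lemma log_Gamma_partial k N y : (1 <= k)%nat ->
  ln (INR N) ^ k / INR k * y + Rsum (fun j => ln (INR j) ^ k / INR k) (seq 1 N)
   - Rsum (fun j => ln (INR j + y) ^ k / INR k) (seq 0 (N + 1))
  = / INR k * (- Dlog 0 k y + Rsum (fun j => dil_term k j y) (seq 0 N)).
Proof.
intros Hk; assert (H : INR k <> 0) by (apply not_0_INR; lia).
rewrite Nat.add_1_r; induction N as [|N IH].
- rewrite Dlog_0; unfold Rsum; cbn [seq map fold_right INR].
  rewrite ln_0, Rplus_0_l, pow_i by lia; field; exact H.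
- rewrite (Rsum_seq_S (fun j => dil_term k j y) N), (Rsum_seq_S _ (S N)), (seq_S N 1), Rsum_app.
  assert (E : dil_term k N y = ln (INR (S N)) ^ k * y - ln (INR N) ^ k * y + ln (INR (S N)) ^ k
    - ln (INR (S N) + y) ^ k) by (unfold dil_term; rewrite Dlog_0; ring).
  rewrite E; cbn [Nat.add]; rewrite Rsum_cons; unfold Rsum at 2; cbn [map fold_right].
  transitivity (ln (INR N) ^ k / INR k * y + Rsum (fun j => ln (INR j) ^ k / INR k) (seq 1 N)
    - Rsum (fun j => ln (INR j + y) ^ k / INR k) (seq 0 (S N))
    + / INR k * (ln (INR (S N)) ^ k * y - ln (INR N) ^ k * y + ln (INR (S N)) ^ k
    - ln (INR (S N) + y) ^ k)); [field; exact H|rewrite IH; ring].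
Qed.

(** Both sides have the same sums of [Dlog 1 k]. The powers of the logarithm telescope to
    [ln (N + 1 + w) ^ k] in the second differences and to [ln N ^ k] in [psi]; their difference is
    [O(N ^ (- 1/2))]. *)
Lemma psi_diff2 k w : (1 <= k)%nat -> 0 < w ->
  INR k * psi k w - ln w ^ k = Series (fun j => diff2 (Dlog 0 k) (Dlog 1 k) (w + INR j)).
Proof.
intros Hk Hw; symmetry; apply is_series_unique, is_series_Rsum.
assert (H : INR k <> 0) by (apply not_0_INR; lia).
apply is_lim_seq_incr_1.
apply is_lim_seq_ext with (fun N =>
  (- Dlog 1 k w - Dlog 0 k w + Rsum (fun j => dil_term' k j w) (seq 0 N))
  + (Dlog 0 k (INR (S N) + w) - ln (INR N) ^ k)).
- intros N; induction N as [|N IH].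
  + unfold Rsum; cbn [seq map fold_right]; unfold diff2.
    replace (w + INR 0) with w by (cbn; ring); replace (INR 1 + w) with (w + 1) by (cbn; ring).
    change (INR 0) with 0; rewrite ln_0, pow_i by lia; ring.
  + rewrite (Rsum_seq_S _ (S N)), <- IH, (Rsum_seq_S _ N); unfold diff2, dil_term'.
    replace (w + INR (S N) + 1) with (INR (S (S N)) + w) by (rewrite (S_INR (S N)); ring).
    rewrite (Rplus_comm w (INR (S N))); ring.
- replace (INR k * psi k w - ln w ^ k) with
    ((- Dlog 1 k w - Dlog 0 k w + Series (fun j => dil_term' k j w)) + 0)
    by (unfold psi; rewrite Dlog_0; field; exact H).
  apply is_lim_seq_plus'.
  + apply is_lim_seq_plus'; [apply is_lim_seq_const|].
    apply ex_series_lim_Rsum, ex_series_dil_term'; lra.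
  + destruct (Dlog_bound 1 k 1 ltac:(lra)) as (K & HK0 & HK).
    apply is_lim_seq_incr_1, is_lim_seq_abs_0.
    apply (is_lim_seq_le_le (fun _ => 0) _ (fun N => (K * (1 + w)) * Rpower (INR (S N)) (- (1 / 2)))).
    * intros N; split; [apply Rabs_pos|].
      pose proof (INR_S_ge_1 N); rewrite <- Dlog_0, (S_INR (S N)).
      assert (Hl : Rabs (Dlog 0 k (INR (S N) + 1 + w) - Dlog 0 k (INR (S N))) <=
        (K * Rpower (INR (S N)) (- (1 / 2))) * Rabs (INR (S N) + 1 + w - INR (S N))).
      { apply (is_derive_lipschitz _ (Dlog 1 k)); rewrite Rmin_left, Rmax_right by lra.
        - intros z Hz; apply is_derive_Dlog; lra.
        - intros z Hz; eapply Rle_trans; [apply HK; lra|].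
          replace (INR 1 - 1 / 2) with (1 / 2) by (cbn; field).
          apply Rmult_le_compat_l; [exact HK0|apply Rpower_antitone; lra]. }
      rewrite (Rabs_pos_eq (_ + w - _)) in Hl by lra.
      eapply Rle_trans; [exact Hl|right; ring].
    * apply is_lim_seq_const.
    * replace (Finite 0) with (Rbar_mult (K * (1 + w)) 0) by (cbn; f_equal; ring).
      apply is_lim_seq_scal_l, is_lim_seq_Rpower_neg; [lra|].
      apply (is_lim_seq_incr_1 INR), is_lim_seq_INR.
Qed.

(** * The Herglotz-Zagier functions on the positive axis *)

Definition phi_row (k i : nat) (x : R) : R :=
  Series (fun j => diff2 (Dlog 0 k) (Dlog 1 k) (node x i j) / INR (S i)).

Definition dphi_row (k i : nat) (x : R) : R :=
  Series (fun j => diff2 (Dlog 1 k) (Dlog 2 k) (node x i j)).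

(** Without the derivative in [x] the decay is only 3/2, split as [1/4 + 5/4]; the division by
    [i + 1] raises the share of [i] to 5/4. *)
Lemma phi_bound k x : 0 < x -> exists K, forall i j,
  Rabs (diff2 (Dlog 0 k) (Dlog 1 k) (node x i j) / INR (S i)) <= K * weight i * weight j.
Proof.
intros Hx; destruct (Rmin_1_bounds x Hx) as [Hc Hcx].
destruct (diff2_Dlog_bound 0 k _ Hc) as (K & HK0 & HK).
exists (K * Rpower (Rmin x 1) (- (1 / 4 + 5 / 4))); intros i j.
pose proof (INR_S_pos i) as Hi; pose proof (Rinv_0_lt_compat _ Hi) as Hi'.
unfold Rdiv; rewrite Rabs_mult, (Rabs_pos_eq (/ _)) by lra.
apply Rle_trans with ((K * (Rpower (Rmin x 1) (- (1 / 4 + 5 / 4)) * Rpower (INR (S i)) (- (1 / 4))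
   * Rpower (INR (S j)) (- (5 / 4)))) * / INR (S i)).
- apply Rmult_le_compat_r; [lra|].
  eapply Rle_trans; [apply HK, node_ge_min; tauto|].
  apply Rmult_le_compat_l; [exact HK0|].
  replace (INR 0 + 3 / 2) with (1 / 4 + 5 / 4) by (cbn; field).
  apply Rpower_node_le; try tauto; lra.
- right; unfold weight.
  replace (- (5 / 4)) with (- (1 / 4) - INR 1) at 2 by (cbn; field).
  rewrite <- Rpower_div_pow, pow_1 by exact Hi; unfold Rdiv; ring.
Qed.

(** One more derivative gives decay 7/2, split as [9/4 + 5/4]; the chain rule factor [i + 1] lowers
    the share of [i] to 5/4. Monotonicity of the nodes in [x] makes the constant uniform on
    [[c, oo)]. *)
Lemma phi_lipschitz k c : 0 < c -> exists K, 0 <= K /\ forall i j y z, c <= y -> c <= z ->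
  Rabs (diff2 (Dlog 1 k) (Dlog 2 k) (node z i j) - diff2 (Dlog 1 k) (Dlog 2 k) (node y i j))
  <= (K * weight i * weight j) * Rabs (z - y).
Proof.
intros Hc0; destruct (Rmin_1_bounds c Hc0) as [Hc Hcx].
destruct (diff2_Dlog_bound 2 k _ Hc) as (K & HK0 & HK).
exists (K * Rpower (Rmin c 1) (- (9 / 4 + 5 / 4))); split;
  [apply Rmult_le_pos; [exact HK0|apply Rlt_le, Rpower_pos]|].
intros i j y z Hy Hz; pose proof (INR_S_pos i) as Hi.
assert (Hw : forall w, Rmin (node y i j) (node z i j) <= w -> node c i j <= w).
{ intros w Hw; eapply Rle_trans; [|exact Hw]; unfold node; apply Rmin_glb;
    apply Rplus_le_compat_r, Rmult_le_compat_l; lra. }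
pose proof (node_ge_min c (Rmin c 1) i j (proj1 Hc) Hcx (proj2 Hc)) as Hn.
pose proof (node_pos c i j Hc0) as Hn0.
apply Rle_trans with ((K * Rpower (node c i j) (- (9 / 4 + 5 / 4))) * Rabs (node z i j - node y i j)).
- apply (is_derive_lipschitz _ (diff2 (Dlog 2 k) (Dlog 3 k))).
  + intros w [H1 _]; apply Hw in H1; unfold diff2.
    apply (is_derive_minus (V := R_NormedModule) (fun y => Dlog 1 k (y + 1) - Dlog 1 k y));
      [|apply is_derive_Dlog; lra].
    apply (is_derive_minus (V := R_NormedModule) (fun y => Dlog 1 k (y + 1)));
      [|apply is_derive_Dlog; lra].
    eapply is_derive_eq.
    * apply (is_derive_comp (Dlog 1 k) (fun y => y + 1)); [apply is_derive_Dlog; lra|].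
      instantiate (1 := 1); auto_derive; [trivial|ring].
    * apply Rmult_1_l.
  + intros w [H1 _]; apply Hw in H1; eapply Rle_trans; [apply HK; lra|].
    replace (INR 2 + 3 / 2) with (9 / 4 + 5 / 4) by (cbn; field).
    apply Rmult_le_compat_l; [exact HK0|apply Rpower_antitone; lra].
- replace (node z i j - node y i j) with (INR (S i) * (z - y)) by (unfold node; ring).
  rewrite Rabs_mult, (Rabs_pos_eq (INR _)), <- Rmult_assoc by lra.
  apply Rmult_le_compat_r; [apply Rabs_pos|].
  apply Rle_trans with ((K * (Rpower (Rmin c 1) (- (9 / 4 + 5 / 4)) * Rpower (INR (S i)) (- (9 / 4))
   * Rpower (INR (S j)) (- (5 / 4)))) * INR (S i)).
  + apply Rmult_le_compat_r; [lra|]; apply Rmult_le_compat_l; [exact HK0|].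
    apply Rpower_node_le; try tauto; lra.
  + right; unfold weight.
    replace (- (9 / 4)) with (- (5 / 4) - INR 1) by (cbn; field).
    rewrite <- Rpower_div_pow, pow_1 by exact Hi; field; lra.
Qed.

Lemma is_derive_diff2_node k i j y : 0 < y ->
  is_derive (fun y => diff2 (Dlog 0 k) (Dlog 1 k) (node y i j) / INR (S i)) y
    (diff2 (Dlog 1 k) (Dlog 2 k) (node y i j)).
Proof.
intros Hy; pose proof (INR_S_pos i) as Hi; pose proof (node_pos y i j Hy) as Hn.
assert (Hnode : is_derive (fun y => node y i j) y (INR (S i)))
  by (unfold node; generalize (INR (S i)); intros a; auto_derive; [trivial|ring]).
assert (Hd : is_derive (diff2 (Dlog 0 k) (Dlog 1 k)) (node y i j) (diff2 (Dlog 1 k) (Dlog 2 k) (node y i j))).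
{ unfold diff2; apply (is_derive_minus (V := R_NormedModule) (fun y => Dlog 0 k (y + 1) - Dlog 0 k y));
    [|apply is_derive_Dlog; lra].
  apply (is_derive_minus (V := R_NormedModule) (fun y => Dlog 0 k (y + 1)));
    [|apply is_derive_Dlog; lra].
  eapply is_derive_eq.
  - apply (is_derive_comp (Dlog 0 k) (fun y => y + 1)); [apply is_derive_Dlog; lra|].
    instantiate (1 := 1); auto_derive; [trivial|ring].
  - apply Rmult_1_l. }
pose proof (is_derive_comp _ _ _ _ _ Hd Hnode) as Hcomp.
apply (is_derive_scal _ _ (/ INR (S i))) in Hcomp.
apply (is_derive_ext (fun y => / INR (S i) * diff2 (Dlog 0 k) (Dlog 1 k) (node y i j)));
  [intros z; apply Rmult_comm|].
apply (is_derive_eq _ _ _ _ Hcomp); unfold scal; cbn -[INR]; unfold mult; cbn -[INR]; field; lra.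
Qed.

Lemma is_derive_phi_row k i x : 0 < x -> is_derive (phi_row k i) x (dphi_row k i x).
Proof.
intros Hx; destruct (phi_lipschitz k (x / 2)) as (K & HK0 & HK); [lra|].
assert (Hpos : forall z, Rabs (z - x) < x / 2 -> x / 2 <= z).
{ intros z Hz; apply Rabs_def2 in Hz; lra. }
apply (is_derive_Series (fun j y => diff2 (Dlog 0 k) (Dlog 1 k) (node y i j) / INR (S i))
  (fun j y => diff2 (Dlog 1 k) (Dlog 2 k) (node y i j)) x (x / 2) (fun j => (K * weight i) * weight j)).
- lra.
- apply (ex_series_scal_l (K * weight i) weight), ex_series_weight.
- intros j y Hy; apply Hpos in Hy; apply is_derive_diff2_node; lra.
- intros j y Hy; apply Hpos in Hy; apply HK; lra.
- intros y Hy; apply Hpos in Hy; destruct (phi_bound k y) as [K' HK']; [lra|].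
  apply (dominated_row _ _ _ HK' ex_series_weight i).
- destruct (is_dsum_dphi k x Hx) as [H _]; apply H.
Qed.

Definition phi_real (k : nat) (x : R) : R := Series (fun i => phi_row k i x).

Lemma is_derive_phi_real k x : 0 < x -> is_derive (phi_real k) x (dphi k x).
Proof.
intros Hx; destruct (phi_lipschitz k (x / 2)) as (K & HK0 & HK); [lra|].
assert (Hpos : forall z, Rabs (z - x) < x / 2 -> x / 2 <= z).
{ intros z Hz; apply Rabs_def2 in Hz; lra. }
apply (is_derive_Series (phi_row k) (dphi_row k) x (x / 2) (fun i => (K * Series weight) * weight i)).
- lra.
- apply (ex_series_scal_l (K * Series weight) weight), ex_series_weight.
- intros i y Hy; apply Hpos in Hy; apply is_derive_phi_row; lra.
- intros i y Hy; apply Hpos in Hy; unfold dphi_row.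
  destruct (is_dsum_dphi k x Hx) as [H1 _]; destruct (is_dsum_dphi k y ltac:(lra)) as [H2 _].
  rewrite <- Series_minus by auto.
  replace (K * Series weight * weight i * Rabs (y - x))
    with (Series (fun j => (K * weight i * Rabs (y - x)) * weight j)) by (rewrite Series_scal_l; ring).
  apply Series_abs_le.
  + intros j; eapply Rle_trans; [apply HK; lra|right; ring].
  + apply (ex_series_scal_l (K * weight i * Rabs (y - x)) weight), ex_series_weight.
- intros y Hy; apply Hpos in Hy; destruct (phi_bound k y) as [K' HK']; [lra|].
  apply (dominated_sum _ _ _ HK' ex_series_weight).
- destruct (is_dsum_dphi k x Hx) as [_ H]; exists (dphi k x); exact H.
Qed.

(** * Restriction of the complex functions to the real axis *)

Lemma Cexp_RtoC a : Cexp (RtoC a) = RtoC (exp a).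
Proof. unfold Cexp, RtoC; cbn; rewrite cos_0, sin_0; f_equal; ring. Qed.

Lemma Clog_RtoC y : 0 < y -> Clog (RtoC y) = RtoC (ln y).
Proof.
intros Hy; unfold Clog, Carg; change (snd (RtoC y)) with 0; change (fst (RtoC y)) with y.
rewrite Cmod_R, Rabs_pos_eq by lra; unfold RtoC; f_equal.
destruct (Rle_dec 0 0) as [_|H]; [|destruct (H (Rle_refl 0))].
replace (y / y) with 1 by (field; lra); apply acos_1.
Qed.

Lemma Csum_RtoC {A : Type} (f : A -> R) (g : A -> C) l :
  (forall x, In x l -> g x = RtoC (f x)) -> Csum g l = RtoC (Rsum f l).
Proof.
intros H; induction l as [|x l IH]; [reflexivity|].
change (Cplus (g x) (Csum g l) = RtoC (f x + Rsum f l)).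
rewrite IH, H, <- RtoC_plus; [reflexivity|left; reflexivity|].
intros y Hy; apply H; right; exact Hy.
Qed.

Lemma Cprod_Cexp {A : Type} (f : A -> R) (g : A -> C) l :
  (forall x, In x l -> g x = RtoC (exp (f x))) -> Cprod g l = RtoC (exp (Rsum f l)).
Proof.
intros H; induction l as [|x l IH]; [unfold Cprod, Rsum; cbn; rewrite exp_0; reflexivity|].
change (Cmult (g x) (Cprod g l) = RtoC (exp (f x + Rsum f l))).
rewrite IH, H, <- RtoC_mult, exp_plus; [reflexivity|left; reflexivity|].
intros y Hy; apply H; right; exact Hy.
Qed.

Lemma CLim_seq_RtoC (u : nat -> R) (f : nat -> C) (l : R) :
  (forall N, f N = RtoC (u N)) -> is_lim_seq u l -> CLim_seq f = RtoC l.
Proof.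
intros H Hu; unfold CLim_seq, RtoC; f_equal.
- rewrite (Lim_seq_ext _ u) by (intros N; rewrite H; reflexivity).
  rewrite (is_lim_seq_unique _ _ Hu); reflexivity.
- rewrite (Lim_seq_ext _ (fun _ => 0)) by (intros N; rewrite H; reflexivity).
  rewrite Lim_seq_const; reflexivity.
Qed.

Lemma CSeries_RtoC (u : nat -> R) (f : nat -> C) :
  (forall i, f i = RtoC (u i)) -> CSeries f = RtoC (Series u).
Proof.
intros H; unfold CSeries, RtoC; f_equal.
- apply Series_ext; intros i; rewrite H; reflexivity.
- rewrite (Series_ext _ (fun _ => 0 * 0)) by (intros i; rewrite H; cbn; ring).
  rewrite Series_scal_l; ring.
Qed.

(* Coquelicot's [C_derive] is a limit along the horizontal line through the
   point, so at a real point it only sees the values on the real axis. *)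
Lemma C_derive_RtoC (f : C -> C) (g : R -> R) (x l : R) : 0 < x ->
  (forall y, 0 < y -> f (RtoC y) = RtoC (g y)) -> is_derive g x l -> C_derive f (RtoC x) = RtoC l.
Proof.
intros Hx Hf Hg.
assert (Hq : forall y, 0 < y -> y <> x ->
  ((f (RtoC y) - f (RtoC x)) / (RtoC y - RtoC x))%C = RtoC ((g y - g x) / (y - x))).
{ intros y Hy Hne; rewrite !Hf by assumption.
  rewrite <- !RtoC_minus, <- RtoC_div; [reflexivity|lra]. }
assert (Hloc : Rbar_locally' x (fun y => 0 < y /\ y <> x)).
{ exists (mkposreal x Hx); intros y Hy Hne; split; [|exact Hne].
  apply Rabs_def2 in Hy; unfold minus, plus, opp in Hy; cbn in Hy; lra. }
unfold C_derive, C_lim; change (snd (RtoC x)) with 0; change (fst (RtoC x)) with x.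
change (RtoC l) with (l, 0); f_equal.
- rewrite (Lim_ext_loc (fun y => (g y - g x) / (y - x))).
  2:{ revert Hloc; apply filter_imp; intros y [Hy Hne]; fold (RtoC y).
      change (y, 0) with (RtoC y); rewrite Hq by assumption; reflexivity. }
  assert (H : is_lim (fun y => (g y - g x) / (y - x)) x l); [|rewrite (is_lim_unique _ _ _ H); reflexivity].
  apply is_lim_spec; intros eps; apply is_derive_Reals in Hg.
  destruct (Hg eps (cond_pos eps)) as [d Hd]; exists d; intros y Hy Hne.
  specialize (Hd (y - x) ltac:(lra)).
  replace (x + (y - x)) with (y : R) in Hd by (symmetry; apply (Rplus_minus x y)); apply Hd, Hy.
- rewrite (Lim_ext_loc (fun _ => 0)).
  2:{ revert Hloc; apply filter_imp; intros y [Hy Hne].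
      change (y, 0) with (RtoC y); rewrite Hq by assumption; reflexivity. }
  rewrite Lim_const; reflexivity.
Qed.

Lemma Dilcher_Gamma_RtoC k y : 0 < y -> Dilcher_Gamma k (RtoC y) = RtoC (exp (log_Gamma (S k) y)).
Proof.
intros Hy; unfold Dilcher_Gamma.
assert (Hk : forall z, (RtoC z ^ (k + 1) / RtoC (INR (k + 1)))%C = RtoC (z ^ S k / INR (S k))).
{ intros z; rewrite Nat.add_1_r, RtoC_div, RtoC_pow; [reflexivity|].
  pose proof (INR_S_pos k); lra. }
apply (CLim_seq_RtoC (fun N => exp (/ INR (S k) *
  (- Dlog 0 (S k) y + Rsum (fun j => dil_term (S k) j y) (seq 0 N))))).
- intros N; rewrite <- log_Gamma_partial by lia.
  rewrite <- RtoC_mult, Cexp_RtoC, Nat.add_1_r.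
  rewrite (Cprod_Cexp (fun j => ln (INR j) ^ S k / INR (S k)))
    by (intros; apply Cexp_RtoC).
  rewrite (Cprod_Cexp (fun j => ln (INR j + y) ^ S k / INR (S k))).
  + rewrite <- RtoC_mult, <- RtoC_div by apply Rgt_not_eq, exp_pos.
    f_equal; unfold Rminus, Rdiv at 1; rewrite !exp_plus, exp_Ropp, Nat.add_1_r; reflexivity.
  + intros j _; rewrite <- RtoC_plus, Clog_RtoC by (pose proof (pos_INR j); lra).
    rewrite <- Nat.add_1_r, Hk, Nat.add_1_r, Cexp_RtoC; reflexivity.
- apply (is_lim_seq_continuous exp).
  + apply derivable_continuous_pt, derivable_pt_exp.
  + apply (is_lim_seq_scal_l _ (/ INR (S k)) (Finite _)), is_lim_seq_plus'; [apply is_lim_seq_const|].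
    apply ex_series_lim_Rsum, ex_series_dil_term; lra.
Qed.

Lemma Dilcher_psi_RtoC k y : 0 < y -> Dilcher_psi k (RtoC y) = RtoC (psi (S k) y).
Proof.
intros Hy; unfold Dilcher_psi.
rewrite (C_derive_RtoC _ (fun y => exp (log_Gamma (S k) y)) y (psi (S k) y * exp (log_Gamma (S k) y))).
- rewrite Dilcher_Gamma_RtoC, <- RtoC_div by (trivial; apply Rgt_not_eq, exp_pos).
  f_equal; field; apply Rgt_not_eq, exp_pos.
- exact Hy.
- intros z Hz; apply Dilcher_Gamma_RtoC, Hz.
- apply (is_derive_comp exp (log_Gamma (S k))); [apply is_derive_exp|apply is_derive_log_Gamma, Hy].
Qed.

Lemma Phi_RtoC k y : (1 <= k)%nat -> 0 < y -> Phi k (RtoC y) = RtoC (phi_real k y).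
Proof.
intros Hk Hy; unfold Phi, phi_real; apply CSeries_RtoC; intros i; cbv zeta.
pose proof (INR_S_pos i) as Hi.
assert (Hw : 0 < INR (S i) * y) by (apply Rmult_lt_0_compat; assumption).
rewrite <- RtoC_mult, Dilcher_psi_RtoC, Clog_RtoC by exact Hw.
replace (S (k - 1)) with k by lia.
rewrite <- RtoC_mult, <- RtoC_pow, <- RtoC_minus, <- RtoC_div by lra.
f_equal; rewrite psi_diff2 by assumption.
unfold phi_row, Rdiv; rewrite Series_scal_r; f_equal.
Qed.

Lemma dPhi_RtoC k y : (1 <= k)%nat -> 0 < y -> dPhi k (RtoC y) = RtoC (dphi k y).
Proof.
intros Hk Hy; apply (C_derive_RtoC _ (phi_real k)); [exact Hy| |apply is_derive_phi_real, Hy].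
intros z Hz; apply Phi_RtoC; assumption.
Qed.

(** In weight 2 the determinant factor is [n] itself, which the [1 / n] in the final formula
    cancels. *)
Lemma slash_dPhi n k r (g : mat) x : (1 <= n)%nat -> (1 <= r)%nat -> nonneg_entries g ->
  mdet g = Z.of_nat n -> 0 < x ->
  let u := IZR (ma g) * x + IZR (mb g) in let w := IZR (mc g) * x + IZR (md g) in
  slash1 2 k (dPhi r) g (RtoC x) = RtoC (INR n * (/ w ^ 2 * (dphi r (u / w) * ln w ^ k))).
Proof.
intros Hn Hr Hg Hdet Hx; cbv zeta.
destruct (det_pos_linear_pos n g x Hn Hg Hdet Hx) as [Hu Hw].
unfold slash1; cbv zeta.
rewrite <- !RtoC_mult, <- !RtoC_plus, Clog_RtoC by exact Hw.
rewrite <- (RtoC_div _ _ ltac:(apply Rgt_not_eq, Hw)), dPhi_RtoC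
  by (trivial; apply Rdiv_lt_0_compat; assumption).
rewrite <- !RtoC_pow, <- RtoC_div, <- !RtoC_mult by (apply pow_nonzero; lra).
f_equal; rewrite Hdet, <- INR_IZR_INZ.
replace (INR 2 / 2) with 1 by (cbn; field); rewrite Rpower_1 by (apply lt_0_INR; lia).
unfold Rdiv; ring.
Qed.

(** * The zeta function on the real half-line beyond 1 *)

Lemma is_series_fst (a : nat -> R) (f : nat -> C) (l : C) :
  (forall i, f i = RtoC (a i)) -> @is_series C_AbsRing C_NormedModule f l -> is_series a (fst l).
Proof.
intros H Hl P [eps HP].
specialize (Hl (fun z => P (fst z))); unfold filtermap in *.
assert (Hs : forall N, fst (sum_n (G := C_NormedModule) f N) = sum_n a N).
{ intros N; induction N as [|N IH]; [rewrite !sum_O, H; reflexivity|].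
  rewrite !sum_Sn, H, <- IH; reflexivity. }
assert (Hloc : locally (T := C_NormedModule) l (fun z => P (fst z))).
{ exists eps; intros z Hz; apply HP, Hz. }
specialize (Hl Hloc); revert Hl; apply filter_imp; intros N; rewrite Hs; trivial.
Qed.

Lemma zeta_RtoC zeta s : is_zeta zeta -> 1 < s -> fst (zeta (RtoC s)) = rzeta s.
Proof.
intros [Hz _] Hs; symmetry; apply is_series_unique.
apply (is_series_fst _ _ (zeta (RtoC s))) with (2 := Hz (RtoC s) Hs); intros i.
rewrite <- RtoC_opp, <- RtoC_mult, Cexp_RtoC; reflexivity.
Qed.

Lemma Stieltjes_real gam : are_Stieltjes_constants gam -> forall s, 1 < s ->
  is_series (fun j => (-1) ^ j * gam j / INR (fact j) * (s - 1) ^ j) (rzeta s - 1 / (s - 1)).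
Proof.
intros (zeta & Hz & Hs) s Hs1.
assert (Hne : RtoC s <> RtoC 1) by (intros E; apply RtoC_inj in E; lra).
specialize (Hs (RtoC s) Hne).
rewrite <- (zeta_RtoC zeta s Hz Hs1).
replace (fst (zeta (RtoC s)) - 1 / (s - 1))
  with (fst (zeta (RtoC s) - RtoC 1 / (RtoC s - RtoC 1))%C).
- revert Hs; apply is_series_fst; intros j.
  rewrite <- RtoC_minus, <- RtoC_pow, <- RtoC_mult; reflexivity.
- rewrite <- RtoC_minus, <- RtoC_div by lra; destruct (zeta (RtoC s)); reflexivity.
Qed.

Theorem theorem1p3 (n k : nat) (Tn v : comb) (gam : nat -> R)
  (hn : (1 <= n)%nat) (hk : (1 <= k)%nat)
  (hTn : in_R n Tn)
  (hHecke : acts_like_Hecke n Tn)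
  (hv : in_R n v)
  (hvT : req Tn v)
  (hnonneg : List.Forall (fun t => nonneg_entries (snd t)) v)
  (hgam : are_Stieltjes_constants gam)
  (x : R) (hx : 0 < x) :
  Csum (fun r : nat =>
    (RtoC (Binomial.C k r) * (RtoC (1 / INR n) *
      (slash 2 (k - r) (dPhi r) v (RtoC x)
       - RtoC (INR n * Rsum (fun l : nat => (ln (INR l) ^ (k - r) / INR l)%R) (divisors n))
         * dPhi r (RtoC x))))%C) (seq 1 k)
  = RtoC (Rsum (fun r : nat =>
      Binomial.C k r * gamma_tilde gam (k - r) *
      (Rsum (fun t : Q * mat =>
         let a := IZR (ma (snd t)) in let b := IZR (mb (snd t)) in
         let c := IZR (mc (snd t)) in let d := IZR (md (snd t)) in
         Q2R (fst t) * (ln (a * x + b) ^ r / ((a * x + b) * (c * x + d)))) v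
       - Rsum (fun l : nat => ln (INR l * x) ^ r / (INR l * x)) (divisors n)))
      (seq 1 k)).
Proof.
etransitivity; [|exact (f_equal RtoC
  (Hecke_dphi_positive n Tn v gam x hn hHecke hv hvT hnonneg (Stieltjes_real gam hgam) hx k))].
apply Csum_RtoC; intros r Hr; apply in_seq in Hr.
unfold slash; rewrite (Csum_RtoC (fun t => INR n * (Q2R (fst t) *
  (/ (IZR (mc (snd t)) * x + IZR (md (snd t))) ^ 2 *
   (dphi r ((IZR (ma (snd t)) * x + IZR (mb (snd t))) / (IZR (mc (snd t)) * x + IZR (md (snd t))))
    * ln (IZR (mc (snd t)) * x + IZR (md (snd t))) ^ (k - r)))))).
- rewrite dPhi_RtoC by (trivial; lia).
  rewrite <- RtoC_mult, <- RtoC_minus, <- !RtoC_mult, Rsum_scal; f_equal.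
  assert (INR n <> 0) by (apply not_0_INR; lia); field; assumption.
- intros t Ht; unfold in_R in hv; rewrite Forall_forall in hv, hnonneg.
  rewrite (slash_dPhi n _ r _ _ hn (proj1 Hr) (hnonneg t Ht) (hv t Ht) hx).
  rewrite <- RtoC_mult; f_equal; ring.
Qed.
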